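(* Consider a Brill-Lindquist-Riemann sum for $(A,B)$, with metrics $g_n$, and let $g=(\chi\psi)^2g_{\mathbb E}$. Fix $R>\sqrt3D$. There exists a constant $C$ of class $\mathscr C^+[R]$ such that $$d^{GH}\big((\mathcal V_{n,R},g_n),(B(0,R),g)\big)<C\big(\tfrac1n+\ell_n\big)$$ for all $n$ which are large relative to $\mathscr C$. In particular, if the sequence of Brill-Lindquist-Riemann sums has shallow wells then $(\mathcal V_{n,R},g_n)$ converges in the Gromov-Hausdorff sense to $(B(0,R),g)$.
   Context: $g_{\mathbb E}$ is the Euclidean metric on $\mathbb R^3$, $B(p,r)$ the open Euclidean ball. Fix $D>0$ and smooth non-negative functions $A,B$ supported in $[-D,D]^3$. For each $n\in\mathbb N$ subdivide $[-D,D]^3$ into $(2n)^3$ boxes of side $D/n$, with centers $p_{i,n}$. A Brill-Lindquist-Riemann sum for $(A,B)$ is given by parameters $\alpha_{i,n},\beta_{i,n}\ge0$ with $$\mathscr C(\alpha,A):=\sup_{i,n}n^4|\alpha_{i,n}-A(p_{i,n})(D/n)^3|<\infty,\qquad\mathscr C(\beta,B):=\sup_{i,n}n^4|\beta_{i,n}-B(p_{i,n})(D/n)^3|<\infty,$$ and the metrics $g_n=(\chi_n\psi_n)^2g_{\mathbb E}$, where $\chi_n(x)=1+\sum_i\frac{\alpha_{i,n}}{|x-p_{i,n}|}$, $\psi_n(x)=1+\sum_i\frac{\beta_{i,n}}{|x-p_{i,n}|}$. Boxes with $\alpha_{i,n}=\beta_{i,n}=0$ are disregarded: $i$ ranges over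 boxes with $\alpha_{i,n}+\beta_{i,n}\ne0$. Put $\mathcal P_{n,*}=\{p_{i,n}:\alpha_{i,n}+\beta_{i,n}\ne0\}$, $\mathcal P_{n,**}=\{p_{i,n}:\alpha_{i,n}\beta_{i,n}\ne0\}$. Also $\chi(x)=1+\int\frac{A(y)}{|x-y|}dy$, $\psi(x)=1+\int\frac{B(y)}{|x-y|}dy$. Constants of class $\mathscr C$ are polynomial expressions in $\|A\|D^2$, $\|B\|D^2$, $\mathscr C(\alpha,A)/D$, $\mathscr C(\beta,B)/D$ with universal non-negative real coefficients; class $\mathscr C^+$ allows in addition the variables $\|dA\|D^3$, $\|dB\|D^3$ (Euclidean $L^\infty(\mathbb R^3)$-norms). Constants of class $\mathscr C^+[R]$ are polynomials in $R$ whose coefficients are of class $\mathscr C^+$. A property holds for $n$ large relative to $\mathscr C$ if it holds for all $n\ge N$ for some $N$ of class $\mathscr C$. For $n$ large relative to $\mathscr C$ and each $p_{i,n}\in\mathcal P_{n,**}$ there is a unique closed minimal surface $\Sigma_{i,n}$ for $g_n$ contained in $|x-p_{i,n}|\le D/(2n)$, and it is of the form $\{p_{i,n}+\mathcal S_{i,n}(\omega)\omega:\omega\in S^2\}$ with $\mathcal S_{i,n}:S^2\to(0,\infty)$. Let $\mathrm{Out}_R(\Sigma_{i,n})$ be the connected component of $B(0,R)\smallsetminus\Sigma_{i,n}$ not containing $p_{i,n}$, and $\mathcal V_{n,R}:=\big(\bigcap_i\mathrm{Out}_R(\Sigma_{i,n})\big)\smallsetminus\mathcal P_{n,*}$, the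 intersection being over all $p_{i,n}\in\mathcal P_{n,**}$ (and equal to $B(0,R)$ if there are none). $\ell_n:=\max_i\frac1D(\alpha_{i,n}+\beta_{i,n})|\ln(\alpha_{i,n}\beta_{i,n}/D^2)|$ if $\mathcal P_{n,**}=\mathcal P_{n,*}$ and $\ell_n:=\infty$ otherwise. The sequence has deep wells if $\mathcal P_{n,**}\ne\mathcal P_{n,*}$ for some $n$ or $(\ell_n)$ is unbounded; otherwise it has no deep wells. It has shallow wells if it has no deep wells and $\lim_{n\to\infty}\ell_n=0$. A set with a Riemannian metric is regarded as a metric space with distance given by the infimum of lengths of piecewise smooth paths inside the set. $d^{GH}$ is the Gromov-Hausdorff distance: the infimum of Hausdorff distances of images under distance-preserving maps into a common metric space.
   Formalization: The strict bound is stated only for n with ℓ_n finite: if ℓ_n=∞, (V_{n,R},g_n) is unbounded near a pole with only one of α,β nonzero, so both sides are infinite and ''<'' fails. The suprema defining C(α,A) and C(β,B) run over all boxes, including those with α=β=0. *)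

(* Defs.v *)
From HB Require Import structures.
From mathcomp Require Import all_boot all_order all_algebra.
From mathcomp Require Import all_classical all_reals all_analysis.
(* Without notations, which clash with those of the analysis *)
From mathcomp Require Import (canonicals) mpoly.

Set Implicit Arguments.
Unset Strict Implicit.
Unset Printing Implicit Defensive.

Import Order.TTheory GRing.Theory Num.Theory.
Import numFieldNormedType.Exports.

Local Open Scope classical_set_scope.
Local Open Scope ring_scope.

(* The library norm `|x| on 'rV[R]_3 is the sup norm, which has the same
   topology and the same notion of derivative as the Euclidean one. *)
Notation vec3 R := 'rV[R]_3.

Definition enorm (R : realType) (x : vec3 R) : R :=
  Num.sqrt (\sum_(i < 3) x 0 i ^+ 2).

Definition eball (R : realType) (p : vec3 R) (r : R) : set (vec3 R) :=
  [set x | enorm (x - p) < r].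

Definition partial (R : realType) (i : 'I_3) (f : vec3 R -> R) : vec3 R -> R :=
  fun x => 'D_(delta_mx 0 i) f x.

Definition grad (R : realType) (f : vec3 R -> R) : vec3 R -> vec3 R :=
  fun x => \row_i partial i f x.

Fixpoint Ck_on (R : realType) (k : nat) (U : set (vec3 R)) (f : vec3 R -> R)
    : Prop :=
  (forall x, U x -> {for x, continuous f}) /\
  (if k is k'.+1 then
     forall i : 'I_3,
       (forall x, U x -> derivable f x (delta_mx 0 i)) /\
       Ck_on k' U (partial i f)
   else True).

(* Meant for open U. *)
Definition smooth_on (R : realType) (U : set (vec3 R)) (f : vec3 R -> R) :=
  forall k, Ck_on k U f.

Definition smooth_curve (R : realType) (c : R -> vec3 R) :=
  forall (k : nat) (t : R), derivable (derive1n k c) t 1.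

(* Lebesgue measure on R^3 lives on the product type R * R * R. *)
Definition leb3 (R : realType) : {measure set _ -> \bar R} :=
  ((@lebesgue_measure R \x @lebesgue_measure R) \x @lebesgue_measure R)%E.

Definition to_vec (R : realType) (y : R * R * R) : vec3 R :=
  \row_(j < 3) [:: y.1.1; y.1.2; y.2]`_j.

Definition Linfty_norm (R : realType) (f : vec3 R -> R) : R :=
  fine (Lnorm (leb3 R) +oo%E (fun y => (f (to_vec y))%:E)).

Definition potential (R : realType) (A : vec3 R -> R) (x : vec3 R) : R :=
  1 + \int[leb3 R]_y (A (to_vec y) / enorm (x - to_vec y)).

(* A conformal metric u^2 g_E is represented by its factor u > 0. *)

(* gamma : [0,1] -> R^3 is piecewise smooth when it agrees, on each closed
   interval of a subdivision, with a smooth curve; it is then continuous. *)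
Definition piecewise_smooth (R : realType) (gamma : R -> vec3 R) :=
  exists s : seq R, itv_partition 0 1 s /\
    forall k, (k < size s)%N ->
      exists c : R -> vec3 R, smooth_curve c /\
        forall t, nth 0 (0 :: s) k <= t <= nth 0 s k -> gamma t = c t.

(* derive1 takes an arbitrary value at the finitely many break points. *)
Definition conf_length (R : realType) (u : vec3 R -> R) (gamma : R -> vec3 R)
    : \bar R :=
  (\int[lebesgue_measure]_(t in `[0%R, 1%R])
     (u (gamma t) * enorm (derive1 gamma t))%:E)%E.

(* +oo when no path in V joins x to y *)
Definition conf_dist (R : realType) (u : vec3 R -> R) (V : set (vec3 R))
    (x y : vec3 R) : \bar R :=
  ereal_inf [set conf_length u gamma | gamma in
    [set gamma | [/\ piecewise_smooth gamma, gamma 0 = x, gamma 1 = y &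
                   forall t, 0 <= t <= 1 -> V (gamma t)]]].

Definition hausdorff_dist (R : realType) (M : metricType R) (X Y : set M)
    : \bar R :=
  maxe (ereal_sup [set ereal_inf [set (mdist x y)%:E | y in Y] | x in X])
       (ereal_sup [set ereal_inf [set (mdist x y)%:E | x in X] | y in Y]).

Definition dist_preserving (R : realType) (T : Type) (X : set T)
    (dX : T -> T -> \bar R) (M : metricType R) (f : T -> M) :=
  forall x y, X x -> X y -> (mdist (f x) (f y))%:E = dX x y.

Definition GH_dist (R : realType) (T T' : Type)
    (X : set T) (dX : T -> T -> \bar R)
    (Y : set T') (dY : T' -> T' -> \bar R) : \bar R :=
  ereal_inf [set h | exists (M : metricType R) (f : T -> M) (f' : T' -> M),
    [/\ dist_preserving X dX f, dist_preserving Y dY f' &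
        h = hausdorff_dist (f @` X) (f' @` Y)]].

(* g-unit normal to the level sets of f, where g = u^2 g_E:
   grad_g f / |grad_g f|_g with grad_g f = u^-2 grad f *)
Definition conf_normal (R : realType) (u f : vec3 R -> R) (x : vec3 R)
    : vec3 R :=
  (u x * enorm (grad f x))^-1 *: grad f x.

(* div_g X = det(g)^(-1/2) d_i (det(g)^(1/2) X^i) with det(g)^(1/2) = u^3 *)
Definition conf_div (R : realType) (u : vec3 R -> R) (X : vec3 R -> vec3 R)
    (x : vec3 R) : R :=
  (u x ^+ 3)^-1 *
  \sum_(i < 3) partial i (fun z => u z ^+ 3 * X z 0 i) x.

(* Mean curvature, for u^2 g_E, of the level set of f through x: the trace of
   the second fundamental form is the divergence of the unit normal field. *)
Definition mean_curvature (R : realType) (u f : vec3 R -> R) (x : vec3 R) : R :=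
  conf_div u (conf_normal u f) x.

(* Compact smooth embedded surface without boundary, given near each of its
   points as a regular level set, with vanishing mean curvature *)
Definition closed_minimal_surface (R : realType) (u : vec3 R -> R)
    (S : set (vec3 R)) :=
  [/\ S !=set0, compact S &
      forall x, S x -> exists (U : set (vec3 R)) (f : vec3 R -> R),
        [/\ open U, U x & smooth_on U f] /\
        [/\ forall y, U y -> (S y <-> f y = 0),
            forall y, U y -> grad f y != 0 &
            forall y, U y -> S y -> mean_curvature u f y = 0]].

Definition is_radial_graph (R : realType) (p : vec3 R) (S : set (vec3 R)) :=
  exists s : vec3 R -> R,
    (forall w, enorm w = 1 -> 0 < s w) /\
    S = [set p + s w *: w | w in [set w | enorm w = 1]].

(* The (2n)^3 boxes of side D / n in [-D, D]^3; none for n = 0 *)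
Definition box (n : nat) := {ffun 'I_3 -> 'I_(2 * n)}.

Definition center (R : realType) (D : R) (n : nat) (i : box n) : vec3 R :=
  \row_j (- D + ((i j)%:R + 2^-1) * (D / n%:R)).

(* Supremum over all boxes, including those with alpha = beta = 0: only in
   this way do boxes without a pole force A and B to be small there. *)
Definition defect (R : realType) (D : R) (A : vec3 R -> R)
    (alpha : forall n, box n -> R) : \bar R :=
  ereal_sup [set z | exists (n : nat) (i : box n),
    z = (n%:R ^+ 4 *
         `|alpha n i - A (center D i) * (D / n%:R) ^+ 3|)%:E].

Definition admissible_density (R : realType) (D : R) (A : vec3 R -> R) :=
  [/\ smooth_on setT A, forall x, 0 <= A x &
      forall x, A x != 0 -> forall j, `|x 0 j| <= D].

Record BLR_sum (R : realType) (D : R) (A B : vec3 R -> R)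
    (alpha beta : forall n, box n -> R) : Prop := {
  BLR_D_gt0 : 0 < D ;
  BLR_A : admissible_density D A ;
  BLR_B : admissible_density D B ;
  BLR_alpha_ge0 : forall n (i : box n), 0 <= alpha n i ;
  BLR_beta_ge0 : forall n (i : box n), 0 <= beta n i ;
  BLR_alpha_defect : (defect D A alpha < +oo)%E ;
  BLR_beta_defect : (defect D B beta < +oo)%E }.

(* Boxes with zero parameter contribute nothing to the sum. *)
Definition potential_sum (R : realType) (D : R)
    (alpha : forall n, box n -> R) (n : nat) (x : vec3 R) : R :=
  1 + \sum_(i : box n) alpha n i / enorm (x - center D i).

Definition factor_n (R : realType) (D : R) (alpha beta : forall n, box n -> R)
    (n : nat) (x : vec3 R) : R :=
  potential_sum D alpha n x * potential_sum D beta n x.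

Definition limit_factor (R : realType) (A B : vec3 R -> R) (x : vec3 R) : R :=
  potential A x * potential B x.

(* P_{n,*} *)
Definition poles (R : realType) (D : R) (alpha beta : forall n, box n -> R)
    (n : nat) : set (vec3 R) :=
  [set center D i | i in [set i : box n | alpha n i + beta n i != 0]].

(* P_{n,**} *)
Definition double_poles (R : realType) (D : R)
    (alpha beta : forall n, box n -> R) (n : nat) : set (vec3 R) :=
  [set center D i | i in [set i : box n | alpha n i * beta n i != 0]].

(* For n large there is exactly one closed minimal surface in that ball, and it
   is a radial graph; so this determines Sigma_{i,n}. *)
Definition neck_surface (R : realType) (D : R)
    (alpha beta : forall n, box n -> R) (n : nat) (i : box n)
    (S : set (vec3 R)) :=
  [/\ closed_minimal_surface (factor_n D alpha beta n) S,
      S `<=` [set x | enorm (x - center D i) <= D / (2 * n%:R)] &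
      is_radial_graph (center D i) S].

(* The ball minus S has two components; Out is the one that misses p, i.e. the
   set of points that are not in the component of p. *)
Definition Out (R : realType) (rho : R) (p : vec3 R) (S : set (vec3 R))
    : set (vec3 R) :=
  [set x | (eball 0 rho `\` S) x /\
           ~ connected_component (eball 0 rho `\` S) x p].

Definition V_region (R : realType) (D : R) (alpha beta : forall n, box n -> R)
    (n : nat) (Sigma : box n -> set (vec3 R)) (rho : R) : set (vec3 R) :=
  (eball 0 rho `&`
   \bigcap_(i in [set i : box n | alpha n i * beta n i != 0])
      Out rho (center D i) (Sigma i))
  `\` poles D alpha beta n.

(* The maximum is over i with alpha + beta != 0, and 0 if there is no such i. *)
Definition ell (R : realType) (D : R) (alpha beta : forall n, box n -> R)
    (n : nat) : \bar R :=
  if `[< double_poles D alpha beta n = poles D alpha beta n >] then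
    (\big[Num.max/0]_(i : box n | alpha n i + beta n i != 0)
       (D^-1 * (alpha n i + beta n i) *
        `|ln (alpha n i * beta n i / D ^+ 2)|))%:E
  else +oo%E.

Definition deep_wells (R : realType) (D : R)
    (alpha beta : forall n, box n -> R) :=
  (exists2 n : nat, (0 < n)%N &
     double_poles D alpha beta n <> poles D alpha beta n) \/
  ~ (exists M : R, forall n : nat, (0 < n)%N ->
       (ell D alpha beta n <= M%:E)%E).

Definition shallow_wells (R : realType) (D : R)
    (alpha beta : forall n, box n -> R) :=
  ~ deep_wells D alpha beta /\ ell D alpha beta n @[n --> \oo] --> 0%E.

(* A constant of class C is the value at vars_C of a polynomial with
   non-negative coefficients that does not depend on any of the data; class C+
   is the same with vars_Cplus. *)
Definition nonneg_coefs (R : realType) (k : nat) (p : mpoly.mpoly k R) :=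
  forall m, 0 <= mpoly.mcoeff m p.

Definition vars_C (R : realType) (D : R) (A B : vec3 R -> R)
    (alpha beta : forall n, box n -> R) (i : 'I_4) : R :=
  [:: Linfty_norm A * D ^+ 2; Linfty_norm B * D ^+ 2;
      fine (defect D A alpha) / D; fine (defect D B beta) / D]`_i.

Definition vars_Cplus (R : realType) (D : R) (A B : vec3 R -> R)
    (alpha beta : forall n, box n -> R) (i : 'I_6) : R :=
  [:: Linfty_norm A * D ^+ 2; Linfty_norm B * D ^+ 2;
      fine (defect D A alpha) / D; fine (defect D B beta) / D;
      Linfty_norm (fun x => enorm (grad A x)) * D ^+ 3;
      Linfty_norm (fun x => enorm (grad B x)) * D ^+ 3]`_i.

Definition const_C (R : realType) (N : mpoly.mpoly 4 R) (D : R)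
    (A B : vec3 R -> R) (alpha beta : forall n, box n -> R) : R :=
  mpoly.meval (vars_C D A B alpha beta) N.

(* Class C+[rho]: polynomials in rho with coefficients of class C+ *)
Definition nonneg_coefs_poly (R : realType) (k : nat)
    (p : {poly mpoly.mpoly k R}) :=
  forall j, nonneg_coefs p`_j.

Definition const_CplusR (R : realType) (C : {poly mpoly.mpoly 6 R}) (D : R)
    (A B : vec3 R -> R) (alpha beta : forall n, box n -> R) (rho : R) : R :=
  (map_poly (mpoly.meval (vars_Cplus D A B alpha beta)) C).[rho].

(* Main.v *)
(* Put s = D/n and r = D/n^2. At points at distance at least r/2 from the poles, factor_n and
   limit_factor agree up to O(1/n): the boxes at distance at least 8s are compared one by one
   (A is Lipschitz and the lattice sum of 1/|x - p_j|^2 is O(n^3)), the boundedly many others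
   contribute O(1/n) to both sides; limit_factor <= factor_n + O(1/n) even holds everywhere.
   Comparing the mean curvature of a neck surface with that of the spheres about p_i that touch it
   from inside and from outside (maximum principle) shows that its radius is comparable to the
   square root of alpha_i beta_i. Hence V contains all points at distance at least r/2 from the
   poles and is stable under moving radially away from a nearby pole, and a radial segment from
   a point of V to the sphere of radius r has length O(1/n + ell_n): every doubling of the radius
   costs O(alpha_i + beta_i), and there are O(|ln(alpha_i beta_i / D^2)|) of them.
   A curve is then replaced by a chain of segments of length about s/4 whose end points are at
   distance at least r from the poles and which make a detour of length O(r) around the balls of
   radius r/2. So the two distances differ by O(1/n + ell_n) on V, which is O(1/n)-dense in the
   ball, and gluing the two metric spaces along V bounds the Gromov-Hausdorff distance. *)
Require Import Defs.
From HB Require Import structures.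
From mathcomp Require Import all_boot all_order all_algebra.
From mathcomp Require Import all_classical all_reals all_analysis.
From mathcomp Require Import (canonicals) mpoly.
From mathcomp Require Import measurable_realfun ess_sup_inf.
From mathcomp Require Import ring lra zify.

Set Implicit Arguments.
Unset Strict Implicit.
Unset Printing Implicit Defensive.

Import Order.TTheory GRing.Theory Num.Theory.
Import numFieldNormedType.Exports.

Local Open Scope classical_set_scope.
Local Open Scope ring_scope.

(** The scale r = D/n^2 lies between two others: centers are at least D/n apart, while the weights,
    and with them the neck radii, are O(D/n^3). So a single pole contributes only O(1/n) at distance
    r/2, and all necks lie inside the balls of radius r/2 once n is large. This uses bounds on the
    weights but not on gradients, so the threshold for n is of class C; gradients enter through the
    comparison of the factors, hence only in the rate. The two comparisons of distances differ in
    nature. A curve in V is also a curve in the ball, where limit_factor is at most (1 + O(1/n))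
    times factor_n, so it can be kept. A curve in the ball may run through poles and must be
    replaced. As both factors are at least 1, the number of segments is controlled by the length of
    the curve, and each segment costs an excess O(s/n); so the total excess is O(1/n) times the
    length, up to one more segment. Points of a detour are compared with every point of the arc that
    it replaces, so that no modulus of continuity of limit_factor is involved. *)

Local Notation center := Defs.center.

(** * Euclidean space *)

Lemma subr_continuous (R : numFieldType) (V : normedModType R) (p : V) :
  continuous (fun x => x - p).
Proof. by move=> x; apply: cvgB; [exact: cvg_id|exact: cvg_cst]. Qed.

Section Euclidean.
Context {R : realType}.
Implicit Types (x y z v w : vec3 R) (a b c : R).

Definition dot x y : R := \sum_(i < 3) x 0 i * y 0 i.

Lemma dotC x y : dot x y = dot y x.
Proof. by apply: eq_bigr => i _; rewrite mulrC. Qed.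

Lemma dotDl x y z : dot (x + y) z = dot x z + dot y z.
Proof. by rewrite -big_split /=; apply: eq_bigr => i _; rewrite !mxE mulrDl. Qed.

Lemma dotZl a x y : dot (a *: x) y = a * dot x y.
Proof. by rewrite /dot big_distrr /=; apply: eq_bigr => i _; rewrite !mxE mulrA. Qed.

Lemma dotDr x y z : dot x (y + z) = dot x y + dot x z.
Proof. by rewrite dotC dotDl !(dotC x). Qed.

Lemma dotZr a x y : dot x (a *: y) = a * dot x y.
Proof. by rewrite dotC dotZl dotC. Qed.

Lemma dotNl x y : dot (- x) y = - dot x y.
Proof. by rewrite -scaleN1r dotZl mulN1r. Qed.

Lemma dotNr x y : dot x (- y) = - dot x y.
Proof. by rewrite dotC dotNl dotC. Qed.

Lemma dot0l x : dot 0 x = 0.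
Proof. by rewrite -(scale0r x) dotZl mul0r. Qed.

Lemma dot0r x : dot x 0 = 0. Proof. by rewrite dotC dot0l. Qed.

Definition dotE := (dotDl, dotDr, dotZl, dotZr, dotNl, dotNr).

Lemma dotxx_ge0 x : 0 <= dot x x.
Proof. by apply: sumr_ge0 => i _; rewrite -expr2 sqr_ge0. Qed.

Lemma dot_enorm x : dot x x = enorm x ^+ 2.
Proof.
rewrite sqr_sqrtr; last by apply: sumr_ge0 => i _; rewrite sqr_ge0.
by apply: eq_bigr => i _; rewrite expr2.
Qed.

Lemma enorm_ge0 x : 0 <= enorm x. Proof. exact: sqrtr_ge0. Qed.
Hint Resolve enorm_ge0 : core.

Lemma enormE x : enorm x = Num.sqrt (dot x x).
Proof. by rewrite dot_enorm sqrtr_sqr ger0_norm. Qed.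

Lemma enorm0 : enorm (0 : vec3 R) = 0.
Proof. by rewrite enormE dot0l sqrtr0. Qed.

Lemma enorm_eq0 x : (enorm x == 0) = (x == 0).
Proof.
apply/eqP/eqP => [|->]; last exact: enorm0.
move=> x0; have : dot x x = 0 by rewrite dot_enorm x0 expr0n.
move=> /eqP; rewrite psumr_eq0; last by move=> i _; rewrite -expr2 sqr_ge0.
move=> /allP h; apply/matrixP => i j; rewrite ord1 mxE.
by have := h j (mem_index_enum _); rewrite /= -expr2 sqrf_eq0 => /eqP.
Qed.

Lemma enorm_gt0 x : (0 < enorm x) = (x != 0).
Proof. by rewrite lt_def enorm_eq0 enorm_ge0 andbT. Qed.

Lemma enormZ a x : enorm (a *: x) = `|a| * enorm x.
Proof.
rewrite !enormE !dotE mulrA -expr2 sqrtrM ?sqr_ge0//.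
by rewrite sqrtr_sqr.
Qed.

Lemma enormN x : enorm (- x) = enorm x.
Proof. by rewrite -scaleN1r enormZ normrN1 mul1r. Qed.

Lemma enormBC x y : enorm (x - y) = enorm (y - x).
Proof. by rewrite -enormN opprB. Qed.

Lemma CauchySchwarz x y : dot x y <= enorm x * enorm y.
Proof.
have [->|x0] := eqVneq x 0; first by rewrite dot0l enorm0 mul0r.
have [->|y0] := eqVneq y 0; first by rewrite dot0r enorm0 mulr0.
have xp : 0 < enorm x by rewrite enorm_gt0.
have yp : 0 < enorm y by rewrite enorm_gt0.
have := dotxx_ge0 (enorm y *: x - enorm x *: y).
rewrite !dotE !dot_enorm (dotC y x) => h.
have : 0 <= 2 * (enorm x * enorm y) * (enorm x * enorm y - dot x y).
  by apply: le_trans h _; rewrite le_eqVlt; apply/orP; left; apply/eqP; ring.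
by rewrite pmulr_rge0 ?subr_ge0// !mulr_gt0.
Qed.

Lemma enormD x y : enorm (x + y) <= enorm x + enorm y.
Proof.
rewrite -(@ler_pXn2r _ 2)// ?nnegrE ?addr_ge0// -dot_enorm !dotE !dot_enorm.
by rewrite (dotC y x); have := CauchySchwarz x y; nra.
Qed.

Lemma enormB x y : enorm x - enorm y <= enorm (x - y).
Proof. by rewrite lerBlDr -{1}(subrK y x) enormD. Qed.

Lemma enorm_triangle y x z : enorm (x - z) <= enorm (x - y) + enorm (y - z).
Proof. by rewrite -[x - z](subrKA y) enormD. Qed.

Lemma coord_le_enorm x i : `|x 0 i| <= enorm x.
Proof.
rewrite -(@ler_pXn2r _ 2)// ?nnegrE// -dot_enorm -normrX ger0_norm ?sqr_ge0//.
rewrite /dot (bigD1 i)//= -expr2 lerDl.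
by apply: sumr_ge0 => j _; rewrite -expr2 sqr_ge0.
Qed.

Lemma enorm_delta (i : 'I_3) : enorm (delta_mx 0 i : vec3 R) = 1.
Proof.
rewrite enormE /dot (bigD1 i)//= !mxE !eqxx mulr1 big1 ?addr0 ?sqrtr1// => j ji.
by rewrite mxE (negbTE ji) andbF mul0r.
Qed.

Lemma vec3_sum x : x = \sum_(i < 3) x 0 i *: delta_mx 0 i.
Proof. exact: row_sum_delta. Qed.

Lemma enorm_le_sum x : enorm x <= \sum_(i < 3) `|x 0 i|.
Proof.
rewrite {1}(vec3_sum x).
apply: (@le_trans _ _ (\sum_(i < 3) enorm (x 0 i *: delta_mx 0 i))).
  elim/big_ind2 : _ => [|a b c d ab cd|//]; first by rewrite enorm0.
  by apply: le_trans (enormD _ _) (lerD _ _).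
by apply: ler_sum => i _; rewrite enormZ enorm_delta mulr1.
Qed.

Lemma coord_le_norm x i : `|x 0 i| <= `|x|.
Proof.
rewrite [leRHS]/Num.norm /= mx_normrE.
exact: (le_bigmax _ (fun ij => `|x ij.1 ij.2|) (0, i)).
Qed.

Lemma norm_le_enorm x : `|x| <= enorm x.
Proof.
rewrite [leLHS]/Num.norm /= mx_normrE; apply/bigmax_leP; split => //= -[i j] _ /=.
by rewrite ord1; exact: coord_le_enorm.
Qed.

Lemma enorm_le_norm x : enorm x <= 3 * `|x|.
Proof.
apply: le_trans (enorm_le_sum x) _.
apply: (@le_trans _ _ (\sum_(i < 3) `|x|)).
  by apply: ler_sum => i _; exact: coord_le_norm.
by rewrite big_const_ord iter_addr_0 mulr_natl.
Qed.

Lemma enorm_continuous : continuous (@enorm R).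
Proof.
move=> x; apply/(@cvgrPdist_lt R R _ (nbhs x)) => e e0.
near=> y; have : `|x - y| < e / 3.
  near: y; change (nbhs x (ball_ Num.norm x (e / 3))); rewrite ball_normE.
  by apply: nbhsx_ballx; rewrite divr_gt0.
move=> h; apply: (@le_lt_trans _ _ (enorm (x - y))).
  by rewrite ler_norml enormB andbT lerNl opprB enormBC enormB.
by apply: le_lt_trans (enorm_le_norm _) _; rewrite mulrC -ltr_pdivlMr.
Unshelve. all: by end_near. Qed.

Lemma eball_convex (p : vec3 R) (r : R) x y (t : R) :
  eball p r x -> eball p r y -> 0 <= t <= 1 -> eball p r (x + t *: (y - x)).
Proof.
rewrite /eball /= => hx hy /andP[t0 t1].
have -> : x + t *: (y - x) - p = (1 - t) *: (x - p) + t *: (y - p).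
  by apply/matrixP => i j; rewrite !mxE; ring.
apply: le_lt_trans (enormD _ _) _; rewrite !enormZ !ger0_norm ?subr_ge0//.
have [->|tn] := eqVneq t 0; first by rewrite subr0 mul1r mul0r addr0.
have tp : 0 < t by rewrite lt_def tn.
by nra.
Qed.

Lemma eball_open (p : vec3 R) (r : R) : open (eball p r).
Proof.
have -> : eball p r = (fun x => enorm (x - p)) @^-1` [set t | t < r] by [].
apply: open_comp; last exact: open_lt.
move=> x _; apply: (@continuous_comp _ _ _ (fun z => z - p)).
  exact: (@subr_continuous _ 'rV[R]_3).
exact: enorm_continuous.
Qed.

Lemma nbhs_eball (x : vec3 R) (U : set (vec3 R)) :
  nbhs x U -> exists2 d : R, 0 < d & forall y, enorm (y - x) < d -> U y.
Proof.
move=> /nbhs_ballP[d /= d0 h]; exists d => // y hy; apply: h.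
rewrite -ball_normE /ball_ /=; apply: le_lt_trans hy.
by rewrite distrC; exact: norm_le_enorm.
Qed.

Lemma eball_nbhs (x : vec3 R) (d : R) : 0 < d -> nbhs x (eball x d).
Proof.
move=> d0; apply: open_nbhs_nbhs; split; first exact: eball_open.
by rewrite /eball/= subrr enorm0.
Qed.

End Euclidean.
#[export] Hint Resolve enorm_ge0 : core.

(** * Lattice sums *)

Section LatticeSums.
Context {R : realType}.
Variables (D : R) (n : nat).
Hypotheses (D0 : 0 < D) (n0 : (0 < n)%N).
Let s := D / n%:R.

Let nR0 : 0 < n%:R :> R. Proof. by rewrite ltr0n. Qed.
Let s0 : 0 < s. Proof. by rewrite divr_gt0. Qed.

(** The sup norm is used because its balls are cubes: lattice points in them can be counted
    coordinate by coordinate. *)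
Definition near_boxes (x : vec3 R) (c : R) : {set box n} :=
  [set j | (`|x - center D j| < c)%R]%SET.

(* Abel summation of [k^-2], in the shape of a pointwise inequality *)
Lemma inv_sq_le_shells (m : nat) (t : R) : 1 <= t ->
  (t ^+ 2)^-1 <= (m.+1%:R ^+ 2)^-1 +
    \sum_(i < m) ((i.+1%:R ^+ 2)^-1 - (i.+2%:R ^+ 2)^-1) * (t < i.+2%:R)%R%:R.
Proof.
move=> t1; have tp : 0 < t by apply: lt_le_trans t1.
have wge0 i : 0 <= (i.+1%:R ^+ 2)^-1 - (i.+2%:R ^+ 2)^-1 :> R.
  rewrite subr_ge0 lef_pV2 ?posrE ?exprn_gt0 ?ltr0n//.
  by rewrite ler_pXn2r ?nnegrE ?ler_nat.
elim: m => [|m IH].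
  by rewrite big_ord0 addr0 lef_pV2 ?posrE ?exprn_gt0 ?ltr0n// expr1n expr_ge1// ltW.
rewrite big_ord_recr /=; have [tm|tm] := ltP t m.+2%:R.
  move: IH; set S := \sum_(i < m) _; set a := m.+1%:R ^- 2; set b := m.+2%:R ^- 2.
  by rewrite mulr1 (_ : b + (S + (a - b)) = a + S)//; ring.
rewrite mulr0 addr0; apply: (@le_trans _ _ (m.+2%:R ^+ 2)^-1).
  rewrite lef_pV2 ?posrE ?exprn_gt0 ?ltr0n//.
  by rewrite ler_pXn2r ?nnegrE// ltW.
by rewrite lerDl; apply: sumr_ge0 => i _; rewrite mulr_ge0.
Qed.

(** The integers in question lie in a window of 2m consecutive ones that starts at floor(xi) - m +
    1. *)
Lemma lattice_count1 (xi : R) (m : nat) : exists z : int, forall k : nat,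
  `|xi - k%:R| < m%:R -> (0 <= k%:Z - z < (2 * m)%N%:Z)%R.
Proof.
exists (Num.floor xi - m%:Z + 1) => k.
rewrite ltr_norml => /andP[h1 h2].
have f1 := Num.Theory.ge_floor xi; have f2 := Num.Theory.floorD1_gt xi.
have a1 : (Num.floor xi - m%:Z < k%:Z)%R.
  rewrite -(ltr_int R) rmorphB /= -!pmulrn; lra.
have a2 : (k%:Z < Num.floor xi + 1 + m%:Z)%R.
  rewrite -(ltr_int R) !rmorphD /= -!pmulrn; lra.
rewrite PoszM; lia.
Qed.

Lemma lattice_count (x : vec3 R) (m : nat) :
  (#|near_boxes x (m%:R * s)| <= (2 * m) ^ 3)%N.
Proof.
have [->|m0] := posnP m.
  rewrite (_ : near_boxes _ _ = finset.set0) ?cards0//.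
  by apply/setP => j; rewrite !inE mul0r; apply/negbTE; rewrite -leNgt.
have /choice[z hz] : forall k : 'I_3, exists z : int, forall j : nat,
    `|(x 0 k + D) / s - 2^-1 - j%:R| < m%:R -> (0 <= j%:Z - z < (2 * m)%N%:Z)%R.
  by move=> k; exact: lattice_count1.
have m2 : (0 < 2 * m)%N by rewrite muln_gt0.
(* The offset from the start of the window is already below 2m for near boxes; the reduction modulo
   2m only makes [f] total. *)
pose f (j : box n) : {ffun 'I_3 -> 'I_(2 * m)} :=
  [ffun k => Ordinal (ltn_pmod `|(j k)%:Z - z k| m2)].
have inA (j : box n) : (`|x - center D j| < m%:R * s)%R -> forall k,
    (0 <= (j k)%:Z - z k < (2 * m)%N%:Z)%R.
  move=> h k; apply: hz.
  have := le_lt_trans (coord_le_norm (x - center D j) k) h.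
  rewrite !mxE -/s.
  have -> : x 0 k - (- D + ((j k)%:R + 2^-1) * s)
     = ((x 0 k + D) / s - 2^-1 - (j k)%:R) * s.
    by field; rewrite gt_eqF.
  by rewrite normrM (gtr0_norm s0) ltr_pM2r.
rewrite -[X in (_ <= X)%N](_ : #|{ffun 'I_3 -> 'I_(2 * m)}| = _)%N; last first.
  by rewrite card_ffun !card_ord.
apply: (leq_trans _ (max_card (f @: near_boxes x (m%:R * s)))).
rewrite card_in_imset// => i j; rewrite !inE => /inA hi /inA hj fij.
apply/ffunP => k; apply: val_inj => /=.
move/ffunP/(_ k) : fij; rewrite !ffunE => /(congr1 val) /=.
move: (hi k) (hj k) => hik hjk.
rewrite !modn_small; [lia|lia|lia].
Qed.

Lemma card_box : #|{: box n}| = (8 * n ^ 3)%N.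
Proof. by rewrite card_ffun !card_ord expnMn. Qed.

(** In units of s the shell inequality with n - 1 shells applies to every term. Its constant 1/n^2
    occurs for all 8n^3 boxes and gives 8n; shell i gives at most w_i * 8(i+2)^3 <= 48, a bound that
    is attained for i = 0. Altogether 56n / s^2. *)
Lemma lattice_sum_inv_sq (x : vec3 R) :
  \sum_(j : box n | s <= `|x - center D j|) (`|x - center D j| ^+ 2)^-1
  <= 56 * n%:R ^+ 3 / D ^+ 2.
Proof.
pose t (j : box n) := `|x - center D j| / s.
pose w (i : nat) : R := (i.+1%:R ^+ 2)^-1 - (i.+2%:R ^+ 2)^-1.
have w0 i : 0 <= w i.
  rewrite subr_ge0 lef_pV2 ?posrE ?exprn_gt0 ?ltr0n//.
  by rewrite ler_pXn2r ?nnegrE ?ler_nat.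
apply: (@le_trans _ _ (\sum_(j : box n) (s ^+ 2)^-1 *
    ((n%:R ^+ 2)^-1 + \sum_(i < n.-1) w i * (t j < i.+2%:R)%R%:R))).
  rewrite big_mkcond; apply: ler_sum => j _.
  case: ifPn => [h|_]; last first.
    by rewrite mulr_ge0 ?invr_ge0 ?sqr_ge0// addr_ge0 ?invr_ge0 ?sqr_ge0// sumr_ge0// => i _; rewrite mulr_ge0.
  have -> : (`|x - center D j| ^+ 2)^-1 = (s ^+ 2)^-1 * (t j ^+ 2)^-1.
    rewrite /t -invfM -exprMn; congr (_ ^+ 2)^-1.
    by rewrite mulrC divfK// gt_eqF.
  rewrite ler_pM2l ?invr_gt0 ?exprn_gt0//.
  have := @inv_sq_le_shells n.-1 (t j); rewrite prednK//; apply.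
  by rewrite ler_pdivlMr// mul1r.
rewrite -big_distrr /= big_split /= sumr_const card_box exchange_big /=.
have h i : \sum_(j : box n) w i * (t j < i.+2%:R)%R%:R <= 48.
  rewrite -big_distrr /=.
  have -> : \sum_(j : box n) (t j < i.+2%:R)%R%:R =
      #|near_boxes x (i.+2%:R * s)|%:R :> R.
    rewrite -sum1_card natr_sum [RHS]big_mkcond; apply: eq_bigr => j _.
    by rewrite inE /t ltr_pdivrMr//; case: ifP.
  apply: (@le_trans _ _ (w i * (8 * i.+2%:R ^+ 3))).
    apply: ler_wpM2l => //; rewrite -natrX -natrM ler_nat.
    by have := lattice_count x i.+2; rewrite expnMn.
  have i0 : 0 <= i%:R :> R by [].
  rewrite /w -[i.+2%:R]natr1 -[i.+1%:R]natr1; set a := i%:R in i0 *.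
  have -> : ((a + 1) ^+ 2)^-1 - ((a + 1 + 1) ^+ 2)^-1 =
     (2 * a + 3) / ((a + 1) ^+ 2 * (a + 1 + 1) ^+ 2).
    by field; rewrite !gt_eqF//; lra.
  rewrite mulrAC ler_pdivrMr; last by rewrite mulr_gt0// exprn_gt0//; lra.
  rewrite -subr_ge0.
  have -> : 48 * ((a + 1) ^+ 2 * (a + 1 + 1) ^+ 2) -
     (2 * a + 3) * (8 * (a + 1 + 1) ^+ 3) =
    (a + 1 + 1) ^+ 2 * (32 * a ^+ 2 + 40 * a) by ring.
  by rewrite mulr_ge0 ?sqr_ge0// addr_ge0// mulr_ge0// sqr_ge0.
apply: (@le_trans _ _ ((s ^+ 2)^-1 * ((n%:R ^+ 2)^-1 *+ (8 * n ^ 3) + 48 * n%:R))).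
  apply: ler_wpM2l; first by rewrite invr_ge0 sqr_ge0.
  apply: lerD => //.
  apply: (@le_trans _ _ (\sum_(i < n.-1) 48)); first by apply: ler_sum => i _; exact: h.
  rewrite sumr_const card_ord -[X in X <= _]mulr_natr ler_wpM2l// ler_nat.
  exact: leq_pred.
rewrite -[_ *+ (8 * n ^ 3)]mulr_natr natrM natrX /s.
have -> : ((D / n%:R) ^+ 2)^-1 * ((n%:R ^+ 2)^-1 * (8 * n%:R ^+ 3) + 48 * n%:R) =
  56 * n%:R ^+ 3 / D ^+ 2 :> R by field; rewrite !gt_eqF.
by [].
Qed.

(** By 1/t <= 1/(2D) + D/(2t^2) this follows from the number 8n^3 of boxes and the previous sum: 4 +
    28 = 32. *)
Lemma lattice_sum_inv (x : vec3 R) :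
  \sum_(j : box n | s <= `|x - center D j|) `|x - center D j|^-1
  <= 32 * n%:R ^+ 3 / D.
Proof.
apply: (@le_trans _ _ (\sum_(j : box n | s <= `|x - center D j|)
   (2^-1 * D^-1 + 2^-1 * D * (`|x - center D j| ^+ 2)^-1))).
  apply: ler_sum => j h.
  have z0 : 0 < `|x - center D j| by apply: lt_le_trans h.
  set a := `|_|^-1; rewrite -exprVn -/a -subr_ge0.
  have -> : 2^-1 * D^-1 + 2^-1 * D * a ^+ 2 - a = (2 * D)^-1 * (D * a - 1) ^+ 2.
    by field; rewrite gt_eqF.
  by rewrite mulr_ge0 ?sqr_ge0// invr_ge0 mulr_ge0// ltW.
rewrite big_split /=.
apply: (@le_trans _ _ ((2^-1 * D^-1) * (8 * n ^ 3)%N%:R +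
   2^-1 * D * (56 * n%:R ^+ 3 / D ^+ 2))).
  apply: lerD; last first.
    rewrite -big_distrr /=; apply: ler_wpM2l; last exact: lattice_sum_inv_sq.
    by rewrite mulr_ge0// ltW.
  apply: (@le_trans _ _ (\sum_(j : box n) 2^-1 / D)).
    rewrite big_mkcond; apply: ler_sum => j _; case: ifP => // _.
    by rewrite mulr_ge0 ?invr_ge0 ?(ltW D0).
  by rewrite sumr_const card_box mulr_natr.
rewrite natrM natrX le_eqVlt; apply/orP; left; apply/eqP; field; rewrite gt_eqF//.
Qed.

End LatticeSums.

(** * Piecewise smooth curves *)

Lemma derivable_continuous (R : numFieldType) (V : normedModType R) (f : R -> V)
    (t : R) :
  derivable f t 1 -> {for t, continuous f}.
Proof. by move=> /derivable1_diffP; exact: differentiable_continuous. Qed.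

Section SmoothCurves.
Context {R : realType}.
Implicit Types (c : R -> vec3 R) (w : vec3 R).

Lemma smooth_curve_derivable c : smooth_curve c -> forall t, derivable c t 1.
Proof. by move=> h t; exact: (h 0%N). Qed.

Lemma smooth_curve_derive1 c : smooth_curve c -> smooth_curve (derive1 c).
Proof. by move=> h k t; have := h k.+1 t; rewrite /derive1n iterSr. Qed.

Lemma smooth_curve_continuous c : smooth_curve c -> continuous c.
Proof. by move=> h t; apply: derivable_continuous; exact: smooth_curve_derivable. Qed.

Lemma dot_continuous w : continuous (dot w).
Proof.
move=> x; apply/(@cvgrPdist_lt R R _ (nbhs x)) => e e0.
have [d d0 hd] := @nbhs_eball _ x _ (@eball_nbhs _ x (e / (enorm w + 1))
  (divr_gt0 e0 (ltr_wpDl (enorm_ge0 w) ltr01))).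
apply: filterS (@eball_nbhs _ x _ d0) => y /hd; rewrite /eball/= => hy.
rewrite -dotNr -dotDr; apply: (@le_lt_trans _ _ (enorm w * enorm (x - y))).
  rewrite ler_norml CauchySchwarz andbT lerNl -dotNr.
  by rewrite -[leRHS](congr1 (fun z => enorm w * z) (enormN (x - y))) CauchySchwarz.
have w1 : 0 < enorm w + 1 by exact: ltr_wpDl (enorm_ge0 w) ltr01.
rewrite enormBC; move: hy; rewrite ltr_pdivlMr// => hy.
by apply: le_lt_trans hy; rewrite mulrDr mulr1 mulrC lerDl enorm_ge0.
Qed.

Lemma is_derive_dot w (c : R -> vec3 R) (t : R) dc :
  is_derive t (1 : R) c dc -> is_derive t (1 : R) (fun z => dot w (c z)) (dot w dc).
Proof.
move=> [hc <-].
have h : (fun h : R => h^-1 *: (((fun z => dot w (c z)) \o shift t) (h *: 1) -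
    dot w (c t))) = dot w \o (fun h : R => h^-1 *: ((c \o shift t) (h *: 1) - c t)).
  by apply/funext => x /=; rewrite dotZr dotDr dotNr.
have hl : (fun h : R => h^-1 *: (((fun z => dot w (c z)) \o shift t) (h *: 1) -
    dot w (c t))) @ 0^' --> dot w ('D_1 c t).
  by rewrite h; apply: (@continuous_cvg _ _ _ _ _ (fun h : R => h^-1 *: ((c \o shift t) (h *: 1) - c t)) (dot w) ('D_1 c t)); [exact: dot_continuous|exact: hc].
by split; [apply/cvg_ex; exists (dot w ('D_1 c t))|exact/cvg_lim].
Qed.

Lemma is_derive_smooth c (t : R) : smooth_curve c -> is_derive t (1 : R) c (derive1 c t).
Proof.
move=> h; rewrite derive1E; apply: derivableP; exact: smooth_curve_derivable.
Qed.

(** Reduces smoothness, which concerns all iterates of [derive1], to finding a class of curves that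
    is closed under one derivation. *)
Lemma smooth_curve_coind (P : (R -> vec3 R) -> Prop) :
  (forall c, P c -> (forall t, derivable c t 1) /\ P (derive1 c)) ->
  forall c, P c -> smooth_curve c.
Proof.
move=> h c Pc k; suff : P (derive1n k c) by move=> /h[].
by elim: k => [//|k IH]; case: (h _ IH).
Qed.

Lemma smooth_curve_affine (c : R -> vec3 R) (k l : R) : smooth_curve c ->
  smooth_curve (fun t => c (k * t + l)) /\
  forall t, derive1 (fun t => c (k * t + l)) t = k *: derive1 c (k * t + l).
Proof.
have key (e : R -> vec3 R) : smooth_curve e -> forall t : R,
    is_derive t (1 : R) (fun t => e (k * t + l)) (k *: derive1 e (k * t + l)).
  move=> he t.
  have ha : is_derive t (1 : R) (fun t : R => k * t + l) k.
    by apply: is_derive_eq; rewrite /GRing.scale/= !(mulr1, addr0, mulr0).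
  have da : differentiable (fun t : R => k * t + l) t by apply/derivable1_diffP.
  have de : differentiable e (k * t + l).
    by apply/derivable1_diffP; exact: smooth_curve_derivable.
  split; first exact/derivable1_diffP/differentiable_comp.
  rewrite deriveE; last exact: differentiable_comp.
  rewrite (_ : (fun _ => _) = e \o (fun t => k * t + l))//.
  rewrite (diff_comp da de) /= -(deriveE _ da) (@derive_val _ _ _ _ _ _ _ ha).
  by rewrite derive1E (deriveE _ de) -linearZ /= /GRing.scale/= mulr1.
move=> hc; split; last by move=> t; rewrite derive1E; apply: derive_val; exact: key.
(* The class has to allow a scalar factor, since each derivation brings out another [k]. *)
apply: (@smooth_curve_coind (fun e => exists a f, smooth_curve f /\
    e = fun t => a *: f (k * t + l))); last first.
  by exists 1, c; split => //; apply/funext => t; rewrite scale1r.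
move=> _ [a [f [sf ->]]].
have key2 (t : R) : is_derive t (1 : R) (fun t => a *: f (k * t + l))
    (a *: (k *: derive1 f (k * t + l))).
  by apply: is_deriveZ; exact: key.
split; first by move=> t; apply: ex_derive.
exists (a * k), (derive1 f); split; first exact: smooth_curve_derive1.
apply/funext => t; rewrite derive1E (@derive_val _ _ _ _ _ _ _ (key2 t)).
by rewrite scalerA.
Qed.

End SmoothCurves.

Section Partition.
Context {R : realType}.

(* The curve pieces cut out by a subdivision need not be handled explicitly: a relation between
   parameters that is additive and holds along smooth arcs holds along the whole curve. *)
Lemma piecewise_smooth_rect (gamma : R -> vec3 R) (Q : R -> R -> Prop) :
  (forall a b c, 0 <= a -> a <= b -> b <= c -> c <= 1 -> Q a b -> Q b c -> Q a c) ->
  (forall c a b, smooth_curve c -> 0 <= a -> a <= b -> b <= 1 ->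
     (forall t, a <= t <= b -> gamma t = c t) -> Q a b) ->
  piecewise_smooth gamma -> forall a b, 0 <= a -> a <= b -> b <= 1 -> Q a b.
Proof.
move=> Qadd Qpiece [s [hs pieces]].
suff: forall x, 0 <= x -> x < 1 -> itv_partition x 1 s ->
    (forall k, (k < size s)%N -> exists c, smooth_curve c /\
      forall t, nth 0 (x :: s) k <= t <= nth 0 s k -> gamma t = c t) ->
    forall a b, x <= a -> a <= b -> b <= 1 -> Q a b.
  by move=> /(_ 0); apply.
move=> {hs pieces}; elim: s => [|y s IH] x x0 x1 hs pieces a b xa ab b1.
  by move: x1; rewrite (itv_partition_nil hs) ltxx.
have [c [sc hc]] := pieces 0%N isT; rewrite /= in hc.
have xy : x < y by move: hs => [/= /andP[]].
have hs' := itv_partition_cons hs.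
have a0 := le_trans x0 xa.
have [b_le|yb] := leP b y.
  apply: (Qpiece c) => // t /andP[ta tb]; apply: hc.
  by rewrite (le_trans xa ta) (le_trans tb b_le).
have y1 := lt_le_trans yb b1.
have y0 : 0 <= y by rewrite (le_trans x0)// ltW.
have IHy : forall a b, y <= a -> a <= b -> b <= 1 -> Q a b.
  by apply: IH => // k ks; exact: (pieces k.+1).
have [ya|ay] := leP y a; first exact: IHy.
apply: (Qadd _ y) => //; [exact: ltW|exact: ltW| |by apply: IHy => //; exact: ltW].
apply: (Qpiece c) => //; [exact: ltW|exact: ltW|].
move=> t /andP[ta tb]; apply: hc; rewrite tb andbT; exact: le_trans ta.
Qed.

(** Strictly between the end points the two curves agree in a neighborhood of [t]; at an end point
    [gamma] may have a corner. *)
Lemma derive1_piece (gamma c : R -> vec3 R) (a b t : R) : smooth_curve c ->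
  (forall t, a <= t <= b -> gamma t = c t) -> a < t < b ->
  derive1 gamma t = derive1 c t.
Proof.
move=> sc h tab; rewrite !derive1E; apply: near_eq_derive.
have /near_in_itvoo : t \in `]a, b[ by rewrite in_itv.
apply: filterS => y; rewrite in_itv /= => /andP[ay yb].
by apply: h; rewrite !ltW.
Qed.

End Partition.

(** * Length of curves *)

Lemma itv_setU (R : realType) (a b c : R) : a <= b -> b <= c ->
  `[a, c]%classic = `[a, b]%classic `|` `[b, c]%classic.
Proof.
move=> ab bc; apply/seteqP; split => t /=; rewrite !in_itv /=.
  by move=> /andP[h1 h2]; case: (leP t b) => [h|/ltW h]; [left|right]; apply/andP.
by move=> [/andP[h1 h2]|/andP[h1 h2]]; apply/andP; split => //;
  [exact: le_trans bc|exact: le_trans ab _].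
Qed.

Section Length.
Context {R : realType}.
Implicit Types (c gamma : R -> vec3 R).
Local Notation mu := (@lebesgue_measure R).

Definition speed (u : vec3 R -> R) gamma (t : R) : \bar R :=
  (u (gamma t) * enorm (derive1 gamma t))%:E.

Definition arc_length (u : vec3 R -> R) gamma (a b : R) : \bar R :=
  (\int[mu]_(t in `[a, b]) speed u gamma t)%E.

Lemma conf_lengthE (u : vec3 R -> R) gamma : conf_length u gamma = arc_length u gamma 0 1.
Proof. by []. Qed.

Variables (u : vec3 R -> R) (V : set (vec3 R)).
Hypothesis u_cont : forall x, V x -> {for x, continuous u}.
Hypothesis u_ge0 : forall x, V x -> 0 <= u x.

Lemma speed_smooth_within c (a b : R) : smooth_curve c ->
  (forall t, a <= t <= b -> V (c t)) ->
  {within `[a, b], continuous (fun t => u (c t) * enorm (derive1 c t))}.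
Proof.
move=> sc cV; apply: continuous_in_subspaceT => t; rewrite inE /= in_itv /= => tab.
apply: (@continuousM _ _ (u \o c) (fun t => enorm (derive1 c t))).
  apply: continuous_comp; first exact: smooth_curve_continuous.
  exact/u_cont/cV.
apply: (@continuous_comp _ _ _ (derive1 c)); last exact: enorm_continuous.
exact/smooth_curve_continuous/smooth_curve_derive1.
Qed.

Lemma speed_piece gamma c (a b t : R) : smooth_curve c ->
  (forall t, a <= t <= b -> gamma t = c t) -> a < t < b ->
  speed u gamma t = speed u c t.
Proof.
move=> sc h tab; rewrite /speed (derive1_piece sc h tab) h//.
by case/andP : tab => *; rewrite !ltW.
Qed.

(** At the end points [derive1 gamma] may be arbitrary, so these are split off as singletons, on
    which every function is measurable. In between, the speed is that of [c], hence continuous. *)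
Lemma speed_piece_measurable gamma c (a b : R) : smooth_curve c -> a <= b ->
  (forall t, a <= t <= b -> gamma t = c t) ->
  (forall t, a <= t <= b -> V (gamma t)) ->
  measurable_fun `[a, b] (speed u gamma).
Proof.
move=> sc ab h gV; have cV t : a <= t <= b -> V (c t).
  by move=> tab; rewrite -h//; exact: gV.
move: ab; rewrite le_eqVlt => /predU1P[<-|ab].
  by rewrite set_itv1; exact: measurable_fun_set1.
have -> : `[a, b]%classic = [set a] `|` `]a, b[%classic `|` [set b].
  by rewrite setU1itv ?bnd_simp// setUitv1 ?bnd_simp// ltW.
apply/measurable_funU => //; first exact: measurableU.
split; last exact: measurable_fun_set1.
apply/measurable_funU => //; split; first exact: measurable_fun_set1.
apply: (@eq_measurable_fun _ _ _ _ _ (speed u c)).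
  by move=> t; rewrite inE /= in_itv /= => tab; rewrite (speed_piece sc h).
apply/measurable_EFinP; apply: (@measurable_funS _ _ _ _ `[a, b]%classic) => //.
  by apply: subset_itvW; rewrite lexx.
by apply: measurable_realfun.subspace_continuous_measurable_fun => //; exact: speed_smooth_within.
Qed.

(** The two speeds may differ at the end points, which have measure zero: both integrals are taken
    over the open interval. *)
Lemma speed_piece_integral gamma c (a b : R) : smooth_curve c -> a <= b ->
  (forall t, a <= t <= b -> gamma t = c t) ->
  (forall t, a <= t <= b -> V (gamma t)) ->
  (arc_length u gamma a b = arc_length u c a b)%E.
Proof.
move=> sc ab h gV; have cV t : a <= t <= b -> V (c t).
  by move=> tab; rewrite -h//; exact: gV.
have sub : `]a, b[%classic `<=` `[a, b]%classic.
  by apply: subset_itvW; rewrite lexx.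
rewrite /arc_length; transitivity (\int[mu]_(t in `]a, b[) speed u gamma t)%E.
  apply: integral_itv_bndoo.
  exact: measurable_funS (speed_piece_measurable sc ab h gV).
transitivity (\int[mu]_(t in `]a, b[) speed u c t)%E.
  apply: eq_integral => t; rewrite inE /= in_itv /=; exact: speed_piece.
apply/esym; apply: integral_itv_bndoo.
exact: measurable_funS (speed_piece_measurable sc ab (fun=> fun=> erefl) cV).
Qed.

Lemma speed_measurable gamma (a b : R) : piecewise_smooth gamma ->
  (forall t, 0 <= t <= 1 -> V (gamma t)) -> 0 <= a -> a <= b -> b <= 1 ->
  measurable_fun `[a, b] (speed u gamma).
Proof.
move=> pg gV.
apply: (piecewise_smooth_rect _ _ pg (Q := fun a b => measurable_fun `[a, b] (speed u gamma))).
- move=> {}a {}b c _ ab bc _ m1 m2.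
  have -> : `[a, c]%classic = `[a, b]%classic `|` `[b, c]%classic.
    exact: itv_setU.
  by apply/measurable_funU.
- move=> c {}a {}b sc a0 ab b1 h; apply: (speed_piece_measurable sc) => // t /andP[at_ tb].
  by apply: gV; rewrite (le_trans a0 at_) (le_trans tb b1).
Qed.

Lemma speed_ge0 gamma (t : R) : V (gamma t) -> (0 <= speed u gamma t)%E.
Proof. by move=> h; rewrite lee_fin mulr_ge0 ?u_ge0 ?enorm_ge0. Qed.

Lemma speed_integral_cat gamma (a b c : R) : piecewise_smooth gamma ->
  (forall t, 0 <= t <= 1 -> V (gamma t)) -> 0 <= a -> a <= b -> b <= c -> c <= 1 ->
  (arc_length u gamma a c =
   arc_length u gamma a b +
   arc_length u gamma b c)%E.
Proof.
move=> pg gV a0 ab bc c1.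
have mac : measurable_fun `[a, c] (speed u gamma).
  by apply: speed_measurable => //; exact: le_trans bc.
have e : `[a, c]%classic = `[a, b[%classic `|` `[b, c]%classic.
  by rewrite -itv_bndbnd_setU ?bnd_simp.
rewrite /arc_length e ge0_integral_setU//=.
- congr (_ + _)%E; rewrite integral_itv_bndo_bndc//.
  by apply: measurable_funS mac => //; rewrite e; exact: subsetUl.
- by rewrite -e.
- move=> t ht; have : `[a, c]%classic t by rewrite e.
  rewrite /= in_itv /= => /andP[at_ tc].
  by apply/speed_ge0/gV; rewrite (le_trans a0 at_) (le_trans tc c1).
- apply/disj_setPS => t [] /=; rewrite !in_itv /= => /andP[_ h1] /andP[h2 _].
  by move: h1; rewrite ltNge h2.
Qed.

(** The bound by the chord is not additive in the parameters, but its pairing with a fixed [w] is;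
    this is what makes [piecewise_smooth_rect] applicable. On a smooth arc it is the fundamental
    theorem of calculus together with Cauchy-Schwarz. *)
Lemma speed_integral_ge_dot gamma (a b m : R) (w : vec3 R) : piecewise_smooth gamma ->
  (forall t, 0 <= t <= 1 -> V (gamma t)) -> 0 <= a -> a <= b -> b <= 1 ->
  0 <= m -> (forall t, a <= t <= b -> m <= u (gamma t)) -> enorm w <= 1 ->
  ((m * dot w (gamma b - gamma a))%:E <=
   arc_length u gamma a b)%E.
Proof.
move=> pg gV a0 ab b1 m0 + w1; move: a b a0 ab b1.
apply: (piecewise_smooth_rect _ _ pg (Q := fun a b => (forall t, a <= t <= b -> m <= u (gamma t)) ->
  ((m * dot w (gamma b - gamma a))%:E <=
   arc_length u gamma a b)%E)).
- move=> a b c a0 ab bc c1 m1 m2 h.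
  rewrite (speed_integral_cat pg gV a0 ab bc c1).
  apply: le_trans (leeD (m1 _) (m2 _)).
  + by rewrite -EFinD lee_fin -mulrDr -dotDr [gamma b - _ + _]addrC subrKA.
  + by move=> t /andP[ta tb]; apply: h; rewrite ta (le_trans tb).
  + by move=> t /andP[ta tb]; apply: h; rewrite tb andbT (le_trans _ ta).
move=> c a b sc a0 ab b1 h hm.
have gV' t : a <= t <= b -> V (gamma t).
  by move=> /andP[ta tb]; apply: gV; rewrite (le_trans a0 ta) (le_trans tb).
have cV t : a <= t <= b -> V (c t) by move=> tab; rewrite -h//; exact: gV'.
rewrite (speed_piece_integral sc ab h gV').
move: (ab); rewrite le_eqVlt => /predU1P[e|altb].
  by rewrite -e subrr dot0r mulr0 /arc_length integral_ge0// => t /=; rewrite in_itv /= => tab; apply: speed_ge0; apply: cV; rewrite -e.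
have dF (t : R) : is_derive t (1 : R) (fun t => m * dot w (c t)) (m * dot w (derive1 c t)).
  by apply: (is_deriveZ m); exact/is_derive_dot/is_derive_smooth.
have cf : continuous (fun t => m * dot w (derive1 c t)).
  move=> t; apply: (@continuousM _ _ (cst m) (fun t => dot w (derive1 c t))); first exact: cvg_cst.
  apply: (@continuous_comp _ _ _ (derive1 c)); last exact: dot_continuous.
  exact/smooth_curve_continuous/smooth_curve_derive1.
have cF : continuous (fun t => m * dot w (c t)).
  by move=> t; apply: derivable_continuous; exact: ex_derive.
have := @continuous_FTC2 _ (fun t => m * dot w (derive1 c t)) (fun t => m * dot w (c t)) a b altb.
move=> /(_ (continuous_subspaceT cf)) ftc.
rewrite (h a) ?lexx// (h b) ?lexx ?andbT// dotDr dotNr mulrBr EFinB -ftc; last 2 first.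
- split; first by move=> t _; exact: ex_derive.
  + by apply: cvg_at_right_filter; exact: cF.
  + by apply: cvg_at_left_filter; exact: cF.
- by move=> t _; rewrite derive1E (@derive_val _ _ _ _ _ _ _ (dF t)).
apply: le_integral => //.
- by apply: continuous_compact_integrable; [exact: segment_compact|exact: continuous_subspaceT].
- by apply: continuous_compact_integrable; [exact: segment_compact|exact: speed_smooth_within].
move=> t; rewrite inE /= in_itv /= => tab; rewrite lee_fin.
apply: (@le_trans _ _ (m * enorm (derive1 c t))).
  apply: ler_wpM2l => //; apply: le_trans (CauchySchwarz _ _) _.
  by rewrite -[leRHS]mul1r ler_wpM2r// enorm_ge0.
by rewrite ler_wpM2r ?enorm_ge0// -h// hm.
Qed.

(** The previous lemma with [w] the unit vector along the chord. *)
Lemma speed_integral_ge gamma (a b m : R) : piecewise_smooth gamma ->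
  (forall t, 0 <= t <= 1 -> V (gamma t)) -> 0 <= a -> a <= b -> b <= 1 ->
  0 <= m -> (forall t, a <= t <= b -> m <= u (gamma t)) ->
  ((m * enorm (gamma b - gamma a))%:E <=
   arc_length u gamma a b)%E.
Proof.
move=> pg gV a0 ab b1 m0 hm; set v := gamma b - gamma a.
have [v0|v0] := eqVneq v 0.
  rewrite v0 enorm0 mulr0 /arc_length integral_ge0// => t /=; rewrite in_itv /= => /andP[ta tb].
  by apply/speed_ge0/gV; rewrite (le_trans a0 ta) (le_trans tb).
have vp : 0 < enorm v by rewrite enorm_gt0.
have -> : enorm v = dot ((enorm v)^-1 *: v) v.
  by rewrite dotZl dot_enorm expr2 mulKf// gt_eqF.
apply: speed_integral_ge_dot => //.
by rewrite enormZ gtr0_norm ?invr_gt0// mulVf// gt_eqF.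
Qed.

End Length.

(** * The conformal distance *)

Section Subdivision.
Context {R : realType}.
Implicit Types (c gamma delta : R -> vec3 R).

(** [piecewise_smooth] on an arbitrary interval, so that subdivisions can be concatenated; on [0, 1]
    the two are convertible. *)
Definition smooth_pieces gamma (a b : R) := exists s : seq R, itv_partition a b s /\
  forall k, (k < size s)%N -> exists c, smooth_curve c /\
    forall t, nth 0 (a :: s) k <= t <= nth 0 s k -> gamma t = c t.

Lemma smooth_pieces_refl gamma (a : R) : smooth_pieces gamma a a.
Proof. by exists [::]; split; [split=> /=|]. Qed.

Lemma smooth_pieces_cat gamma (a b d : R) : smooth_pieces gamma a b ->
  smooth_pieces gamma b d -> smooth_pieces gamma a d.
Proof.
move=> [s]; elim: s a => [|y s IH] a [hs ps] hb; first by rewrite (itv_partition_nil hs).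
have [t [ht pt]] : smooth_pieces gamma y d.
  apply: (IH y) => //; split; first exact: itv_partition_cons hs.
  by move=> k ks; exact: (ps k.+1).
exists (y :: t); split.
  case: hs ht => /= /andP[ay _] _ [yt et]; split => //=; exact/andP.
by move=> [_|k kt]; [exact: (ps 0%N)|exact: pt].
Qed.

Lemma smooth_pieces1 gamma c (a b : R) : a <= b -> smooth_curve c ->
  (forall t, a <= t <= b -> gamma t = c t) -> smooth_pieces gamma a b.
Proof.
rewrite le_eqVlt => /predU1P[<- _ _|ab sc h]; first exact: smooth_pieces_refl.
by exists [:: b]; split; [exact: itv_partition1|move=> [|//] _; exists c].
Qed.

Lemma smooth_pieces_reparam gamma delta (k l : R) : 0 < k -> piecewise_smooth gamma ->
  (forall t, 0 <= k * t + l <= 1 -> delta t = gamma (k * t + l)) ->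
  smooth_pieces delta ((0 - l) / k) ((1 - l) / k).
Proof.
move=> k0 pg h.
apply: (piecewise_smooth_rect _ _ pg
  (Q := fun a b => smooth_pieces delta ((a - l) / k) ((b - l) / k))) => //.
  by move=> a b c _ _ _ _; exact: smooth_pieces_cat.
move=> c a b sc a0 ab b1 hc.
apply: (@smooth_pieces1 _ (fun t => c (k * t + l))).
- by rewrite ler_pM2r ?invr_gt0// lerB.
- by case: (smooth_curve_affine k l sc).
move=> t; rewrite ler_pdivrMr// ler_pdivlMr// mulrC => /andP[h1 h2].
rewrite h; first by apply: hc; lra.
by lra.
Qed.

Lemma smooth_pieces_rev gamma : piecewise_smooth gamma ->
  piecewise_smooth (fun t => gamma (1 - t)).
Proof.
move=> pg; have : smooth_pieces (fun t => gamma (1 - t)) (1 - 1) (1 - 0).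
  apply: (piecewise_smooth_rect _ _ pg
    (Q := fun a b => smooth_pieces (fun t => gamma (1 - t)) (1 - b) (1 - a))) => //.
    by move=> a b c _ _ _ _ h1 h2; exact: smooth_pieces_cat h2 h1.
  move=> c a b sc a0 ab b1 hc.
  apply: (@smooth_pieces1 _ (fun t => c (-1 * t + 1))).
  - by rewrite lerB.
  - by case: (smooth_curve_affine (-1) 1 sc).
  move=> t /andP[h1 h2]; rewrite (_ : -1 * t + 1 = 1 - t); last by ring.
  by apply: hc; lra.
by rewrite subrr subr0.
Qed.

Definition concat gamma delta (t : R) := if t <= 2^-1 then gamma (2 * t) else delta (2 * t - 1).

Lemma concatr gamma delta (t : R) : gamma 1 = delta 0 -> 2^-1 <= t ->
  concat gamma delta t = delta (2 * t - 1).
Proof.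
rewrite /concat => e t2; case: ifPn => // t2'.
have -> : t = 2^-1 by lra.
by rewrite divff// e subrr.
Qed.

Lemma piecewise_smooth_concat gamma delta : piecewise_smooth gamma ->
  piecewise_smooth delta -> gamma 1 = delta 0 -> piecewise_smooth (concat gamma delta).
Proof.
move=> pg pd e; apply: (@smooth_pieces_cat _ 0 2^-1 1).
  have := @smooth_pieces_reparam gamma (concat gamma delta) 2 0 (ltr0Sn _ _) pg.
  rewrite subrr mul0r subr0 mul1r; apply => t.
  by rewrite addr0 => ht; rewrite /concat ifT//; lra.
have := @smooth_pieces_reparam delta (concat gamma delta) 2 (-1) (ltr0Sn _ _) pd.
rewrite opprK add0r mul1r (_ : (1 + 1) / 2 = 1); last by rewrite divff.
by apply => t ht; rewrite concatr//; lra.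
Qed.

Lemma smooth_affine (p v : vec3 R) :
  smooth_curve (fun t : R => p + t *: v) /\ derive1 (fun t : R => p + t *: v) = cst v.
Proof.
have key (q w : vec3 R) (t : R) : is_derive t (1 : R) (fun t : R => q + t *: w) w.
  have cv : (fun h : R => h^-1 *: (((fun t => q + t *: w) \o shift t) (h *: 1) -
      (q + t *: w))) @ 0^' --> w.
    apply: cvg_near_cst; near=> h => /=.
    have h0 : h != 0 by near: h; exact: nbhs_dnbhs_neq.
    have -> : h *: (1 : R) = h by exact: mulr1.
    rewrite scalerDl opprD addrACA subrr add0r addrK.
    by rewrite scalerA mulVf// scale1r.
  by split; [apply/cvg_ex; exists w|exact/cvg_lim].
split; last by apply/funext => t; rewrite derive1E (@derive_val _ _ _ _ _ _ _ (key p v t)).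
apply: (@smooth_curve_coind _ (fun e => exists q w, e = fun t => q + t *: w)); last by exists p, v.
move=> _ [q [w ->]]; split; first by move=> t; exact: ex_derive.
exists w, 0; apply/funext => t; rewrite derive1E (@derive_val _ _ _ _ _ _ _ (key q w t)).
by rewrite scaler0 addr0.
Unshelve. all: by end_near. Qed.

End Subdivision.

(** * Metric properties of the conformal distance *)

Section ConfDist.
Context {R : realType}.
Implicit Types (c gamma delta : R -> vec3 R).
Local Notation mu := (@lebesgue_measure R).
Variables (u : vec3 R -> R) (V : set (vec3 R)).
Hypothesis u_cont : forall x, V x -> {for x, continuous u}.
Hypothesis u_ge0 : forall x, V x -> 0 <= u x.

Lemma speed_subst_affine c (a b k l : R) : 0 < k -> a <= b -> smooth_curve c ->
  (forall t, k * a + l <= t <= k * b + l -> V (c t)) ->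
  (arc_length u (fun t => c (k * t + l)) a b =
   arc_length u c (k * a + l) (k * b + l)).
Proof.
move=> k0 ab sc cV.
have dF (t : R) : is_derive t (1 : R) (fun t : R => k * t + l) k.
  by apply: is_derive_eq; rewrite /GRing.scale/= !(mulr1, addr0, mulr0).
have F' : derive1 (fun t : R => k * t + l) = cst k.
  by apply/funext => t; rewrite derive1E (@derive_val _ _ _ _ _ _ _ (dF t)).
have cF : continuous (fun t : R => k * t + l).
  by move=> t; apply: derivable_continuous; exact: ex_derive.
rewrite /arc_length; have := @integration_by_substitution_increasing R (fun t : R => k * t + l)
  (fun t => u (c t) * enorm (derive1 c t)) a b ab.
rewrite F' => ->.
- apply: eq_integral => t _; rewrite /speed /=; congr (_%:E).
  have [_ ->] := smooth_curve_affine k l sc.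
  by rewrite enormZ gtr0_norm// fctE /= mulrAC mulrA.
- by move=> x y _ _ xy; rewrite ltrD2r ltr_pM2l.
- by move=> x _; exact: cvg_cst.
- by apply/cvg_ex; exists k; exact: cvg_cst.
- by apply/cvg_ex; exists k; exact: cvg_cst.
- split; first by move=> t _; exact: ex_derive.
  + by apply: cvg_at_right_filter; exact: cF.
  + by apply: cvg_at_left_filter; exact: cF.
- exact: (speed_smooth_within u_cont sc cV).
Qed.

Lemma speed_subst_rev c (a b : R) : a <= b -> smooth_curve c ->
  (forall t, 1 - b <= t <= 1 - a -> V (c t)) ->
  (arc_length u (fun t => c (1 - t)) a b =
   arc_length u c (1 - b) (1 - a)).
Proof.
move=> ab sc cV.
have [se de] := smooth_curve_affine 1 1 sc.
(* The reflection t -> 1 - t is a shift by 1, covered by the previous lemma, combined with t ->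
   -t. *)
have -> : arc_length u c (1 - b) (1 - a) =
   arc_length u (fun t => c (1 * t + 1)) (- b) (- a).
  rewrite speed_subst_affine ?lerN2//.
    by rewrite !mul1r ![- _ + 1]addrC.
  by move=> t; rewrite !mul1r ![- _ + 1]addrC; exact: cV.
have cw : {within `[- b, - a], continuous (fun t => u (c (1 * t + 1)) *
    enorm (derive1 (fun t => c (1 * t + 1)) t))}.
  apply: (speed_smooth_within u_cont) => // t /andP[h1 h2].
  by apply: cV; rewrite mul1r; lra.
apply: etrans _ (esym (integration_by_substitution_oppr ab cw)).
rewrite /arc_length; apply: eq_integral => t _; apply: (congr1 EFin) => /=.
have e1 : (fun t => c (1 - t)) = (fun t => c (-1 * t + 1)).
  by apply/funext => z; rewrite mulN1r addrC.
have [_ e2] := smooth_curve_affine (-1) 1 sc.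
have e3 : 1 * (- t) + 1 = 1 - t :> R by ring.
have e4 : -1 * t + 1 = 1 - t :> R by ring.
by rewrite de e1 e2 e3 e4 scaleN1r enormN scale1r.
Qed.

Local Opaque arc_length.

Definition path_in gamma (x y : vec3 R) := [/\ piecewise_smooth gamma, gamma 0 = x, gamma 1 = y &
  forall t, 0 <= t <= 1 -> V (gamma t)].

(** Equality of the lengths of corresponding parts is additive, so it needs to be checked on smooth
    arcs only. The next lemma follows the same pattern. *)
Lemma conf_length_rev gamma (x y : vec3 R) : path_in gamma x y ->
  path_in (fun t => gamma (1 - t)) y x /\
  conf_length u (fun t => gamma (1 - t)) = conf_length u gamma.
Proof.
move=> [pg g0 g1 gV].
have gV' t : 0 <= t <= 1 -> V (gamma (1 - t)) by move=> h; apply: gV; lra.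
have pr := smooth_pieces_rev pg.
split; first by split; rewrite ?subr0 ?subrr.
rewrite !conf_lengthE; have : (arc_length u (fun t => gamma (1 - t)) (1 - 1) (1 - 0)
   = arc_length u gamma 0 1); last by rewrite subrr subr0.
apply: (piecewise_smooth_rect _ _ pg (Q := fun a b =>
   (arc_length u (fun t => gamma (1 - t)) (1 - b) (1 - a)
   = arc_length u gamma a b))); [| |exact: lexx|exact: ler01|exact: lexx].
  move=> a b c a0 ab bc c1 h1 h2.
  rewrite (speed_integral_cat u_cont u_ge0 pg gV a0 ab bc c1) -h1 -h2 addeC.
  by apply: (speed_integral_cat u_cont u_ge0 pr gV'); lra.
move=> c a b sc a0 ab b1 hc.
have cV t : a <= t <= b -> V (c t) by move=> h; rewrite -hc//; apply: gV; lra.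
rewrite (speed_piece_integral u_cont sc ab hc); last by move=> t h; apply: gV; lra.
have [sr _] := smooth_curve_affine (-1) 1 sc.
have -> : arc_length u (fun t => gamma (1 - t)) (1 - b) (1 - a) =
    arc_length u (fun t => c (-1 * t + 1)) (1 - b) (1 - a).
  apply: (speed_piece_integral u_cont sr).
  - by lra.
  - move=> t h; have -> : -1 * t + 1 = 1 - t by ring.
    by apply: hc; lra.
  - by move=> t h; apply: gV'; lra.
have -> : (fun t => c (-1 * t + 1)) = (fun t => c (1 - t)).
  by apply/funext => z; rewrite mulN1r addrC.
rewrite speed_subst_rev ?lerB//.
  by rewrite !subKr.
by move=> t; rewrite !subKr; exact: cV.
Qed.

Lemma conf_length_concat gamma delta (x y z : vec3 R) : path_in gamma x y -> path_in delta y z ->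
  path_in (concat gamma delta) x z /\
  conf_length u (concat gamma delta) = (conf_length u gamma + conf_length u delta)%E.
Proof.
move=> [pg g0 g1 gV] [pd d0 d1 dV].
have e : gamma 1 = delta 0 by rewrite g1.
have pc := piecewise_smooth_concat pg pd e.
have cl t : t <= 2^-1 -> concat gamma delta t = gamma (2 * t) by rewrite /concat => ->.
have cr t : 2^-1 <= t -> concat gamma delta t = delta (2 * t - 1) by exact: concatr.
have cV t : 0 <= t <= 1 -> V (concat gamma delta t).
  move=> ht; have [h|/ltW h] := leP t 2^-1; first by rewrite cl//; apply: gV; lra.
  by rewrite cr//; apply: dV; lra.
split.
  by split => //; [rewrite cl ?mulr0// invr_ge0|rewrite cr ?mulr1 ?addrK//; lra].
(* One statement for both halves of the concatenation: it is used with (k, l) = (2, 0) for [gamma]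
   and (2, -1) for [delta]. *)
have key eta (k l : R) : 0 < k -> piecewise_smooth eta ->
    (forall t, 0 <= t <= 1 -> V (eta t)) -> 0 <= (0 - l) / k -> (1 - l) / k <= 1 ->
    (forall t, (0 - l) / k <= t <= (1 - l) / k -> concat gamma delta t = eta (k * t + l)) ->
    (arc_length u (concat gamma delta) ((0 - l) / k) ((1 - l) / k)
   = arc_length u eta 0 1).
  move=> k0 pe eV l0 l1 ce.
  have mono (a b : R) : a <= b -> (a - l) / k <= (b - l) / k.
    by move=> ab; rewrite ler_pM2r ?invr_gt0// lerB.
  have inv (a : R) : k * ((a - l) / k) + l = a.
    by rewrite mulrC divfK ?subrK// gt_eqF.
  apply: (piecewise_smooth_rect _ _ pe (Q := fun a b =>
    (arc_length u (concat gamma delta) ((a - l) / k) ((b - l) / k)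
   = arc_length u eta a b))); [| |exact: lexx|exact: ler01|exact: lexx].
    move=> a b c a0 ab bc c1 h1 h2.
    rewrite (speed_integral_cat u_cont u_ge0 pe eV a0 ab bc c1) -h1 -h2.
    apply: (speed_integral_cat u_cont u_ge0 pc cV).
    - exact: le_trans l0 (mono _ _ _).
    - exact: mono.
    - exact: mono.
    - exact: le_trans (mono _ _ _) l1.
  move=> c a b sc a0 ab b1 hc.
  have cV' t : a <= t <= b -> V (c t) by move=> h; rewrite -hc//; apply: eV; lra.
  have bnd t : (a - l) / k <= t <= (b - l) / k -> a <= k * t + l <= b.
    by rewrite ler_pdivrMr// ler_pdivlMr// mulrC; lra.
  rewrite (speed_piece_integral u_cont sc ab hc); last by move=> t h; apply: eV; lra.
  have [sr _] := smooth_curve_affine k l sc.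
  have -> : arc_length u (concat gamma delta) ((a - l) / k) ((b - l) / k) =
      arc_length u (fun t => c (k * t + l)) ((a - l) / k) ((b - l) / k).
    apply: (speed_piece_integral u_cont sr).
    - exact: mono.
    - move=> t h; rewrite ce; first by apply: hc; exact: bnd.
      by move: h => /andP[h1 h2]; rewrite (le_trans (mono _ _ a0) h1) (le_trans h2 (mono _ _ b1)).
    - move=> t /andP[h1 h2]; apply: cV; rewrite (le_trans (le_trans l0 (mono _ _ a0)) h1).
      by rewrite (le_trans h2 (le_trans (mono _ _ b1) l1)).
  rewrite speed_subst_affine ?inv//; exact: mono.
have h0 : 0 <= 2^-1 :> R by lra.
have h1 : 2^-1 <= 1 :> R by lra.
have lc := speed_integral_cat u_cont u_ge0 pc cV (lexx 0) h0 h1 (lexx 1).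
rewrite 3!conf_lengthE lc; apply: (congr2 adde).
  have := key gamma 2 0 (ltr0Sn _ _) pg gV; rewrite subrr mul0r subr0 mul1r; apply; [exact: lexx|by lra|].
  by move=> t /andP[_ h]; rewrite addr0 cl.
have := key delta 2 (-1) (ltr0Sn _ _) pd dV.
rewrite opprK add0r mul1r (_ : (1 + 1) / 2 = 1); last by rewrite divff.
apply; [by lra|exact: lexx|].
by move=> t /andP[h _]; rewrite cr.
Qed.

Lemma conf_dist_le gamma x y : path_in gamma x y -> (conf_dist u V x y <= conf_length u gamma)%E.
Proof. by move=> h; apply: ereal_inf_lbound; exists gamma. Qed.

Lemma conf_dist_sym x y : conf_dist u V x y = conf_dist u V y x.
Proof.
by apply/eqP; rewrite eq_le; apply/andP; split; apply: le_ereal_inf_tmp => _ [gamma h <-];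
  have [h' <-] := conf_length_rev h; exact: conf_dist_le.
Qed.

Lemma conf_dist_ge (x y : vec3 R) (m : R) : 0 <= m -> (forall z, V z -> m <= u z) ->
  ((m * enorm (y - x))%:E <= conf_dist u V x y)%E.
Proof.
move=> m0 hm; apply: le_ereal_inf_tmp => _ [gamma [pg <- <- gV] <-].
by apply: (speed_integral_ge u_cont u_ge0 pg gV) => // t h; exact/hm/gV.
Qed.

Lemma conf_dist_ge0 (x y : vec3 R) : (0 <= conf_dist u V x y)%E.
Proof. by have := @conf_dist_ge x y 0 (lexx _) u_ge0; rewrite mul0r. Qed.

Lemma conf_dist_triangle y x z :
  (conf_dist u V x z <= conf_dist u V x y + conf_dist u V y z)%E.
Proof.
have [->|fxy] := eqVneq (conf_dist u V x y) +oo%E.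
  rewrite addye ?leey//; apply/eqP => h; have := conf_dist_ge0 y z.
  by rewrite h.
have [->|fyz] := eqVneq (conf_dist u V y z) +oo%E.
  rewrite addey ?leey//; apply/eqP => h; have := conf_dist_ge0 x y.
  by rewrite h.
have f1 : conf_dist u V x y \is a fin_num by rewrite ge0_fin_numE ?conf_dist_ge0// lt_neqAle fxy leey.
have f2 : conf_dist u V y z \is a fin_num by rewrite ge0_fin_numE ?conf_dist_ge0// lt_neqAle fyz leey.
apply/lee_addgt0Pr => e e0; have e2 : 0 < e / 2 by rewrite divr_gt0.
have [_ [g hg <-] lg] := lb_ereal_inf_adherent e2 f1.
have [_ [d hd <-] ld] := lb_ereal_inf_adherent e2 f2.
have [h _] := conf_length_concat hg hd; apply: le_trans (conf_dist_le h) _.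
have [_ ->] := conf_length_concat hg hd.
have -> : e%:E = ((e / 2)%:E + (e / 2)%:E)%E by rewrite -EFinD -splitr.
by apply: le_trans (leeD (ltW lg) (ltW ld)) _; rewrite addeACA lexx.
Qed.

Lemma conf_dist_segment (x y : vec3 R) (M : R) : (forall t, 0 <= t <= 1 -> V (x + t *: (y - x))) ->
  (forall t, 0 <= t <= 1 -> u (x + t *: (y - x)) <= M) ->
  (conf_dist u V x y <= (M * enorm (y - x))%:E)%E.
Proof.
move=> sV sM; have [sc dc] := smooth_affine x (y - x).
have ps : piecewise_smooth (fun t : R => x + t *: (y - x)).
  by apply: (@smooth_pieces1 _ _ (fun t : R => x + t *: (y - x))).
apply: (@le_trans _ _ (conf_length u (fun t => x + t *: (y - x)))).
  by apply: conf_dist_le; split => //; rewrite ?scale0r ?addr0// scale1r addrC subrK.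
rewrite /conf_length.
apply: (@le_trans _ _ (\int[mu]_(t in `[0%R, 1%R]) (cst (M * enorm (y - x))%:E) t)%E); last first.
  by rewrite integral_cst//= lebesgue_measure_itv /= lte_fin ltr01 oppr0 adde0 mule1.
apply: ge0_le_integral => //.
- by move=> t /=; rewrite in_itv /= => h; apply: (speed_ge0 u_ge0); exact: sV.
- by have := speed_measurable u_cont ps sV (lexx _) ler01 (lexx _).
by move=> t /=; rewrite in_itv /= dc => h; rewrite lee_fin ler_wpM2r ?enorm_ge0// sM.
Qed.

Lemma conf_dist_refl x : V x -> conf_dist u V x x = 0%E.
Proof.
move=> Vx; apply/eqP; rewrite eq_le conf_dist_ge0 andbT.
have := @conf_dist_segment x x (u x); rewrite subrr enorm0 mulr0; apply => t _;
  by rewrite scaler0 addr0.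
Qed.

End ConfDist.

(** * Gluing metric spaces *)

Section Gluing.
Context {R : realType} {T : Type}.
Variables (X Y : set T) (a b : T -> T -> R) (e : R).

(** Two disjoint copies instead of a quotient: a point of [X] and its twin in [Y] remain distinct,
    at distance e > 0, so the result is a metric and not only a pseudometric. *)
Definition glued : Type := ({x : T | X x} + {y : T | Y y})%type.

Hypothesis XY : X `<=` Y.
Hypothesis X0 : X !=set0.
Hypothesis e0 : 0 < e.
Hypothesis axx : forall x, X x -> a x x = 0.
Hypothesis apos : forall x y, X x -> X y -> a x y = 0 -> x = y.
Hypothesis asym : forall x y, X x -> X y -> a x y = a y x.
Hypothesis atri : forall y x z, X x -> X y -> X z -> a x z <= a x y + a y z.
Hypothesis bxx : forall x, Y x -> b x x = 0.
Hypothesis bpos : forall x y, Y x -> Y y -> b x y = 0 -> x = y.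
Hypothesis bsym : forall x y, Y x -> Y y -> b x y = b y x.
Hypothesis btri : forall y x z, Y x -> Y y -> Y z -> b x z <= b x y + b y z.
Hypothesis ab : forall x y, X x -> X y -> a x y <= b x y + 2 * e.
Hypothesis ba : forall x y, X x -> X y -> b x y <= a x y + 2 * e.

Let a_ge0 x y : X x -> X y -> 0 <= a x y.
Proof. by move=> Xx Xy; have := @atri y x x Xx Xy Xx; rewrite axx// (asym Xy)//; lra. Qed.
Let b_ge0 x y : Y x -> Y y -> 0 <= b x y.
Proof. by move=> Xx Xy; have := @btri y x x Xx Xy Xx; rewrite bxx// (bsym Xy)//; lra. Qed.

(* Distance between the two copies in the metric space glued along [X] by bridges of length [e]. *)
Definition cross_dist (x y : T) : R := inf [set r | exists2 z, X z & r = a x z + e + b z y].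

Let cross_le x y z : X x -> Y y -> X z -> cross_dist x y <= a x z + e + b z y.
Proof.
move=> Xx Yy Xz; apply: ge_inf; last by exists z.
exists 0 => _ [w Xw ->]; rewrite !addr_ge0 ?a_ge0 ?b_ge0//; [exact: ltW|exact: XY].
Qed.

Let cross_ge x y m : (forall z, X z -> m <= a x z + e + b z y) -> m <= cross_dist x y.
Proof.
move=> h; apply: lb_le_inf; first by case: X0 => z Xz; exists (a x z + e + b z y), z.
by move=> _ [z Xz ->]; exact: h.
Qed.

Definition glued_dist (p q : glued) : R :=
  match p, q with
  | inl x, inl y => a (sval x) (sval y)
  | inr x, inr y => b (sval x) (sval y)
  | inl x, inr y => cross_dist (sval x) (sval y)
  | inr y, inl x => cross_dist (sval x) (sval y)
  end.

Let gxx p : glued_dist p p = 0.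
Proof. by case: p => -[x hx] /=; [exact: axx|exact: bxx]. Qed.

Let cross_gt0 x y : X x -> Y y -> 0 < cross_dist x y.
Proof.
move=> Xx Yy; apply: lt_le_trans e0 _; apply: cross_ge => z Xz.
have := a_ge0 Xx Xz; have := b_ge0 (XY Xz) Yy; lra.
Qed.

Let gpos p q : glued_dist p q = 0 -> p = q.
Proof.
case: p q => -[x hx] [] [y hy] /= h.
- by congr inl; apply: eq_exist; exact: apos.
- by have := cross_gt0 hx hy; rewrite h ltxx.
- by have := cross_gt0 hy hx; rewrite h ltxx.
- by congr inr; apply: eq_exist; exact: bpos.
Qed.

Let gsym p q : glued_dist p q = glued_dist q p.
Proof. by case: p q => -[x hx] [] [y hy] //=; [exact: asym|exact: bsym]. Qed.

(** The critical cases are those in which [p] and [r] are in one copy and [q] is in the other: a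
    path through [q] crosses two bridges, and their total length 2e is exactly the discrepancy that
    [ab] and [ba] allow. In the other cases the triangle inequality of one metric is enough. *)
Let gtri q p r : glued_dist p r <= glued_dist p q + glued_dist q r.
Proof.
case: p q r => -[x hx] [] [y hy] [] [z hz] /=.
- exact: atri.
- rewrite -lerBlDl; apply: cross_ge => w hw.
  by have := cross_le hx hz hw; have := atri hx hy hw; lra.
- rewrite addrC -lerBlDr; apply: cross_ge => w hw.
  rewrite lerBlDr addrC -lerBlDr; apply: cross_ge => v hv.
  have := ab hv hw; have := atri hx hv hz; have := atri hv hw hz.
  have := btri (XY hv) hy (XY hw); rewrite (bsym hy (XY hw)) (asym hz hw); lra.
- rewrite -lerBlDr; apply: cross_ge => w hw.
  by have := cross_le hx hz hw; have := btri (XY hw) hy hz; lra.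
- rewrite -lerBlDr; apply: cross_ge => w hw.
  have := cross_le hz hx hw; have := atri hz hy hw.
  by rewrite (asym hz hy); lra.
- rewrite addrC -lerBlDr; apply: cross_ge => w hw.
  rewrite lerBlDr addrC -lerBlDr; apply: cross_ge => v hv.
  have := ba hv hw; have := atri hv hy hw; have := btri hx (XY hv) hz.
  have := btri (XY hv) (XY hw) hz; rewrite (bsym hx (XY hv)) (asym hv hy); lra.
- rewrite -lerBlDl; apply: cross_ge => w hw.
  have := cross_le hz hx hw; have := btri (XY hw) hy hx.
  by rewrite (bsym hy hx); lra.
- exact: btri.
Qed.

HB.instance Definition _ := gen_eqMixin glued.
HB.instance Definition _ := gen_choiceMixin glued.
HB.instance Definition _ := @isMetric.Build R glued glued_dist gxx gpos gsym gtri.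

(** A point of [X] is at distance at most e from its twin; a point of [Y] is reached from the twin
    of a point of [X] near it, at cost at most e + e'. *)
Lemma GH_dist_glue (dX dY : T -> T -> \bar R) (e' : R) : 0 <= e' ->
  (forall x y, X x -> X y -> dX x y = (a x y)%:E) ->
  (forall x y, Y x -> Y y -> dY x y = (b x y)%:E) ->
  (forall y, Y y -> exists2 x, X x & b x y <= e') ->
  (GH_dist X dX Y dY <= (e + e')%:E)%E.
Proof.
move=> e'0 haX hbY hcov; have [x0 hx0] := X0.
(* [GH_dist] takes total maps; outside [X] and [Y] they get an arbitrary value. *)
pose f x : glued := if pselect (X x) is left h then inl (exist _ x h) else inl (exist _ x0 hx0).
pose f' y : glued := if pselect (Y y) is left h then inr (exist _ y h) else inl (exist _ x0 hx0).
have fE x (h : X x) : f x = inl (exist _ x h).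
  by rewrite /f; case: pselect => // h'; congr inl; apply: eq_exist.
have f'E y (h : Y y) : f' y = inr (exist _ y h).
  by rewrite /f'; case: pselect => // h'; congr inr; apply: eq_exist.
apply: (@le_trans _ _ (hausdorff_dist (f @` X) (f' @` Y))).
  apply: ereal_inf_lbound; exists glued, f, f'; split => //.
  - by move=> x y hx hy; rewrite !fE haX.
  - by move=> x y hx hy; rewrite !f'E hbY.
rewrite /hausdorff_dist ge_max; apply/andP; split; apply: ge_ereal_sup.
  move=> _ [_ [x hx <-] <-]; apply: ge_ereal_inf.
  exists (mdist (f x) (f' x))%:E; first by exists (f' x) => //; exists x => //; exact: XY.
  rewrite (fE _ hx) (f'E _ (XY hx)) lee_fin; apply: (le_trans (cross_le hx (XY hx) hx)).
  by rewrite axx// bxx ?add0r ?addr0 ?lerDl//; exact: XY.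
move=> _ [_ [y hy <-] <-]; apply: ge_ereal_inf.
have [x hx bxy] := hcov y hy.
exists (mdist (f x) (f' y))%:E; first by exists (f x) => //; exists x.
rewrite (fE _ hx) (f'E _ hy) lee_fin; apply: (le_trans (cross_le hx hy hx)).
by rewrite axx// add0r lerD2l.
Qed.

End Gluing.

Lemma GH_dist_ge0 (R : realType) (T T' : Type) (X : set T) (dX : T -> T -> \bar R)
    (Y : set T') (dY : T' -> T' -> \bar R) : Y !=set0 -> (0 <= GH_dist X dX Y dY)%E.
Proof.
move=> [y Yy]; apply: le_ereal_inf_tmp => _ [M [f [f' [_ _ ->]]]].
rewrite /hausdorff_dist le_max; apply/orP; right.
apply: (@le_trans _ _ (ereal_inf [set (mdist x (f' y))%:E | x in f @` X])).
  by apply: le_ereal_inf_tmp => _ [z _ <-]; rewrite lee_fin mdist_ge0.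
by apply: ereal_sup_ubound; exists (f' y) => //; exists y.
Qed.

(** * Calculus of C^1 functions *)

Lemma add3K (V : zmodType) (x a b : V) : x + a + b - x = a + b.
Proof. by rewrite -[x + a + b]addrA addrAC subrr add0r. Qed.

Section Calculus.
Context {R : realType}.
Implicit Types (f : vec3 R -> R) (x y v w : vec3 R) (U : set (vec3 R)).

Lemma is_derive_line f y (i : 'I_3) (t : R) : derivable f (y + t *: delta_mx 0 i) (delta_mx 0 i) ->
  is_derive t (1 : R) (fun t => f (y + t *: delta_mx 0 i)) (partial i f (y + t *: delta_mx 0 i)).
Proof.
move=> h.
have e : (fun h : R => h^-1 *: (((fun t => f (y + t *: delta_mx 0 i)) \o shift t) (h *: (1 : R)) -
    f (y + t *: delta_mx 0 i))) =
   (fun h : R => h^-1 *: ((f \o shift (y + t *: delta_mx 0 i)) (h *: delta_mx 0 i) -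
    f (y + t *: delta_mx 0 i))).
  apply/funext => k /=; congr (_ *: (f _ - _)).
  have -> : k *: (1 : R) = k by exact: mulr1.
  by rewrite scalerDl addrCA.
by split; rewrite /derivable /derive e.
Qed.

Lemma mvt_coord f y (i : 'I_3) (s d e : R) :
  (forall t, `|t| <= `|s| -> derivable f (y + t *: delta_mx 0 i) (delta_mx 0 i) /\
     `|partial i f (y + t *: delta_mx 0 i) - d| <= e) ->
  `|f (y + s *: delta_mx 0 i) - f y - s * d| <= e * `|s|.
Proof.
move=> h; pose g (t : R) := f (y + t *: delta_mx 0 i).
have dg (t : R) : `|t| <= `|s| -> is_derive t (1 : R) g (partial i f (y + t *: delta_mx 0 i)).
  by move=> /h[h1 _]; exact: is_derive_line.
have g0 : g 0 = f y by rewrite /g scale0r addr0.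
have key (a b : R) : a < b -> (forall t, a <= t <= b -> `|t| <= `|s|) ->
    `|g b - g a - (b - a) * d| <= e * (b - a).
  move=> ab hs.
  have [||c cab ->] := @MVT R g (fun t => partial i f (y + t *: delta_mx 0 i)) a b ab.
  - by move=> t; rewrite in_itv /= => /andP[h1 h2]; apply: dg; apply: hs; rewrite !ltW.
  - apply: continuous_in_subspaceT => t; rewrite inE /= in_itv /= => /hs /dg d'.
    by apply: derivable_continuous; exact: ex_derive.
  rewrite [_ * d]mulrC -mulrBl normrM (@gtr0_norm _ (b - a)) ?subr_gt0//.
  rewrite ler_pM2r ?subr_gt0//; move: cab; rewrite in_itv /= => /andP[h1 h2].
  by have [] := h c; rewrite ?hs// !ltW.
rewrite -g0 -/(g s); have [s0|s0|->] := ltgtP s 0.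
- have := key s 0 s0; rewrite ltr0_norm// => k.
  have {k} := k _; rewrite sub0r => k.
  rewrite -normrN (_ : - (g s - g 0 - s * d) = g 0 - g s - - s * d); last by ring.
  by apply: k => t /andP[h1 h2]; rewrite ler0_norm// lerN2.
- have := key 0 s s0; rewrite gtr0_norm// subr0 => k.
  by apply: k => t /andP[h1 h2]; rewrite ger0_norm.
by rewrite subrr mul0r subr0 normr0 mulr0.
Qed.

Lemma three_steps (v : vec3 R) (x : vec3 R) : exists y1 y2 : vec3 R,
  [/\ y1 = x + v 0 (0 : 'I_3) *: delta_mx 0 (0 : 'I_3),
      y2 = y1 + v 0 (1 : 'I_3) *: delta_mx 0 (1 : 'I_3) &
      x + v = y2 + v 0 (2%:R : 'I_3) *: delta_mx 0 (2%:R : 'I_3)].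
Proof.
eexists; eexists; split => //; rewrite -!addrA; congr (_ + _).
rewrite {1}(vec3_sum v) !big_ord_recl big_ord0 addr0.
by congr (_ + (_ + _)); congr (v 0 _ *: delta_mx 0 _); apply: val_inj.
Qed.

(** One mean value estimate along each of three coordinate steps from x to x + v; the points in
    between stay within the l^1 length of v. With [d] the partial derivatives at x this becomes a
    first-order expansion, with d = 0 a Lipschitz bound. *)
Lemma mvt3 f x v (d : 'I_3 -> R) (e r : R) :
  \sum_i `|v 0 i| <= r ->
  (forall i y, enorm (y - x) <= r -> derivable f y (delta_mx 0 i) /\ `|partial i f y - d i| <= e) ->
  `|f (x + v) - f x - \sum_i v 0 i * d i| <= e * \sum_i `|v 0 i|.
Proof.
move=> hr h; have [y1 [y2 [e1 e2 e3]]] := three_steps v x.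
move: hr; rewrite !big_ord_recl !big_ord0 !addr0.
rewrite (_ : lift ord0 ord0 = 1 :> 'I_3); last exact: val_inj.
rewrite (_ : lift ord0 (lift ord0 ord0) = 2%:R :> 'I_3); last exact: val_inj.
rewrite -[ord0]/(0 : 'I_3); set a := v 0 0; set b := v 0 1; set c := v 0 2%:R => hr.
have n0 := normr_ge0 a; have n1 := normr_ge0 b; have n2 := normr_ge0 c.
have s1 : `|f y1 - f x - a * d 0| <= e * `|a|.
  rewrite e1; apply: mvt_coord => t ta; apply: h.
  by rewrite addrAC subrr add0r enormZ enorm_delta mulr1; lra.
have s2 : `|f y2 - f y1 - b * d 1| <= e * `|b|.
  rewrite e2; apply: mvt_coord => t ta; apply: h.
  have -> : y1 + t *: delta_mx 0 1 - x = a *: delta_mx 0 0 + t *: delta_mx 0 1.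
    by rewrite e1 add3K.
  apply: le_trans (enormD _ _) _.
  by rewrite !enormZ !enorm_delta !mulr1; lra.
have s3 : `|f (x + v) - f y2 - c * d 2%:R| <= e * `|c|.
  rewrite e3; apply: mvt_coord => t ta; apply: h.
  have -> : y2 + t *: delta_mx 0 2%:R - x =
      a *: delta_mx 0 0 + (b *: delta_mx 0 1 + t *: delta_mx 0 2%:R).
    by rewrite e2 e1 -[_ + _ + t *: _]addrA add3K.
  apply: le_trans (enormD _ _) _.
  apply: (@le_trans _ _ (`|a| + (`|b| + `|c|))) => //.
  rewrite enormZ enorm_delta mulr1 lerD2l; apply: le_trans (enormD _ _) _.
  by rewrite !enormZ !enorm_delta !mulr1 lerD2l.
rewrite (_ : _ - _ - _ = (f y1 - f x - a * d 0) + ((f y2 - f y1 - b * d 1) +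
    (f (x + v) - f y2 - c * d 2%:R))); last by ring.
rewrite !mulrDr; apply: le_trans (ler_normD _ _) (lerD s1 _).
exact: le_trans (ler_normD _ _) (lerD s2 s3).
Qed.

(** Continuity of the partial derivatives makes [mvt3] applicable with e/3; the other factor 3
    compares the l^1 norm of v with the Euclidean one. The radius d/4 keeps the coordinate steps, of
    total length at most 3|v|, inside the ball of radius d. *)
Lemma C1_expand f U x (e : R) : open U -> Ck_on 1 U f -> U x -> 0 < e ->
  exists2 d : R, 0 < d & forall v, enorm v < d ->
    `|f (x + v) - f x - dot (grad f x) v| <= e * enorm v.
Proof.
move=> oU [_ C1] Ux e0.
have e3 : 0 < e / 3 by rewrite divr_gt0.
have nU : nbhs x U by apply: open_nbhs_nbhs.
have [dU dU0 hU] := nbhs_eball nU.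
have /choice[dd hdd] : forall i : 'I_3, exists d : R, 0 < d /\
    forall y, enorm (y - x) < d -> `|partial i f y - partial i f x| <= e / 3.
  move=> i; have [_ [ci _]] := C1 i.
  have /(@cvgrPdist_lt R R _ (nbhs x)) /(_ _ e3) h := ci x Ux.
  have [d d0 hd] := nbhs_eball h.
  by exists d; split => // y /hd /ltW; rewrite distrC.
pose d := Num.min dU (Num.min (dd 0) (Num.min (dd 1) (dd 2%:R))).
have d0 : 0 < d by rewrite !lt_min dU0 !(proj1 (hdd _)).
have ddi i : d <= dd i.
  rewrite /d; case: i => -[|[|[|//]]] hi.
  - by rewrite (_ : Ordinal hi = 0)//; [rewrite !ge_min lexx !orbT|exact: val_inj].
  - by rewrite (_ : Ordinal hi = 1)//; [rewrite !ge_min lexx !orbT|exact: val_inj].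
  - by rewrite (_ : Ordinal hi = 2%:R)//; [rewrite !ge_min lexx !orbT|exact: val_inj].
have dle : d <= dU by rewrite ge_min lexx.
exists (d / 4); first by rewrite divr_gt0.
move=> v hv.
have sv : \sum_i `|v 0 i| <= 3 * enorm v.
  apply: (@le_trans _ _ (\sum_(i < 3) enorm v)).
    by apply: ler_sum => i _; exact: coord_le_enorm.
  by rewrite sumr_const card_ord mulr_natl.
have -> : dot (grad f x) v = \sum_i v 0 i * partial i f x.
  by apply: eq_bigr => i _; rewrite mxE mulrC.
have hmv := @mvt3 f x v (fun i => partial i f x) (e / 3) (3 * enorm v) sv.
apply: le_trans (hmv _) _.
  move=> i y hy; have hyd : enorm (y - x) < d by apply: le_lt_trans hy _; lra.
  split; last by have [_] := hdd i; apply; apply: lt_le_trans hyd (ddi i).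
  have [h _] := C1 i; apply: h; apply: hU; exact: lt_le_trans hyd dle.
by have := ler_wpM2l (ltW e3) sv; lra.
Qed.

(** Chain rule for functions that are known only through their partial derivatives. With q(h) the
    difference quotient of [c], the remainder in [C1_expand] at the increment h q(h) is at most a
    small multiple of |h| |q(h)|, and q(h) stays bounded. *)
Lemma is_derive_C1 f U (c : R -> vec3 R) (t : R) dc : open U -> Ck_on 1 U f -> U (c t) ->
  is_derive t (1 : R) c dc -> is_derive t (1 : R) (f \o c) (dot (grad f (c t)) dc).
Proof.
move=> oU C1 Uct hc; set G := grad f (c t).
pose q (h : R) := h^-1 *: ((c \o shift t) (h *: (1 : R)) - c t).
have hq : q @ 0^' --> dc by rewrite -(@derive_val _ _ _ _ _ _ _ hc); exact: ex_derive.
have hGq : (dot G \o q) @ 0^' --> dot G dc.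
  by apply: (@continuous_cvg _ _ _ _ _ q (dot G)) hq; exact: dot_continuous.
have hEq : (@enorm R \o q) @ 0^' --> enorm dc.
  by apply: (@continuous_cvg _ _ _ _ _ q (@enorm R)) hq; exact: enorm_continuous.
have cc : {for t, continuous c} by apply: derivable_continuous; exact: ex_derive.
have : (fun h : R => h^-1 *: (((f \o c) \o shift t) (h *: (1 : R)) - (f \o c) t)) @ 0^' --> dot G dc.
  apply/cvgrPdist_le => e e0.
  have m0 : 0 < enorm dc + 1 by rewrite ltr_wpDl ?enorm_ge0.
  have e2 : 0 < e / 2 by rewrite divr_gt0.
  have e3 : 0 < e / 2 / (enorm dc + 1) by rewrite divr_gt0.
  have [d d0 hd] := C1_expand oU C1 Uct e3.
  have nc : \forall h \near 0^', enorm (c (h + t) - c t) < d.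
    have := @eball_nbhs R (c t) d d0 => /cc /(@nbhs_ballP R R) [r /= r0 hr].
    near=> h; apply: (hr (h + t)); rewrite /ball /= opprD addrCA subrr addr0 normrN.
    by near: h; apply: dnbhs0_lt.
  have /cvgrPdist_le /(_ _ e2) nG := hGq.
  have /cvgrPdist_le /(_ _ ltr01) nE := hEq.
  near=> h.
  have h0 : h != 0 by near: h; exact: nbhs_dnbhs_neq.
  have n1 : `|dot G dc - dot G (q h)| <= e / 2.
    by near: h; exact: nG.
  have n2 : enorm (q h) <= enorm dc + 1.
    near: h; apply: filterS nE => h /=.
    by rewrite ler_norml => /andP[h1 _]; lra.
  have n3 : enorm (c (h + t) - c t) < d by near: h.
  have qh : h *: q h = c (h + t) - c t.
    rewrite /q scalerA divff// scale1r /=.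
    by have -> : h *: (1 : R) = h by exact: mulr1.
  have := hd _ n3; have -> : c t + (c (h + t) - c t) = c (h + t) by rewrite addrC subrK.
  rewrite -qh => n4.
  rewrite /=; have -> : h *: (1 : R) = h by exact: mulr1.
  have -> : dot G dc - h^-1 *: (f (c (h + t)) - f (c t)) =
     (dot G dc - dot G (q h)) - h^-1 * (f (c (h + t)) - f (c t) - dot G (h *: q h)).
    rewrite (dotZr h G (q h)); set a := dot G (q h); set b := f (c (h + t)); set k := f (c t).
    have -> : h^-1 *: (b - k) = h^-1 * (b - k) by [].
    rewrite (mulrBr _ (b - k)) mulKf//; ring.
  apply: le_trans (ler_normB _ _) _; rewrite [leRHS]splitr; apply: lerD => //.
  rewrite normrM normfV ler_pdivrMl ?normr_gt0//; apply: le_trans n4 _.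
  rewrite enormZ mulrCA ler_wpM2l//.
  by rewrite mulrAC ler_pdivrMr// ler_wpM2l// ltW.
move=> h; split; first by apply/cvg_ex; eexists; exact: h.
exact/cvg_lim.
Unshelve. all: by end_near. Qed.

End Calculus.

(** * Level sets tangent to a sphere *)

Section SignNearSphere.
Context {R : realType}.
Implicit Types (f : vec3 R -> R) (x y v w : vec3 R) (U : set (vec3 R)).

Lemma ge0_of_small (x y : R) : (forall t, 0 < t -> 0 <= x + t * y) -> 0 <= x.
Proof.
move=> h; rewrite leNgt; apply/negP => x0.
have y1 : 0 < `|y| + 1 by rewrite ltr_wpDl.
have := h (- x / 2 / (`|y| + 1)); rewrite !divr_gt0// ?oppr_gt0// => /(_ isT).
have : - x / 2 / (`|y| + 1) * y <= - x / 2.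
  rewrite -[leRHS](divfK (lt0r_neq0 y1)); apply: ler_wpM2l.
    by rewrite !divr_ge0// ?oppr_ge0 ?ltW.
  by apply: le_trans (ler_norm _) _; rewrite lerDl.
lra.
Qed.

(** The last expression is, up to [sg], the second derivative of [f] along the curve x + t v + t^2 w
    at t = 0, where the value and the first derivative vanish. If it had the wrong sign, then so
    would the first derivative for small t > 0, and by the mean value theorem also [f] itself. *)
Lemma quad_deriv f U x v w (sg : R) : open U -> Ck_on 2 U f -> U x -> f x = 0 ->
  dot (grad f x) v = 0 ->
  (exists2 d : R, 0 < d & forall t, 0 < t < d -> 0 <= sg * f (x + t *: v + t ^+ 2 *: w)) ->
  0 <= sg * (\sum_i \sum_j v 0 i * v 0 j * partial j (partial i f) x + 2 * dot (grad f x) w).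
Proof.
move=> oU C2 Ux fx0 Gv [d d0 hd].
have C1 : Ck_on 1 U f.
  by case: C2 => c0 h; split => // i; have [h1 [h2 _]] := h i.
have C1i i : Ck_on 1 U (partial i f) by case: C2 => _ /(_ i)[].
pose c (t : R) := x + t *: v + t ^+ 2 *: w.
have dc (t : R) : is_derive t (1 : R) c (v + (2 * t) *: w).
  have cv : (fun h : R => h^-1 *: ((c \o shift t) (h *: (1 : R)) - c t)) =
     (fun h : R => h^-1 *: (h *: v + (h * (2 * t + h)) *: w)).
    apply/funext => h /=; have -> : h *: (1 : R) = h by exact: mulr1.
    congr (_ *: _); rewrite /c; apply/matrixP => i j; rewrite !mxE; ring.
  have lv : (fun h : R => h^-1 *: (h *: v + (h * (2 * t + h)) *: w)) @ 0^' --> v + (2 * t) *: w.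
    have : (fun h : R => v + (2 * t + h) *: w) @ 0^' --> v + (2 * t) *: w.
      apply: cvgD; first exact: cvg_cst.
      apply: cvgZr_tmp; rewrite -[X in _ --> X]addr0; apply: cvgD; first exact: cvg_cst.
      exact: nbhs_dnbhs.
    apply: cvg_trans; apply: near_eq_cvg; near=> h.
    have h0 : h != 0 by near: h; exact: nbhs_dnbhs_neq.
    by rewrite scalerDr !scalerA mulrA mulVf// scale1r mul1r.
  split; first by rewrite /derivable cv; apply/cvg_ex; eexists; exact: lv.
  by rewrite /derive cv; exact/cvg_lim.
have cc t : {for t, continuous c} by apply: derivable_continuous; exact: ex_derive.
have c0 : c 0 = x by rewrite /c expr0n /= !scale0r !addr0.
have [r r0 hr] : exists2 r : R, 0 < r & forall t, `|t| < r -> U (c t).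
  have nU : nbhs (c 0) U by rewrite c0; apply: open_nbhs_nbhs.
  have /nbhs_ballP[r /= r0 h] := cc 0 _ nU; exists r => // t tr; apply: h.
  by rewrite /ball /= sub0r normrN.
pose psi t := dot (grad f (c t)) (v + (2 * t) *: w).
have dphi t : `|t| < r -> is_derive t (1 : R) (f \o c) (psi t).
  by move=> tr; apply: (is_derive_C1 oU) => //; exact: hr.
pose H := \sum_i \sum_j v 0 i * v 0 j * partial j (partial i f) x.
pose K := H + 2 * dot (grad f x) w.
have dpsi : is_derive 0 (1 : R) psi K.
  have -> : psi = fun t => \sum_i (partial i f (c t)) * (v 0 i + 2 * t * w 0 i).
    by apply/funext => t; apply: eq_bigr => i _; rewrite !mxE.
  have di i : is_derive 0 (1 : R) (fun t => partial i f (c t) * (v 0 i + 2 * t * w 0 i))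
     (dot (grad (partial i f) x) v * v 0 i + partial i f x * (2 * w 0 i)).
    have d1 : is_derive 0 (1 : R) (partial i f \o c) (dot (grad (partial i f) x) v).
      have := @is_derive_C1 R (partial i f) U c 0 _ oU (C1i i) _ (dc 0).
      by rewrite c0 mulr0 scale0r addr0; apply.
    have d2 : is_derive 0 (1 : R) (fun t => v 0 i + 2 * t * w 0 i) (2 * w 0 i).
      by apply: is_derive_eq; rewrite /GRing.scale /=; ring.
    have d3 : is_derive 0 (1 : R) ((partial i f \o c) * (fun t => v 0 i + 2 * t * w 0 i)) _ := is_deriveM d1 d2.
    apply: is_derive_eq d3 _.
    by rewrite /= c0 /GRing.scale /=; ring.
  have ds := @is_derive_sum R R R 3 (fun i (t : R) => partial i f (c t) * (v 0 i + 2 * t * w 0 i))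
     0 1 (fun i => dot (grad (partial i f) x) v * v 0 i + partial i f x * (2 * w 0 i)).
  have -> : (fun t => \sum_i partial i f (c t) * (v 0 i + 2 * t * w 0 i)) =
     \sum_(i < 3) (fun t : R => partial i f (c t) * (v 0 i + 2 * t * w 0 i)).
    by apply/funext => t; rewrite fct_sumE.
  apply: is_derive_eq (ds di) _.
  rewrite big_split /= /K /H; congr (_ + _).
    apply: eq_bigr => i _; rewrite big_distrl /=; apply: eq_bigr => j _; rewrite !mxE; ring.
  by rewrite big_distrr /=; apply: eq_bigr => i _; rewrite !mxE; ring.
rewrite -/H -/K leNgt; apply/negP => sK.
have psi0 : psi 0 = 0 by rewrite /psi c0 mulr0 scale0r addr0.
have [r2 r20 hr2] : exists2 r2 : R, 0 < r2 & forall t, 0 < t < r2 -> sg * psi t < 0.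
  have : (fun h : R => h^-1 *: ((psi \o shift 0) (h *: (1 : R)) - psi 0)) @ 0^' --> K.
    by rewrite -(@derive_val _ _ _ _ _ _ _ dpsi); exact: ex_derive.
  have sg0 : 0 < `|sg| by rewrite normr_gt0; apply: contraTneq sK => ->; rewrite mul0r ltxx.
  have e0 : 0 < - (sg * K) / 2 / `|sg| by rewrite !divr_gt0// oppr_gt0.
  move=> /cvgrPdist_lt /(_ _ e0); rewrite near_withinE => /nbhs_ballP[r2 /= r20 h].
  exists r2 => // t /andP[t0 tr]; have := h t; rewrite /ball /= sub0r normrN gtr0_norm// => /(_ tr).
  rewrite (gt_eqF t0) => /(_ isT) /=; have -> : t *: (1 : R) = t by exact: mulr1.
  rewrite addr0 psi0 subr0 /GRing.scale /= => hk.
  have : sg * (t^-1 * psi t - K) < - (sg * K) / 2.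
    apply: le_lt_trans (ler_norm _) _; rewrite normrM distrC mulrC.
    by rewrite -ltr_pdivlMr.
  rewrite mulrBr mulrCA => h2.
  have h3 : t^-1 * (sg * psi t) < 0 by lra.
  by move: h3; rewrite pmulr_rlt0// invr_gt0.
pose t := Num.min d (Num.min r r2) / 2.
have t0 : 0 < t by rewrite divr_gt0// !lt_min d0 r0.
have mle : Num.min d (Num.min r r2) = t * 2 by rewrite /t divfK.
have td : t < d.
  have : Num.min d (Num.min r r2) <= d by rewrite ge_min lexx.
  by rewrite mle; lra.
have tr : t < r.
  have : Num.min d (Num.min r r2) <= r by rewrite !ge_min lexx !orbT.
  by rewrite mle; lra.
have tr2 : t < r2.
  have : Num.min d (Num.min r r2) <= r2 by rewrite !ge_min lexx !orbT.
  by rewrite mle; lra.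
have [||z zt hz] := @MVT R (f \o c) psi 0 t t0.
- move=> z; rewrite in_itv /= => /andP[z0 zt]; apply: dphi.
  by rewrite gtr0_norm// (lt_trans zt).
- apply: continuous_in_subspaceT => z; rewrite inE /= in_itv /= => /andP[z0 zt].
  apply: derivable_continuous; have h : is_derive z (1 : R) (f \o c) (psi z).
    by apply: dphi; rewrite ger0_norm// (le_lt_trans zt).
  exact: ex_derive.
move: zt; rewrite in_itv /= => /andP[z0 zt].
have := hd t; rewrite t0 td => /(_ isT); rewrite -/(c t).
move: hz; rewrite /= c0 fx0 !subr0 => ->; rewrite mulrA pmulr_lge0// leNgt => /negP; apply.
by apply: hr2; rewrite z0 (lt_trans zt).
Unshelve. all: by end_near. Qed.

Lemma first_deriv f U x w (sg : R) : open U -> Ck_on 1 U f -> U x -> f x = 0 ->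
  (exists2 d : R, 0 < d & forall t, 0 < t < d -> 0 <= sg * f (x + t *: w)) ->
  0 <= sg * dot (grad f x) w.
Proof.
move=> oU C1 Ux fx0 [d d0 hd].
apply: (@ge0_of_small _ (`|sg| * enorm w)) => e e0.
have [r r0 hr] := C1_expand oU C1 Ux e0.
have w1 : 0 < enorm w + 1 by rewrite ltr_wpDl ?enorm_ge0.
pose t := Num.min d (r / (enorm w + 1)) / 2.
have m0 : 0 < Num.min d (r / (enorm w + 1)) by rewrite lt_min d0 divr_gt0.
have t0 : 0 < t by rewrite divr_gt0.
have td : t < d.
  have : Num.min d (r / (enorm w + 1)) <= d by rewrite ge_min lexx.
  by rewrite /t; lra.
have tr : enorm (t *: w) < r.
  have : Num.min d (r / (enorm w + 1)) <= r / (enorm w + 1) by rewrite !ge_min lexx !orbT.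
  have : t < Num.min d (r / (enorm w + 1)) by rewrite /t; lra.
  move=> h1 h2; have := lt_le_trans h1 h2; rewrite ltr_pdivlMr// mulrDr mulr1 enormZ (gtr0_norm t0).
  by lra.
have := hr _ tr; rewrite fx0 subr0 dotZr enormZ (gtr0_norm t0) => h.
have := hd t; rewrite t0 td => /(_ isT) => h2.
have h3 : sg * (f (x + t *: w) - t * dot (grad f x) w) <= `|sg| * (e * (t * enorm w)).
  by apply: le_trans (ler_norm _) _; rewrite normrM ler_wpM2l.
have : 0 <= t * (sg * dot (grad f x) w + e * (`|sg| * enorm w)).
  rewrite mulrDr; set a := sg * f _ in h2; move: h3; rewrite mulrBr -/a; lra.
by rewrite pmulr_rge0.
Qed.

Lemma same_sign_segment f x y :
  (forall t, 0 <= t <= 1 -> {for x + t *: (y - x), continuous f} /\ f (x + t *: (y - x)) != 0) ->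
  0 < f x * f y.
Proof.
move=> h; rewrite ltNge; apply/negP => h0.
pose g (t : R) := f (x + t *: (y - x)).
have cg : {within `[0, 1], continuous g}.
  apply: continuous_in_subspaceT => t; rewrite inE /= in_itv /= => /h[ct _].
  apply: (@continuous_comp _ _ _ (fun t : R => x + t *: (y - x)) f) => //.
  have [sc _] := smooth_affine x (y - x); exact: smooth_curve_continuous.
have g0 : g 0 = f x by rewrite /g scale0r addr0.
have g1 : g 1 = f y by rewrite /g scale1r addrC subrK.
have [|c] := @IVT R g 0 1 0 ler01 cg.
  have fx : f x != 0 by move: (h 0); rewrite lexx ler01 scale0r addr0 => /(_ isT)[].
  have fy : f y != 0 by move: (h 1); rewrite lexx ler01 scale1r addrC subrK => /(_ isT)[].
  rewrite g0 g1 ge_min le_max; move: fx fy; rewrite !neq_lt => /orP[fx|fx] /orP[fy|fy].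
  - by have := nmulr_lgt0 (f x) fy; rewrite fx ltNge h0.
  - by rewrite (ltW fx) (ltW fy) orbT.
  - by rewrite (ltW fx) (ltW fy) orbT.
  - by have := mulr_gt0 fx fy; rewrite ltNge h0.
by rewrite in_itv /= => /h[_ /eqP].
Qed.

(** The outside of a sphere is not convex, so two points on that side near [x0] cannot simply be
    joined by a segment. Both are first moved along the normal, away from the sphere, by a distance
    [tau] that exceeds their distance from [x0]; this stays on the same side, and the moved points
    can be joined by a segment on which [f] has no zero. *)
Lemma sign_near_sphere f U (p x0 : vec3 R) (sg : R) : sg = 1 \/ sg = -1 ->
  open U -> (forall x, U x -> {for x, continuous f}) -> U x0 -> 0 < enorm (x0 - p) ->
  (forall x, U x -> 0 < sg * (enorm (x - p) ^+ 2 - enorm (x0 - p) ^+ 2) -> f x != 0) ->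
  exists2 d : R, 0 < d & forall x y, enorm (x - x0) < d -> enorm (y - x0) < d ->
    0 < sg * (enorm (x - p) ^+ 2 - enorm (x0 - p) ^+ 2) ->
    0 < sg * (enorm (y - p) ^+ 2 - enorm (x0 - p) ^+ 2) -> 0 < f x * f y.
Proof.
move=> hsg oU cf Ux0 r0 hf; set r := enorm (x0 - p) in r0 hf *.
have [d d0 hd] := nbhs_eball (open_nbhs_nbhs (conj oU Ux0)).
have [e [e1 x0e]] : exists e, enorm e = 1 /\ x0 - p = r *: e.
  exists (r^-1 *: (x0 - p)); rewrite scalerA divff ?scale1r ?gt_eqF//; split => //.
  by rewrite enormZ gtr0_norm ?invr_gt0// mulVf// gt_eqF.
have dist x : enorm (x - p) ^+ 2 - r ^+ 2 = enorm (x - x0) ^+ 2 + 2 * r * dot e (x - x0).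
  have -> : x - p = r *: e + (x - x0) by apply/matrixP => i j; rewrite -x0e !mxE; ring.
  move: (x - x0) => z.
  rewrite -dot_enorm !dotE (dot_enorm e) e1 (dot_enorm z) (dotC z e); ring.
pose tau := Num.min (r / 2) (d / 4).
have tau0 : 0 < tau by rewrite lt_min !divr_gt0.
have taur : tau <= r / 2 by rewrite ge_min lexx.
have taud : tau <= d / 4 by rewrite ge_min lexx orbT.
have sg2 : sg * sg = 1 by case: hsg => ->; ring.
have absg : `|sg| = 1 by case: hsg => ->; rewrite ?normrN normr1.
exists tau => // x y hx hy Ox Oy.
have CS z : `|dot e (z - x0)| <= enorm (z - x0).
  rewrite ler_norml; apply/andP; split; last by have := CauchySchwarz e (z - x0); rewrite e1 mul1r.
  by rewrite lerNl -dotNr; apply: le_trans (CauchySchwarz _ _) _; rewrite e1 mul1r enormN.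
have step z : enorm (z - x0) < tau -> 0 < sg * (enorm (z - p) ^+ 2 - r ^+ 2) ->
    0 < f z * f (z + tau *: (sg *: e)).
  move=> hz Oz; have := @same_sign_segment f z (z + tau *: (sg *: e)).
  have -> : z + tau *: (sg *: e) - z = tau *: (sg *: e) by rewrite addrC addKr.
  apply => t /andP[t0 t1].
  have Uz : U (z + t *: (tau *: (sg *: e))).
    apply: hd; rewrite addrAC; apply: le_lt_trans (enormD _ _) _.
    rewrite !enormZ e1 absg !mulr1 !ger0_norm ?(ltW tau0)//.
    have : t * tau <= tau by rewrite ler_piMl// ltW.
    lra.
  split; first exact: cf.
  apply: hf => //; move: Oz; rewrite !dist addrAC.
  have hs : - tau < dot e (z - x0).
    have := CS z; rewrite ler_norml => /andP[h _]; lra.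
  move: (z - x0) hs => zz hs.
  rewrite -!dot_enorm !dotE (dot_enorm e) e1 !dot_enorm (dotC zz e).
  move: hs; set s := dot e zz; set q := enorm zz ^+ 2 => hs Oz.
  have tt0 : 0 <= t * tau by rewrite mulr_ge0// ltW.
  have tt1 : t * tau <= tau by rewrite ler_piMl// ltW.
  set a := t * tau in tt0 tt1.
  have -> : sg * (q + t * (tau * (sg * s)) + (t * (tau * (sg * s)) + t * (tau * (sg * (t * (tau * (sg * 1 ^+ 2)))))) +
     2 * r * (s + t * (tau * (sg * 1 ^+ 2)))) =
     sg * (q + 2 * r * s) + (sg * sg) * (2 * a * s) + sg * sg * (2 * r * a) + (sg * sg) * sg * a ^+ 2.
    by rewrite /a; ring.
  rewrite sg2 !mul1r.
  have h1 : 0 <= 2 * a * s + 2 * r * a - a ^+ 2.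
    rewrite (_ : _ - _ = a * (2 * s + 2 * r - a)); last by ring.
    by rewrite mulr_ge0//; lra.
  have h2 : - a ^+ 2 <= sg * a ^+ 2 by case: hsg => ->; have := sqr_ge0 a; lra.
  lra.
have s1 := step x hx Ox; have s2 := step y hy Oy.
have s3 : 0 < f (x + tau *: (sg *: e)) * f (y + tau *: (sg *: e)).
  apply: same_sign_segment => t ht.
  set z := x + t *: (y - x) - x0.
  have zE : x + tau *: (sg *: e) + t *: (y + tau *: (sg *: e) - (x + tau *: (sg *: e))) =
     x0 + z + tau *: (sg *: e).
    by apply/matrixP => i j; rewrite /z !mxE; ring.
  rewrite zE.
  have hz : enorm z < tau by apply: (@eball_convex R x0 tau x y t).
  have Uz : U (x0 + z + tau *: (sg *: e)).
    apply: hd; rewrite addrAC [x0 + z]addrC addrK; apply: le_lt_trans (enormD _ _) _.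
    by rewrite !enormZ e1 absg !mulr1 gtr0_norm//; lra.
  split; first exact: cf.
  apply: hf => //; rewrite dist.
  have -> : x0 + z + tau *: (sg *: e) - x0 = z + tau *: (sg *: e).
    by rewrite addrAC [x0 + z]addrC addrK.
  clearbody z; rewrite -!dot_enorm !dotE (dot_enorm e) e1 (dot_enorm z) (dotC z e).
  set s := dot e z; set m := enorm z in hz *.
  have m0 : 0 <= m by exact: enorm_ge0.
  have hs : - m <= s <= m.
    by have := CS (x0 + z); rewrite [x0 + z]addrC addrK -/m -/s ler_norml.
  have -> : sg * (m ^+ 2 + tau * (sg * s) + (tau * (sg * s) + tau * (sg * (tau * (sg * 1 ^+ 2)))) +
     2 * r * (s + tau * (sg * 1 ^+ 2))) =
     sg * (m ^+ 2 + 2 * r * s) + (sg * sg) * (2 * tau * s) + sg * sg * (2 * r * tau) + (sg * sg) * sg * tau ^+ 2.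
    by ring.
  rewrite sg2 !mul1r; move: hs => /andP[hs1 hs2].
  have t1 : 0 < tau - m by rewrite subr_gt0.
  case: hsg => ->.
  - have h1 : 0 < (tau - m) * (2 * r + tau - m) by rewrite mulr_gt0//; lra.
    have h2 : 0 <= (s + m) * (2 * r + 2 * tau) by rewrite mulr_ge0//; lra.
    lra.
  - have h1 : 0 < (tau - m) * (2 * r - tau + m) by rewrite mulr_gt0//; lra.
    have h2 : 0 <= (m - s) * (2 * r - 2 * tau) by rewrite mulr_ge0//; lra.
    lra.
set a := f x in s1 *; set b := f (x + _) in s1 s3.
set c := f y in s2 *; set g := f (y + _) in s2 s3.
have : 0 < (a * b) * (b * g) * (c * g) by exact: mulr_gt0 (mulr_gt0 s1 s3) s2.
rewrite (_ : _ * _ * _ = (a * c) * (b * g) ^+ 2); last by ring.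
by rewrite pmulr_lgt0// exprn_gt0.
Qed.

End SignNearSphere.

(** * The maximum principle for minimal surfaces *)

Section Barrier.
Context {R : realType}.
Implicit Types (f u : vec3 R -> R) (x y v w : vec3 R) (U : set (vec3 R)).

Lemma is_derive_line0 f x (i : 'I_3) : derivable f x (delta_mx 0 i) ->
  is_derive 0 (1 : R) (fun t : R => f (x + t *: delta_mx 0 i)) (partial i f x).
Proof.
move=> h; have := @is_derive_line R f x i 0; rewrite scale0r addr0; exact.
Qed.

Lemma partial_line f x (i : 'I_3) d :
  is_derive 0 (1 : R) (fun t : R => f (x + t *: delta_mx 0 i)) d -> partial i f x = d.
Proof.
move=> h; rewrite -(@derive_val _ _ _ _ _ _ _ h) /partial /derive.
have -> : (fun t : R => t^-1 *: ((f \o shift x) (t *: delta_mx 0 i) - f x)) =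
  (fun t : R => t^-1 *: (((fun t : R => f (x + t *: delta_mx 0 i)) \o shift 0) (t *: (1 : R)) -
    f (x + 0 *: delta_mx 0 i))); last by [].
apply/funext => t /=.
have -> : t *: (1 : R) = t by exact: mulr1.
by rewrite !addr0 scale0r addr0 [_ + x]addrC.
Qed.

(** The weight u^3 of the volume and the factor u^-1 of the unit normal combine, so that the mean
    curvature is u^-3 div(u^2 grad f / |grad f|), which is then differentiated term by term. *)
Lemma mean_curvature_eq u f U x : open U -> U x -> Ck_on 2 U f ->
  (forall i, derivable u x (delta_mx 0 i)) -> 0 < u x -> grad f x != 0 ->
  let G := grad f x in let N := enorm G in
  mean_curvature u f x = (u x ^+ 2 * N)^-1 * (2 * dot (grad u x) G +
    u x * (\sum_i partial i (partial i f) x -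
      (N ^+ 2)^-1 * \sum_i \sum_j G 0 i * G 0 j * partial j (partial i f) x)).
Proof.
move=> oU Ux C2 du u0 G0 G N.
have N0 : 0 < N by rewrite enorm_gt0.
have C1i i : Ck_on 1 U (partial i f) by case: C2 => _ /(_ i)[].
have dpf (k i : 'I_3) : is_derive 0 (1 : R) (fun t : R => partial k f (x + t *: delta_mx 0 i))
    (partial i (partial k f) x).
  by apply: is_derive_line0; have [_ /(_ i)[h _]] := C1i k; exact: h.
pose T (i : 'I_3) := 2 * u x * partial i u x * G 0 i / N + u x ^+ 2 *
  (partial i (partial i f) x / N - G 0 i * (\sum_k G 0 k * partial i (partial k f) x) / N ^+ 3).
have key i : partial i (fun z => u z ^+ 3 * conf_normal u f z 0 i) x = T i.
  apply: partial_line.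
  pose Ui (t : R) := u (x + t *: delta_mx 0 i).
  pose Fk (k : 'I_3) (t : R) := partial k f (x + t *: delta_mx 0 i).
  pose S2 (t : R) := \sum_k Fk k t ^+ 2.
  have dU : is_derive 0 (1 : R) Ui (partial i u x) by exact: is_derive_line0.
  have dF k : is_derive 0 (1 : R) (Fk k) (partial i (partial k f) x) by exact: dpf.
  have F0 k : Fk k 0 = G 0 k by rewrite /Fk scale0r addr0 /G mxE.
  have U0 : Ui 0 = u x by rewrite /Ui scale0r addr0.
  have dS : is_derive 0 (1 : R) S2 (2 * \sum_k G 0 k * partial i (partial k f) x).
    have -> : S2 = \sum_(k < 3) (fun t : R => Fk k t ^+ 2).
      by apply/funext => t; rewrite fct_sumE.
    have d2 k : is_derive 0 (1 : R) (fun t : R => Fk k t ^+ 2) (2 * (G 0 k * partial i (partial k f) x)).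
      have h : is_derive 0 (1 : R) (Fk k * Fk k) _ := is_deriveM (dF k) (dF k).
      have -> : (fun t => Fk k t ^+ 2) = Fk k * Fk k by apply/funext => t; rewrite expr2.
      by apply: is_derive_eq h _; rewrite F0 /GRing.scale /=; ring.
    by apply: is_derive_eq; rewrite big_distrr.
  have S20 : S2 0 = N ^+ 2.
    by rewrite /S2 /N -dot_enorm; apply: eq_bigr => k _; rewrite F0 expr2.
  have S2p : 0 < S2 0 by rewrite S20 exprn_gt0.
  have dN : is_derive 0 (1 : R) (Num.sqrt \o S2) ((\sum_k G 0 k * partial i (partial k f) x) / N).
    have h := is_derive1_comp (is_derive1_sqrt S2p) dS.
    apply: is_derive_eq h _.
    by rewrite S20 sqrtr_sqr gtr0_norm//; field; rewrite gt_eqF.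
  have N00 : (Num.sqrt \o S2) 0 = N by rewrite /= S20 sqrtr_sqr gtr0_norm.
  have -> : (fun t : R => u (x + t *: delta_mx 0 i) ^+ 3 *
       conf_normal u f (x + t *: delta_mx 0 i) 0 i) =
     Ui ^+ 3 * ((fun t => ((Ui * (Num.sqrt \o S2)) t)^-1) * Fk i).
    apply/funext => t; rewrite /conf_normal !mxE /Ui /Fk /=.
    congr (_ * ((_ * _)^-1 * _)).
    by rewrite /S2 /enorm; congr Num.sqrt; apply: eq_bigr => k _; rewrite mxE.
  have UN0 : (Ui * (Num.sqrt \o S2)) 0 != 0.
    by rewrite -[X in X != 0]/(Ui 0 * (Num.sqrt \o S2) 0) U0 N00 mulf_neq0 ?gt_eqF.
  have d1 := is_deriveM dU dN.
  have d2 := is_deriveV UN0 d1.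
  have d3 := is_deriveM d2 (dF i).
  have d4 := is_deriveX 3 dU.
  have d5 := is_deriveM d4 d3.
  apply: is_derive_eq d5 _.
  rewrite -[(Ui ^+ 3) 0]/(Ui 0 ^+ 3).
  rewrite -[((fun t => ((Ui * (Num.sqrt \o S2)) t)^-1) * Fk i) 0]/((Ui 0 * (Num.sqrt \o S2) 0)^-1 * Fk i 0).
  rewrite -[(Ui * (Num.sqrt \o S2)) 0]/(Ui 0 * (Num.sqrt \o S2) 0) U0 N00 F0.
  rewrite /T; set A := \sum_k _; rewrite /GRing.scale /=.
  by field; rewrite !gt_eqF.
rewrite /mean_curvature /conf_div (eq_bigr T); last by move=> i _; exact: key.
have -> : \sum_i T i = 2 * u x / N * dot (grad u x) G + u x ^+ 2 *
   (\sum_i partial i (partial i f) x / N - \sum_i G 0 i * (\sum_k G 0 k * partial i (partial k f) x) / N ^+ 3).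
  rewrite /T big_split /= -!big_distrr /= -sumrB; congr (_ + _).
  by rewrite /dot big_distrr /=; apply: eq_bigr => i _; rewrite !mxE; field; rewrite gt_eqF.
rewrite -!big_distrl /=.
have -> : \sum_i G 0 i * (\sum_k G 0 k * partial i (partial k f) x) =
   \sum_i \sum_j G 0 i * G 0 j * partial j (partial i f) x.
  rewrite [RHS]exchange_big /=; apply: eq_bigr => i _; rewrite big_distrr /=.
  by apply: eq_bigr => j _; ring.
by field; rewrite !gt_eqF.
Qed.

(** The trace of [H] on the plane orthogonal to [e], expressed by the projections of the three basis
    vectors to this plane; this avoids the choice of an orthonormal frame. *)
Lemma hessian_trace (H : 'I_3 -> 'I_3 -> R) (e : vec3 R) : dot e e = 1 ->
  \sum_(k < 3) (\sum_i \sum_j (delta_mx 0 k - e 0 k *: e : vec3 R) 0 i *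
      (delta_mx 0 k - e 0 k *: e : vec3 R) 0 j * H i j) =
  \sum_i H i i - \sum_i \sum_j e 0 i * e 0 j * H i j.
Proof.
move=> e1.
(* Adding a multiple of |e|^2 - 1 = 0 turns the claim into a polynomial identity. *)
have -> : \sum_i H i i - \sum_i \sum_j e 0 i * e 0 j * H i j =
  \sum_i H i i - \sum_i \sum_j e 0 i * e 0 j * H i j +
  (dot e e - 1) * \sum_i \sum_j e 0 i * e 0 j * H i j by rewrite e1; ring.
rewrite /dot !big_ord_recl !big_ord0 !mxE /=; ring.
Qed.

(* The sphere about [p] through [x0] touches [S] at [x0], from inside if [sg = -1] and from outside
   if [sg = 1]; the left-hand side is, up to a positive factor, its mean curvature there. *)
Lemma minimal_surface_barrier u (S : set (vec3 R)) (p x0 : vec3 R) (sg : R) :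
  sg = 1 \/ sg = -1 ->
  closed_minimal_surface u S -> S x0 -> 0 < enorm (x0 - p) ->
  (forall i, derivable u x0 (delta_mx 0 i)) -> 0 < u x0 ->
  (forall x, S x -> sg * (enorm (x - p) ^+ 2 - enorm (x0 - p) ^+ 2) <= 0) ->
  sg * (u x0 + dot (grad u x0) (x0 - p)) <= 0.
Proof.
move=> hsg [_ _ hS] Sx0 r0 du u0 hmin.
have [U [f [[oU Ux0 sf] [fS gf mc]]]] := hS x0 Sx0.
have fx0 : f x0 = 0 by apply/(fS _ Ux0).
have C2 := sf 2%N; have C1 := sf 1%N.
set r := enorm (x0 - p) in r0 hmin.
have [e [e1 x0e]] : exists e, enorm e = 1 /\ x0 - p = r *: e.
  exists (r^-1 *: (x0 - p)); rewrite scalerA divff ?scale1r ?gt_eqF//; split => //.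
  by rewrite enormZ gtr0_norm ?invr_gt0// mulVf// gt_eqF.
have ee : dot e e = 1 by rewrite dot_enorm e1 expr1n.
have dist v : enorm (x0 + v - p) ^+ 2 - r ^+ 2 = enorm v ^+ 2 + 2 * r * dot e v.
  have -> : x0 + v - p = r *: e + v by rewrite -x0e addrAC.
  by rewrite -dot_enorm !dotE ee (dot_enorm v) (dotC v e); ring.
have cf x : U x -> {for x, continuous f} by case: C1 => h _; exact: h.
pose Om x := 0 < sg * (enorm (x - p) ^+ 2 - r ^+ 2).
have fOm x : U x -> Om x -> f x != 0.
  by move=> Ux Ox; apply/eqP => /(fS _ Ux) /hmin h; move: Ox; rewrite /Om ltNge h.
have [d d0 hd] := sign_near_sphere hsg oU cf Ux0 r0 fOm.
have sg2 : sg * sg = 1 by case: hsg => ->; ring.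
have absg : `|sg| = 1 by case: hsg => ->; rewrite ?normrN normr1.
(* The curve [x0 + t v + t^2 w] enters [Om] if [v] points into [Om], or if [v] is tangent to the
   sphere and [w] outweighs its curvature. *)
have into v w : (0 < sg * dot e v \/ dot e v = 0 /\ 0 < sg * (enorm v ^+ 2 + 2 * r * dot e w)) ->
    exists2 d1 : R, 0 < d1 & forall t, 0 < t < d1 ->
      enorm (x0 + t *: v + t ^+ 2 *: w - x0) < d /\ Om (x0 + t *: v + t ^+ 2 *: w).
  move=> hvw.
  have OmE t : sg * (enorm (x0 + t *: v + t ^+ 2 *: w - p) ^+ 2 - r ^+ 2) =
      t * (2 * r * (sg * dot e v)) + t ^+ 2 * (sg * (enorm v ^+ 2 + 2 * r * dot e w)) +
      t ^+ 3 * (sg * (2 * dot v w + t * enorm w ^+ 2)).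
    rewrite -[x0 + _ + _]addrA dist -dot_enorm !dotE (dot_enorm v) (dot_enorm w) (dotC w v).
    ring.
  pose M : R := `|enorm v ^+ 2 + 2 * r * dot e w| + 2 * `|dot v w| + enorm w ^+ 2.
  have M0 : 0 <= M by rewrite !addr_ge0 ?sqr_ge0 ?mulr_ge0.
  have [k k0 hk] : exists2 k : R, 0 < k & forall t, 0 < t -> t <= 1 -> t * M < k ->
      Om (x0 + t *: v + t ^+ 2 *: w).
    have b1 t : 0 < t -> t <= 1 -> `|sg * (2 * dot v w + t * enorm w ^+ 2)| <= 2 * `|dot v w| + enorm w ^+ 2.
      move=> t0 t1; rewrite normrM absg mul1r; apply: le_trans (ler_normD _ _) _.
      rewrite (normrM 2) (normrM t) (ger0_norm (ler0n _ 2)) (gtr0_norm t0) (ger0_norm (sqr_ge0 _)).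
      by rewrite lerD2l ler_piMl ?sqr_ge0.
    case: hvw => [hv|[hv hw]].
    - exists (2 * r * (sg * dot e v)); first by rewrite mulr_gt0// mulr_gt0.
      move=> t t0 t1 tM; rewrite /Om OmE.
      have -> : t * (2 * r * (sg * dot e v)) + t ^+ 2 * (sg * (enorm v ^+ 2 + 2 * r * dot e w)) +
        t ^+ 3 * (sg * (2 * dot v w + t * enorm w ^+ 2)) = t * (2 * r * (sg * dot e v) +
         t * (sg * (enorm v ^+ 2 + 2 * r * dot e w) + t * (sg * (2 * dot v w + t * enorm w ^+ 2)))) by ring.
      rewrite pmulr_rgt0//.
      have h1 : - M <= sg * (enorm v ^+ 2 + 2 * r * dot e w) + t * (sg * (2 * dot v w + t * enorm w ^+ 2)).
        rewrite lerNl; apply: le_trans (ler_norm _) _; rewrite normrN.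
        apply: le_trans (ler_normD _ _) _; rewrite /M -addrA; apply: lerD.
          by rewrite normrM absg mul1r.
        rewrite normrM gtr0_norm//; apply: le_trans (b1 t t0 t1).
        by rewrite ler_piMl.
      have := ler_wpM2l (ltW t0) h1; rewrite mulrN; lra.
    - exists (sg * (enorm v ^+ 2 + 2 * r * dot e w)) => //.
      move=> t t0 t1 tM; rewrite /Om OmE hv !mulr0 add0r.
      have -> : t ^+ 2 * (sg * (enorm v ^+ 2 + 2 * r * dot e w)) +
        t ^+ 3 * (sg * (2 * dot v w + t * enorm w ^+ 2)) = t ^+ 2 * (
         sg * (enorm v ^+ 2 + 2 * r * dot e w) + t * (sg * (2 * dot v w + t * enorm w ^+ 2))) by ring.
      rewrite pmulr_rgt0 ?exprn_gt0//.
      have h1 : - M <= sg * (2 * dot v w + t * enorm w ^+ 2).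
        rewrite lerNl; apply: le_trans (ler_norm _) _; rewrite normrN.
        by apply: le_trans (b1 t t0 t1) _; rewrite /M -addrA lerDr.
      have := ler_wpM2l (ltW t0) h1; rewrite mulrN; lra.
  have M1 : 0 < M + 1 by lra.
  have N1 : 0 < enorm v + enorm w + 1 by rewrite ltr_wpDl ?addr_ge0 ?enorm_ge0.
  exists (Num.min 1 (Num.min (k / (M + 1)) (d / (enorm v + enorm w + 1)))).
    by rewrite !lt_min ltr01 !divr_gt0.
  move=> t; rewrite !lt_min => /and4P[t0 t1 t2 t3].
  move: t2 t3; rewrite !ltr_pdivlMr// => t2 t3; split; last by apply: hk => //; [exact: ltW|lra].
  rewrite -[x0 + _ + _]addrA addrAC subrr add0r; apply: le_lt_trans (enormD _ _) _.
  rewrite !enormZ (gtr0_norm t0) ger0_norm ?sqr_ge0//.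
  have h : t ^+ 2 * enorm w <= t * enorm w.
    by rewrite ler_wpM2r ?enorm_ge0// expr2 ler_piMl ?(ltW t0)// ltW.
  move: t3; rewrite !mulrDr; lra.
(* [eps] is the constant sign that [f] has on [Om] near [x0]. *)
have [eps [heps hf]] : exists eps : R, (eps = 1 \/ eps = -1) /\ forall x, enorm (x - x0) < d -> Om x -> 0 < eps * f x.
  have [z hz Oz] : exists2 z, enorm (z - x0) < d & Om z.
    have := into (sg *: e) 0; rewrite dotZr ee mulr1 sg2 ltr01 => /(_ (or_introl isT))[d1 d10].
    by move=> /(_ (d1 / 2)) []; [lra|move=> ? ?; eexists; eassumption].
  exists (if 0 < f z then 1 else -1); case: ifPn => fz; split; try by [left|right].
  - by move=> x hx Ox; have := hd z x hz hx Oz Ox; rewrite mul1r pmulr_rgt0.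
  - move=> x hx Ox; have := hd z x hz hx Oz Ox; rewrite mulN1r oppr_gt0.
    move: fz; rewrite -leNgt le_eqVlt => /orP[/eqP ->|fz]; first by rewrite mul0r ltxx.
    by rewrite nmulr_rgt0.
have eps2 : eps * eps = 1 by case: heps => ->; ring.
set G := grad f x0.
have fo v : 0 < sg * dot e v -> 0 <= eps * dot G v.
  move=> hv; apply: (first_deriv oU C1 Ux0 fx0).
  have [d1 d10 h1] := into v 0 (or_introl hv); exists d1 => // t /h1.
  by rewrite scaler0 addr0 => -[h2 h3]; apply/ltW/hf.
(* After adding a small multiple of [sg *: e], both v and -v point into [Om]. In the limit the
   first-order inequality holds in both directions, so it is an equality. *)
have tang v : dot e v = 0 -> dot G v = 0.
  move=> ev.
  have h1 w : dot e w = 0 -> 0 <= eps * dot G w.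
    move=> ew; apply: (@ge0_of_small _ _ (eps * dot G (sg *: e))) => t t0.
    have := fo (w + t *: (sg *: e)); rewrite !dotDr !dotZr ew ee add0r mulr1 mulrCA sg2 mulr1 => /(_ t0).
    by rewrite mulrDr => h; rewrite [t * _]mulrCA.
  have h2 := h1 v ev; have h3 := h1 (- v); rewrite !dotNr ev oppr0 mulrN in h3.
  have {}h3 := h3 erefl.
  have h4 : eps * dot G v = 0 by lra.
  by rewrite -[LHS]mul1r -eps2 -mulrA h4 mulr0.
pose la := dot G e.
have GE : G = la *: e.
  apply/eqP; rewrite -subr_eq0 -enorm_eq0 -sqrf_eq0 -dot_enorm; apply/eqP.
  have h : dot e (G - la *: e) = 0 by rewrite !dotE ee mulr1 (dotC e) subrr.
  by rewrite {1}dotDl dotNl dotZl (tang _ h) h mulr0 subr0.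
have la0 : la != 0.
  apply/eqP => la0; have := gf x0 Ux0; rewrite -/G GE la0 scale0r eqxx//.
have NG : enorm G = `|la| by rewrite GE enormZ e1 mulr1.
have sla : eps * la = sg * `|la|.
  have := fo (sg *: e); rewrite !dotZr ee mulr1 sg2 => /(_ ltr01); rewrite -/la => h.
  have : `|eps * la| = `|la| by rewrite normrM; case: heps => ->; rewrite ?normrN normr1 mul1r.
  have h5 : 0 <= sg * (eps * la) by rewrite mulrCA.
  have : `|sg * (eps * la)| = `|la|.
    by rewrite normrM absg mul1r normrM; case: heps => ->; rewrite ?normrN normr1 mul1r.
  by rewrite ger0_norm// => <- _; rewrite mulrA sg2 mul1r.
pose H i j := partial j (partial i f) x0.
pose Q v := \sum_i \sum_j v 0 i * v 0 j * H i j.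
(* The curve with this [k] leaves the sphere towards [Om] by t at second order, so the
   second-derivative test applies to it; then t tends to 0. The bound is the second fundamental form
   of the sphere. *)
have so v : dot e v = 0 -> sg * enorm v ^+ 2 * `|la| / r <= eps * Q v.
  move=> ev; rewrite -subr_ge0; apply: (@ge0_of_small _ _ (2 * `|la|)) => t t0.
  pose k := t - sg * enorm v ^+ 2 / (2 * r).
  have := @quad_deriv R f U x0 v (k *: (sg *: e)) eps oU C2 Ux0 fx0 (tang _ ev).
  have : 0 < sg * (enorm v ^+ 2 + 2 * r * dot e (k *: (sg *: e))).
    rewrite !dotZr ee mulr1 /k.
    have -> : sg * (enorm v ^+ 2 + 2 * r * ((t - sg * enorm v ^+ 2 / (2 * r)) * sg)) =
      sg * enorm v ^+ 2 + (sg * sg) * 2 * r * t - (sg * sg) * sg * enorm v ^+ 2.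
      by field; rewrite gt_eqF.
    rewrite sg2 !mul1r addrAC subrr add0r !mulr_gt0//.
  move=> /(conj ev) /(@or_intror (0 < sg * dot e v)) /into [d1 d10 h1] h2.
  have : 0 <= eps * (Q v + 2 * dot G (k *: (sg *: e))).
    by apply: h2; exists d1 => // z /h1 [h3 h4]; apply/ltW/hf.
  rewrite !dotZr -/la => h3.
  have -> : eps * Q v - sg * enorm v ^+ 2 * `|la| / r + t * (2 * `|la|) =
     eps * Q v + 2 * `|la| * k by rewrite /k; field; rewrite gt_eqF.
  have e3 : eps * (2 * (k * (sg * la))) = 2 * k * sg * (eps * la) by ring.
  move: h3; rewrite mulrDr e3 sla.
  by have -> : 2 * k * sg * (sg * `|la|) = (sg * sg) * (2 * `|la| * k) by [ring]; rewrite sg2 mul1r.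
have trH := hessian_trace H ee.
set K := \sum_i H i i - \sum_i \sum_j e 0 i * e 0 j * H i j in trH.
have epsK : sg * 2 * `|la| / r <= eps * K.
  rewrite -trH big_distrr /=.
  apply: (@le_trans _ _ (\sum_(k < 3) sg * enorm (delta_mx 0 k - e 0 k *: e) ^+ 2 * `|la| / r)).
    have s2 : \sum_(k < 3) enorm (delta_mx 0 k - e 0 k *: e) ^+ 2 = 2.
      rewrite (_ : 2 = 3 - 2 * dot e e + dot e e * dot e e); last by rewrite ee; ring.
      rewrite (eq_bigr (fun k => dot (delta_mx 0 k - e 0 k *: e) (delta_mx 0 k - e 0 k *: e)));
        last by move=> k _; rewrite dot_enorm.
      by rewrite /dot !big_ord_recl !big_ord0 !mxE /=; ring.
    by rewrite -!big_distrl -big_distrr /= s2.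
  apply: ler_sum => k _; apply: so.
  rewrite !dotE ee mulr1 /dot (bigD1 k)//= big1; last first.
    by move=> j jk; rewrite mxE (negbTE jk) andbF mulr0.
  by rewrite !mxE !eqxx mulr1 addr0 subrr.
(* Zero mean curvature turns the bound [epsK] on the trace of the tangential Hessian into one on the
   radial derivative of [u]. *)
have := mc x0 Ux0 Sx0; rewrite (mean_curvature_eq oU Ux0 C2 du u0 (gf x0 Ux0)) /=.
rewrite -/G NG => /eqP; rewrite mulf_eq0 invr_eq0 mulf_eq0 expf_eq0 /= (gt_eqF u0) normr_eq0 (negbTE la0) /=.
have -> : (`|la| ^+ 2)^-1 * (\sum_i \sum_j G 0 i * G 0 j * partial j (partial i f) x0) =
   \sum_i \sum_j e 0 i * e 0 j * H i j.
  rewrite real_normK ?num_real// big_distrr /=; apply: eq_bigr => i _; rewrite big_distrr /=.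
  by apply: eq_bigr => j _; rewrite GE !mxE /H; field.
rewrite -/K GE dotZr x0e dotZr => /eqP hK.
have : eps * (2 * (la * dot (grad u x0) e) + u x0 * K) = 0 by rewrite hK mulr0.
have -> : eps * (2 * (la * dot (grad u x0) e) + u x0 * K) =
  2 * (eps * la) * dot (grad u x0) e + u x0 * (eps * K) by ring.
rewrite sla => h1.
have h2 : u x0 * (sg * 2 * `|la| / r) <= u x0 * (eps * K) by rewrite ler_pM2l.
have la1 : 0 < `|la| by rewrite normr_gt0.
have h3 : (2 * `|la| / r) * (sg * (u x0 + r * dot (grad u x0) e)) <= 0.
  have -> : (2 * `|la| / r) * (sg * (u x0 + r * dot (grad u x0) e)) =
    u x0 * (sg * 2 * `|la| / r) + 2 * (sg * `|la|) * dot (grad u x0) e by field; rewrite gt_eqF.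
  lra.
by move: h3; rewrite pmulr_rle0// !mulr_gt0// invr_gt0.
Qed.

End Barrier.

(** * Lebesgue measure on R^3 *)

Lemma inv_enorm_continuous (R : realType) (p x : vec3 R) : x != p ->
  {for x, continuous (fun z : vec3 R => (enorm (z - p))^-1)}.
Proof.
move=> xp; have n0 : enorm (x - p) != 0 by rewrite enorm_eq0 subr_eq0.
have c1 : continuous (fun z : vec3 R => enorm (z - p)).
  move=> z; apply: (@continuous_comp _ _ _ (fun w : vec3 R => w - p) (@enorm R)).
    exact: subr_continuous.
  exact: enorm_continuous.
have c2 := inv_continuous n0.
exact: (continuous_comp (c1 x) c2).
Qed.

Section Leb3.
Context {R : realType}.
Local Notation T3 := (R * R * R)%type.
Implicit Types (x : vec3 R) (y : T3).

Definition of_vec x : T3 := (x 0 0, x 0 1, x 0 2%:R).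

Lemma to_vecE y : (to_vec y 0 0 = y.1.1) * (to_vec y 0 1 = y.1.2) * (to_vec y 0 2%:R = y.2).
Proof. by rewrite !mxE. Qed.

Lemma ord3_ind (P : 'I_3 -> Prop) : P 0 -> P 1 -> P 2%:R -> forall i, P i.
Proof.
move=> p0 p1 p2 [[|[|[|//]]] hi].
- by rewrite (_ : Ordinal hi = 0)//; exact: val_inj.
- by rewrite (_ : Ordinal hi = 1)//; exact: val_inj.
- by rewrite (_ : Ordinal hi = 2%:R)//; exact: val_inj.
Qed.

Lemma of_vecK x : to_vec (of_vec x) = x.
Proof.
apply/matrixP => i j; rewrite ord1; move: j.
by apply: ord3_ind; rewrite to_vecE.
Qed.

Definition prod3 (I J K : interval R) : set T3 := ([set` I] `*` [set` J]) `*` [set` K].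

Lemma measurable_prod3 I J K : measurable (prod3 I J K).
Proof. by apply: measurableX => //; exact: measurableX. Qed.

Lemma leb3_prod3 (I J K : interval R) : leb3 R (prod3 I J K) =
  (lebesgue_measure [set` I] * lebesgue_measure [set` J] * lebesgue_measure [set` K])%E.
Proof.
rewrite /leb3 /= product_measure1E//; last exact: measurableX.
by congr (_ * _)%E; apply: product_measure1E.
Qed.

Definition cube x (h : R) : set T3 :=
  prod3 `]x 0 0 - h, x 0 0 + h[ `]x 0 1 - h, x 0 1 + h[ `]x 0 2%:R - h, x 0 2%:R + h[.

Lemma norm_lt3 x (h : R) : 0 < h -> (`|x| < h) <-> forall i, `|x 0 i| < h.
Proof.
move=> h0; split; first by move=> xh i; apply: le_lt_trans xh; exact: coord_le_norm.
move=> hx; rewrite [ltLHS]/Num.norm /= mx_normrE; apply/bigmax_ltP; split => //= -[i j] _ /=.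
by rewrite ord1.
Qed.

Lemma cubeP x (h : R) y : 0 < h -> cube x h y <-> `|to_vec y - x| < h.
Proof.
move=> h0; rewrite (norm_lt3 _ h0) /cube /prod3 /= !in_itv /=; split.
  move=> [[h1 h2] h3]; apply: ord3_ind; rewrite !mxE /= ltr_norml;
    lra.
move=> hi; have := hi 0; have := hi 1; have := hi 2%:R.
rewrite !mxE /= !ltr_norml => /andP[a1 a2] /andP[b1 b2] /andP[c1 c2].
by split; [split|]; lra.
Qed.

Lemma leb3_cube x (h : R) : 0 < h -> leb3 R (cube x h) = ((2 * h) ^+ 3)%:E.
Proof.
move=> h0; rewrite /cube leb3_prod3 !lebesgue_measure_itv /= !lte_fin.
have e (a : R) : a + h - (a - h) = 2 * h by ring.
have l (a : R) : a - h < a + h by lra.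
by rewrite !l -!EFinB !e -!EFinM -expr2 -exprSr.
Qed.

Lemma measurable_cube x (h : R) : measurable (cube x h).
Proof. exact: measurable_prod3. Qed.

(** The sigma-algebra is the product one, so an open set has to be exhibited as a countable union of
    boxes: cubes with rational centers and half sides 1/(m+1) that are contained in it. *)
Lemma measurable_preimage_open (U : set (vec3 R)) : open U -> measurable (@to_vec R @^-1` U).
Proof.
move=> oU.
pose q (i : rat * rat * rat * nat) : vec3 R :=
  \row_(j < 3) [:: ratr i.1.1.1; ratr i.1.1.2; ratr i.1.2]`_j.
pose B (i : rat * rat * rat * nat) : set T3 :=
  if `[< forall z : vec3 R, `|z - q i| < i.2.+1%:R^-1 -> U z >] then cube (q i) i.2.+1%:R^-1 else set0.
have -> : @to_vec R @^-1` U = \bigcup_i B i.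
  apply/seteqP; split => [y Uy|y [i _]]; last first.
    rewrite /B; case: asboolP => // h /cubeP; rewrite invr_gt0 ltr0n => /(_ isT).
    exact: h.
  have [d d0 hd] := nbhs_eball (open_nbhs_nbhs (conj oU Uy)).
  (* A cube of half side below d/6 that contains [y] lies within sup distance d/3 of it, hence
     within Euclidean distance d. *)
  have [m hm] : exists m : nat, m.+1%:R^-1 < d / 6.
    have d6 : 0 < d / 6 by rewrite divr_gt0.
    have d7 : 0 < (d / 6)^-1 by rewrite invr_gt0.
    have hm := archi_boundP (ltW d7).
    exists (Num.bound (d / 6)^-1); rewrite -[ltRHS]invrK ltf_pV2 ?posrE ?invr_gt0//.
    by apply: lt_le_trans hm _; rewrite ler_nat.
  have m0 : 0 < m.+1%:R^-1 :> R by rewrite invr_gt0.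
  have rt (a : R) : exists r : rat, `|a - ratr r| < m.+1%:R^-1.
    move: m0; move: (m.+1%:R^-1) => e e0.
    have /rat_in_itvoo[r] : a - e < a + e by lra.
    by rewrite in_itv /= => /andP[h1 h2]; exists r; rewrite ltr_norml; lra.
  have [r0 h0] := rt y.1.1; have [r1 h1] := rt y.1.2; have [r2 h2] := rt y.2.
  exists (r0, r1, r2, m) => //; rewrite /B.
  have hy : `|to_vec y - q (r0, r1, r2, m)| < m.+1%:R^-1.
    by apply/norm_lt3 => //; apply: ord3_ind; rewrite !mxE.
  case: asboolP => [_|]; first exact/cubeP.
  move=> nh; exfalso; apply: nh => z hz; apply: hd; apply: le_lt_trans (enorm_le_norm _) _.
  have : `|z - to_vec y| <= `|z - q (r0, r1, r2, m)| + `|to_vec y - q (r0, r1, r2, m)|.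
    by rewrite -(subrKA (q (r0, r1, r2, m))) [X in _ <= _ + X]distrC ler_normD.
  by move: hm hz hy; rewrite /=; move: (m.+1%:R^-1) => e; lra.
apply: countable_bigcupT_measurable => // i; rewrite /B; case: ifP => // _.
exact: measurable_cube.
Qed.

(** One exceptional point is allowed, for the singularity of the Newtonian kernel; the preimage of
    this point is a measurable singleton. *)
Lemma measurable_to_vec (g : vec3 R -> R) (x0 : vec3 R) :
  (forall x, x != x0 -> {for x, continuous g}) ->
  measurable_fun [set: T3] (g \o @to_vec R).
Proof.
move=> cg _; apply: (measurability _ (RGenOInfty.measurableE R)) => //.
move=> /= _ [_ [a ->] <-]; rewrite setTI.
pose U := [set x | x != x0 /\ a < g x].
have oU : open U.
  rewrite openE => x [xx0 ax]; apply: filterI.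
    have : 0 < enorm (x - x0) by rewrite enorm_gt0 subr_eq0.
    move=> h; apply: filterS (eball_nbhs x h) => z; rewrite /eball /= => hz.
    by apply: contraTneq hz => ->; rewrite enormBC ltxx.
  have := cg x xx0; move=> /(@cvgrPdist_lt R R _ (nbhs x)) /(_ (g x - a)).
  rewrite subr_gt0 => /(_ ax); apply: filterS => z; rewrite ltr_norml; lra.
have -> : (g \o @to_vec R) @^-1` `]a, +oo[ =
    (@to_vec R @^-1` U) `|` (if a < g x0 then @to_vec R @^-1` [set x0] else set0).
  apply/seteqP; split => y /=; rewrite ?in_itv /= ?andbT.
    move=> ay; have [e|ne] := eqVneq (to_vec y) x0; last by left.
    by right; rewrite -e ay.
  by move=> [[]//|]; case: ifP => // h /= ->.
apply: measurableU; first exact: measurable_preimage_open.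
case: ifP => // _.
have -> : @to_vec R @^-1` [set x0] = [set of_vec x0].
  apply/seteqP; split => y /=; last by move=> ->; exact: of_vecK.
  by move=> <-; rewrite /of_vec !to_vecE -!surjective_pairing.
have -> : [set of_vec x0] = prod3 `[x0 0 0, x0 0 0] `[x0 0 1, x0 0 1] `[x0 0 2%:R, x0 0 2%:R].
  rewrite /prod3 !set_itv1; apply/seteqP; split => [y ->//|[[a1 a2] a3]] /=.
  by move=> [[/= -> ->] ->].
exact: measurable_prod3.
Qed.

Lemma leb3_open_gt0 (U : set (vec3 R)) x : open U -> U x -> (0 < leb3 R (@to_vec R @^-1` U))%E.
Proof.
move=> oU Ux; have [d d0 hd] := nbhs_eball (open_nbhs_nbhs (conj oU Ux)).
apply: (@lt_le_trans _ _ (leb3 R (cube x (d / 3)))).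
  by rewrite leb3_cube ?divr_gt0// lte_fin exprn_gt0// mulr_gt0// divr_gt0.
apply: le_measure; rewrite ?inE; [exact: measurable_cube|exact: measurable_preimage_open|].
move=> y /cubeP; rewrite divr_gt0// => /(_ isT) h; apply: hd.
apply: le_lt_trans (enorm_le_norm _) _; move: h; lra.
Qed.

(** The set where |A| exceeds its essential supremum is open and has measure zero, and nonempty open
    sets have positive measure. The bound [M] makes the essential supremum finite, so that [fine]
    does not replace it by 0. *)
Lemma Linfty_ub (A : vec3 R -> R) (M : R) : continuous A -> (forall x, `|A x| <= M) ->
  forall x, `|A x| <= Linfty_norm A.
Proof.
move=> cA AM x; rewrite leNgt; apply/negP => hx.
have muT : (0 < leb3 R [set: T3])%E.
  by have := @leb3_open_gt0 setT 0 openT I; rewrite preimage_setT.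
move: hx; rewrite /Linfty_norm Lnorm.unlock muT.
set f := fun y : T3 => (A (to_vec y))%:E.
set e := ess_sup (leb3 R) (abse \o f).
have eM : (e <= M%:E)%E.
  by apply/ess_supP; apply: aeW => y; rewrite /= lee_fin.
have e0 : (0 <= e)%E.
  by apply: ess_sup_gee => //; apply: aeW => y /=.
have efin : e \is a fin_num by rewrite ge0_fin_numE// (le_lt_trans eM)// ltry.
move=> hx; pose U := [set z | fine e < `|A z|].
have oU : open U.
  apply: (@open_comp _ _ (fun z => `|A z|) [set t | fine e < t]); last exact: open_gt.
  move=> z _; apply: continuous_comp; [exact: cA|exact: norm_continuous].
have [N [mN N0 hN]] : (leb3 R).-negligible (~` [set y | ((abse \o f) y <= e)%E]).
  exact: ess_sup_ge.
have : (leb3 R (@to_vec R @^-1` U) <= leb3 R N)%E.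
  apply: le_measure; rewrite ?inE//; first exact: measurable_preimage_open.
  move=> y /= Uy; apply: hN => /=; apply/negP; rewrite -ltNge -(fineK efin) lte_fin.
  exact: Uy.
by rewrite N0 leNgt (leb3_open_gt0 oU hx).
Qed.

Lemma integral_cst_indic (B : set T3) (c : R) : measurable B -> 0 <= c ->
  (\int[leb3 R]_y (c * \1_B y)%:E = c%:E * leb3 R B)%E.
Proof.
move=> mB c0; under eq_integral do rewrite EFinM.
rewrite ge0_integralZl_EFin//; last first.
  by apply/measurable_EFinP; exact: measurable_indic.
by rewrite integral_indic// setIT.
Qed.

Lemma dyadic_scale (z h : R) : 0 < z -> z < h -> exists k : nat, h / 2 ^+ k.+1 <= z < h / 2 ^+ k.
Proof.
move=> z0 zh.
have h0 : 0 < h by exact: lt_trans zh.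
have ex : exists k : nat, h / 2 ^+ k.+1 <= z.
  have hm := archi_boundP (ltW (divr_gt0 h0 z0)).
  exists (Num.bound (h / z)); rewrite ler_pdivrMr ?exprn_gt0// mulrC -ler_pdivrMr//.
  apply: le_trans (ltW hm) _; rewrite -natrX ler_nat; apply: leq_trans (leqnSn _) _.
  exact: ltnW (ltn_expl _ _).
have := ex_minnP ex; case=> k hk kmin; exists k; rewrite hk /=.
case: k hk kmin => [|k] hk kmin; first by rewrite expr0 divr1.
by rewrite ltNge; apply/negP => /kmin; rewrite ltnn.
Qed.

(** Between the concentric cubes of half sides h/2^(k+1) and h/2^k the kernel is at most 2^(k+1)/h,
    and the larger cube has volume 8h^3/8^k. The sum of 16 h^2 / 4^k over all k is 64/3 h^2 <= 22
    h^2. *)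
Lemma integral_inv_cube x (h : R) : 0 < h ->
  (\int[leb3 R]_y ((enorm (x - to_vec y))^-1 * \1_(cube x h) y)%:E <= (22 * h ^+ 2)%:E)%E.
Proof.
move=> h0.
pose F (k : nat) (y : T3) : \bar R := (2 ^+ k.+1 / h * \1_(cube x (h / 2 ^+ k)) y)%:E.
have hk0 k : 0 < h / 2 ^+ k by rewrite divr_gt0// exprn_gt0.
have F0 k y : (0 <= F k y)%E.
  by rewrite lee_fin mulr_ge0// divr_ge0 ?exprn_ge0// ltW.
have mF k : measurable_fun [set: T3] (F k).
  apply/measurable_EFinP; apply: measurable_funM; first exact: measurable_cst.
  by apply: measurable_indic; exact: measurable_cube.
have IF k : (\int[leb3 R]_y F k y = (16 * h ^+ 2 * (4^-1) ^+ k)%:E)%E.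
  rewrite integral_cst_indic ?divr_ge0 ?exprn_ge0 ?(ltW h0)//; last exact: measurable_cube.
  rewrite leb3_cube// -EFinM; congr (_%:E).
  have k2 : 2 ^+ k != 0 :> R by rewrite expf_neq0.
  rewrite exprS (_ : (4^-1 : R) = (2 ^+ 2)^-1); last by congr (_^-1); ring.
  by rewrite exprVn -exprM mulnC exprM; field; rewrite k2 gt_eqF.
apply: (@le_trans _ _ (\int[leb3 R]_y (\sum_(0 <= k <oo) F k y))%E).
  apply: ge0_le_integral => //.
  - by move=> y _; rewrite lee_fin mulr_ge0// invr_ge0 enorm_ge0.
  - apply/measurable_EFinP; apply: measurable_funM; last first.
      by apply: measurable_indic; exact: measurable_cube.
    apply: (@measurable_to_vec (fun z => (enorm (x - z))^-1) x) => z zx.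
    have -> : (fun z => (enorm (x - z))^-1) = (fun z => (enorm (z - x))^-1).
      by apply/funext => t; rewrite enormBC.
    exact: inv_enorm_continuous.
  - exact: (@ge0_emeasurable_sum _ _ _ _ F xpredT).
  - move=> y _; rewrite indicE; have [yc|_] := boolP (y \in cube x h); last first.
      by rewrite mulr0; exact: nneseries_ge0.
    rewrite mulr1; move: yc; rewrite inE => /(cubeP _ _ h0) hy.
    (* At the singularity the integrand is 0, as the inverse of 0 is 0. *)
    have [e|ne] := eqVneq (to_vec y) x.
      by rewrite e subrr enorm0 invr0; exact: nneseries_ge0.
    have z0 : 0 < `|to_vec y - x| by rewrite normr_gt0 subr_eq0.
    have [k /andP[k1 k2]] := dyadic_scale z0 hy.
    apply: (@le_trans _ _ (F k y)).
      rewrite /F indicE mem_set; last exact/cubeP.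
      rewrite mulr1 lee_fin -[leRHS]invrK invf_div lef_pV2 ?posrE//.
        by apply: (le_trans k1); rewrite distrC; exact: norm_le_enorm.
      by rewrite enorm_gt0 subr_eq0 eq_sym.
    apply: (@le_trans _ _ (\sum_(0 <= i < k.+1) F i y)%E); last exact: nneseries_lim_ge.
    by rewrite big_nat_recr//= leeDr// sume_ge0.
rewrite integral_nneseries//.
apply: lime_le; first by apply: is_cvg_nneseries => k _ _; exact: integral_ge0.
apply: nearW => m; rewrite (eq_bigr (fun k => (16 * h ^+ 2 * (4^-1) ^+ k)%:E)); last by move=> k _; rewrite IF.
rewrite sumEFin lee_fin big_mkord -big_distrr /=.
have : \sum_(k < m) (4^-1 : R) ^+ k = (1 - 4^-1 ^+ m) / (1 - 4^-1).
  by have := @subrX1 R 4^-1 m; rewrite -opprB => /eqP; rewrite eqr_oppLR => /eqP ->; field.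
move=> ->; have : 0 <= (4^-1 : R) ^+ m by rewrite exprn_ge0.
set a := _ ^+ m => a0.
have -> : 16 * h ^+ 2 * ((1 - a) / (1 - 4^-1)) = 64 / 3 * h ^+ 2 * (1 - a) by field.
have h2 : 0 < h ^+ 2 by rewrite exprn_gt0.
nra.
Qed.

End Leb3.

(** * Densities *)

Section Density.
Context {R : realType}.
Variables (D : R) (A : vec3 R -> R).
Hypothesis D0 : 0 < D.
Hypothesis hA : admissible_density D A.

Lemma bounded_of_support (f : vec3 R -> R) (d : R) : 0 <= d -> continuous f ->
  (forall x, f x != 0 -> forall j, `|x 0 j| <= d) -> exists M, forall x, `|f x| <= M.
Proof.
move=> d0 cf sf.
pose K := [set v : vec3 R | forall i, `[- d, d]%classic (v ord0 i)].
have cK : compact K by apply: (@rV_compact R 3 (fun _ => `[- d, d]%classic)) => i; exact: segment_compact.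
have K0 : K !=set0 by exists 0 => i /=; rewrite mxE in_itv /= oppr_le0 d0.
have cn : continuous (fun x => `|f x|).
  by move=> x; apply: continuous_comp; [exact: cf|exact: norm_continuous].
have [c cin hc] := EVT_max_rV K0 cK (@continuous_subspaceT _ _ K _ cn).
exists `|f c| => x; have [->|fx] := eqVneq (f x) 0; first by rewrite normr0.
by apply: hc; rewrite inE => i /=; rewrite in_itv /= -ler_norml; exact: sf.
Qed.

Let cA : continuous A.
Proof. by case: hA => sA _ _ x; case: (sA 0%N) => + _; apply. Qed.

Definition sup_density := Linfty_norm A.
Definition sup_grad := Linfty_norm (fun x => enorm (grad A x)).

Lemma density_le x : A x <= sup_density.
Proof.
have [_ A0 sA] := hA; have [M hM] := bounded_of_support (ltW D0) cA sA.
by have := Linfty_ub cA hM x; rewrite ger0_norm.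
Qed.

Lemma density_ge0 x : 0 <= A x. Proof. by have [_ + _] := hA; apply. Qed.

Lemma density_continuous : continuous A. Proof. exact: cA. Qed.

Lemma sup_density_ge0 : 0 <= sup_density.
Proof. by apply: le_trans (density_le 0); exact: density_ge0. Qed.

Lemma density_far (x : vec3 R) (i : 'I_3) : D < `|x 0 i| -> A x = 0.
Proof. by have [_ _ sA] := hA; rewrite ltNge; apply: contraNeq => /sA. Qed.

(** The support is only assumed to lie in the closed cube; by continuity [A] also vanishes on its
    faces. This matters because the half-open boxes do not cover all of the faces. *)
Lemma density_edge (x : vec3 R) (i : 'I_3) : D <= `|x 0 i| -> A x = 0.
Proof.
move=> hx; apply: contraTeq isT => nx; exfalso.
have Ax : 0 < A x by rewrite lt_def nx density_ge0.
have /(@cvgrPdist_lt R R _ (nbhs x)) /(_ _ Ax) /nbhs_eball[d d0 hd] := @cA x.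
pose sg : R := if 0 <= x 0 i then 1 else -1.
pose z : vec3 R := x + (sg * (d / 2)) *: delta_mx 0 i.
have ez : enorm (z - x) < d.
  rewrite /z addrC addKr enormZ enorm_delta mulr1 normrM /sg.
  by case: ifP; rewrite ?normrN normr1 mul1r ger0_norm ?divr_ge0 ?(ltW d0)//; lra.
have /(density_far) Az : D < `|z 0 i|.
  rewrite !mxE !eqxx /= mulr1 /sg; move: hx.
  case: ifP => [h|/negbT]; first by rewrite !ger0_norm ?addr_ge0 ?mulr_ge0//; lra.
  by rewrite -ltNge => h; rewrite !ltr0_norm; lra.
by have := hd z ez; rewrite /= Az subr0 ger0_norm ?ltxx// ltW.
Qed.

Lemma grad_continuous : continuous (fun x => enorm (grad A x)).
Proof.
have [sA _ _] := hA.
have cp i : continuous (partial i A).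
  by move=> x; have [_ /(_ i)[_ [+ _]]] := sA 1%N; apply.
pose q (x : vec3 R) := partial 0 A x * partial 0 A x + (partial 1 A x * partial 1 A x + partial 2%:R A x * partial 2%:R A x).
have cq : continuous q.
  have cm i x : {for x, continuous (partial i A * partial i A)} := continuousM (cp i x) (cp i x).
  by move=> x; exact: (continuousD (cm 0 x) (continuousD (cm 1 x) (cm 2%:R x))).
have -> : (fun x => enorm (grad A x)) = (fun x => Num.sqrt (q x)).
  apply/funext => x; rewrite /enorm /q !big_ord_recl big_ord0 addr0 !mxE -!expr2.
  rewrite (_ : lift ord0 ord0 = 1 :> 'I_3); last exact: val_inj.
  by rewrite (_ : lift ord0 (lift ord0 ord0) = 2%:R :> 'I_3); last exact: val_inj.
by move=> x; exact: (continuous_comp (cq x) (@sqrt_continuous R _)).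
Qed.

Lemma grad_le x : enorm (grad A x) <= sup_grad.
Proof.
have sg y : enorm (grad A y) != 0 -> forall j, `|y 0 j| <= D.
  apply: contra_neqP => /existsNP[j /negP]; rewrite -ltNge => hj.
  suff -> : grad A y = 0 by exact: enorm0.
  apply/rowP => i; rewrite !mxE /partial.
  have : \forall z \near y, A z = cst 0 z.
    have d0 : 0 < `|y 0 j| - D by rewrite subr_gt0.
    apply: filterS (eball_nbhs y d0) => z; rewrite /eball /= => hz.
    apply: (@density_far _ j).
    have h1 := coord_le_enorm (z - y) j; rewrite !mxE in h1.
    have := ler_normB (z 0 j) (z 0 j - y 0 j).
    by rewrite opprB addrC subrK => h2; lra.
  by move=> h; rewrite (near_eq_derive _ h) ?derive_cst// ; apply/eqP => /matrixP /(_ 0 i) /eqP; rewrite !mxE !eqxx oner_eq0.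
have [M hM] := bounded_of_support (ltW D0) grad_continuous sg.
by have := Linfty_ub grad_continuous hM x; rewrite ger0_norm ?enorm_ge0.
Qed.

Lemma sup_grad_ge0 : 0 <= sup_grad.
Proof. by apply: le_trans (grad_le 0); exact: enorm_ge0. Qed.

(** The coordinatewise mean value estimate with reference derivatives 0, whose natural distance is
    the l^1 one. *)
Lemma density_lipschitz x y : `|A y - A x| <= sup_grad * \sum_i `|y 0 i - x 0 i|.
Proof.
have [sA _ _] := hA; have [_ h1] := sA 1%N.
have := @mvt3 R A x (y - x) (fun _ => 0) sup_grad _ (lexx _) _.
rewrite (addrC x) subrK (_ : \sum_i (y - x) 0 i * 0 = 0); last by apply: big1 => i _; rewrite mulr0.
rewrite subr0 (_ : \sum_i `|(y - x) 0 i| = \sum_i `|y 0 i - x 0 i|); last by apply: eq_bigr => i _; rewrite !mxE.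
apply => i z _; split; first by have [+ _] := h1 i; apply.
rewrite subr0; apply: le_trans (grad_le z).
by have := coord_le_enorm (grad A z) i; rewrite mxE.
Qed.

End Density.

(** * Riemann sums of Newtonian potentials *)

Section Boxes.
Context {R : realType}.
Variables (D : R) (n : nat).
Hypotheses (D0 : 0 < D) (n0 : (0 < n)%N).
Local Notation T3 := (R * R * R)%type.
Local Notation s := (D / n%:R).
Implicit Types (j : box n) (y : T3).

Let nR : 0 < n%:R :> R. Proof. by rewrite ltr0n. Qed.
Let s0 : 0 < s. Proof. by rewrite divr_gt0. Qed.

(** Half-open, so that the boxes are pairwise disjoint and a step function takes exactly one
    coefficient at each point that they cover. *)
Definition half_open_box j : set T3 :=
  let p := center D j in
  prod3 `[p 0 0 - s / 2, p 0 0 + s / 2[ `[p 0 1 - s / 2, p 0 1 + s / 2[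
    `[p 0 2%:R - s / 2, p 0 2%:R + s / 2[.

Lemma half_open_boxP j y : half_open_box j y <->
  forall k, center D j 0 k - s / 2 <= to_vec y 0 k < center D j 0 k + s / 2.
Proof.
rewrite /half_open_box /prod3 /=; move: (center D j) => p.
rewrite !in_itv /= -!to_vecE; split; first by move=> [[h1 h2] h3]; exact: ord3_ind.
by move=> h; split; [split|]; exact: h.
Qed.

Lemma half_open_boxE j y : half_open_box j y <->
  forall k, (j k)%:R <= (to_vec y 0 k + D) / s < (j k).+1%:R.
Proof.
rewrite half_open_boxP; split => h k; have := h k; rewrite !mxE -[(j k).+1%:R]natr1 ler_pdivlMr// ltr_pdivrMr//;
  by move: (s) s0 => e e0 /andP[h1 h2]; apply/andP; split; lra.
Qed.

Lemma half_open_box_inj j j' y : half_open_box j y -> half_open_box j' y -> j = j'.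
Proof.
move=> /half_open_boxE h /half_open_boxE h'; apply/ffunP => k; apply: val_inj => /=.
by rewrite -(truncn_def (h k)) -(truncn_def (h' k)).
Qed.

Lemma half_open_box_cover y : (forall k, `|to_vec y 0 k| < D) -> exists j, half_open_box j y.
Proof.
move=> hy.
have y0 k : 0 <= (to_vec y 0 k + D) / s.
  by rewrite divr_ge0 ?(ltW s0)//; have := hy k; rewrite ltr_norml => /andP[h _]; lra.
have y1 (k : 'I_3) : (Num.trunc ((to_vec y 0 k + D) / s)%R < 2 * n)%N.
  rewrite -(ltr_nat R); apply: le_lt_trans (_ : (to_vec y 0 k + D) / s < _).
    by have /andP[] := truncn_itv (y0 k).
  rewrite ltr_pdivrMr// (_ : (2 * n)%:R * s = 2 * D); last by rewrite natrM; field; rewrite gt_eqF.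
  by have := hy k; rewrite ltr_norml => /andP[_ h]; lra.
exists [ffun k => Ordinal (y1 k)]; apply/half_open_boxE => k.
by rewrite ffunE /=; exact: truncn_itv.
Qed.

Lemma measurable_half_open_box j : measurable (half_open_box j).
Proof. exact: measurable_prod3. Qed.

Lemma leb3_half_open_box j : leb3 R (half_open_box j) = (s ^+ 3)%:E.
Proof.
rewrite /half_open_box leb3_prod3 !lebesgue_measure_itv /= !lte_fin.
have l (a : R) : a - s / 2 < a + s / 2 by move: (s) s0 => e e0; lra.
have e (a : R) : a + s / 2 - (a - s / 2) = s by move: (s) => b; field.
by rewrite !l -!EFinB !e -!EFinM -expr2 -exprSr.
Qed.

Definition step (c : box n -> R) y : R := \sum_j c j * \1_(half_open_box j) y.

Lemma step_in c j y : half_open_box j y -> step c y = c j.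
Proof.
move=> hj; rewrite /step (bigD1 j)//= indicE mem_set// mulr1 big1 ?addr0// => k kj.
rewrite indicE memNset ?mulr0// => hk; move: kj.
by rewrite (half_open_box_inj hk hj) eqxx.
Qed.

Lemma step_out c y : ~ (exists j, half_open_box j y) -> step c y = 0.
Proof.
move=> ny; apply: big1 => k _; rewrite indicE memNset ?mulr0// => hk.
by apply: ny; exists k.
Qed.

Lemma step_ge0 c y : (forall j, 0 <= c j) -> 0 <= step c y.
Proof. by move=> c0; apply: sumr_ge0 => j _; rewrite mulr_ge0. Qed.

Lemma measurable_step c : measurable_fun [set: T3] (step c).
Proof.
apply: measurable_sum => j; apply: measurable_funM; first exact: measurable_cst.
by apply: measurable_indic; exact: measurable_half_open_box.
Qed.

Lemma integral_step c : (forall j, 0 <= c j) ->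
  (\int[leb3 R]_y (step c y)%:E = (s ^+ 3 * \sum_j c j)%:E)%E.
Proof.
move=> c0; under eq_integral do rewrite /step -sumEFin.
rewrite ge0_integral_sum//; last first.
- by move=> j y _; rewrite lee_fin mulr_ge0.
- move=> j; apply/measurable_EFinP; apply: measurable_funM; first exact: measurable_cst.
  by apply: measurable_indic; exact: measurable_half_open_box.
rewrite big_distrr -sumEFin /=; apply: eq_bigr => j _.
rewrite integral_cst_indic//; last exact: measurable_half_open_box.
by rewrite leb3_half_open_box -EFinM mulrC.
Qed.

End Boxes.

Lemma far_quotient (R : realFieldType) (a q X Y t sg LA e : R) :
  0 < t -> t / 2 <= X -> t / 2 <= Y -> `|X - Y| <= sg -> 0 <= a <= LA -> `|a - q| <= e ->
  `|a / X - q / Y| <= 4 * sg * LA / t ^+ 2 + 2 * e / t.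
Proof.
move=> t0 tX tY hXY /andP[a0 aL] aq.
have X0 : 0 < X by lra.
have Y0 : 0 < Y by lra.
have iX : X^-1 <= 2 / t by rewrite -[leRHS]invf_div lef_pV2 ?posrE//; lra.
have iY : Y^-1 <= 2 / t by rewrite -[leRHS]invf_div lef_pV2 ?posrE//; lra.
have iX0 : 0 < X^-1 by rewrite invr_gt0.
have iY0 : 0 < Y^-1 by rewrite invr_gt0.
have -> : a / X - q / Y = a * (Y - X) * (X^-1 * Y^-1) + (a - q) * Y^-1.
  by field; rewrite !gt_eqF.
apply: le_trans (ler_normD _ _) _; apply: lerD.
  rewrite !normrM (ger0_norm a0) (distrC Y) (gtr0_norm iX0) (gtr0_norm iY0).
  have -> : 4 * sg * LA / t ^+ 2 = LA * sg * (2 / t * (2 / t)) by field; rewrite gt_eqF.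
  by apply: ler_pM; rewrite ?mulr_ge0 ?(ltW iX0) ?(ltW iY0)//; apply: ler_pM; rewrite ?(ltW iX0) ?(ltW iY0).
rewrite normrM (gtr0_norm iY0) (_ : 2 * e / t = e * (2 / t)); last by ring.
by apply: ler_pM; rewrite ?(ltW iY0).
Qed.

(** A round number above the two constants of the comparison below: 1782 + 1008 = 2790 in one
    direction and 2 * 16^3 + 1008 = 9200 in the other. *)
Definition lattice_const {R : realType} : R := 10 ^+ 4.

Lemma lattice_const_ge {R : realType} : 9200 <= @lattice_const R.
Proof. by rewrite /lattice_const (_ : 10 ^+ 4 = 100 * 100); [lra | ring]. Qed.

Lemma lattice_const_ge0 {R : realType} : 0 < @lattice_const R.
Proof. by rewrite exprn_gt0. Qed.

(** * Comparison of a Riemann sum with the Newtonian potential *)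

Section SamplePotential.
Context {R : realType}.
Variables (D : R) (n : nat).
Hypotheses (D0 : 0 < D) (n0 : (0 < n)%N).
Variable A : vec3 R -> R.
Hypothesis hA : admissible_density D A.
Variables (w : box n -> R) (del : R).
Hypotheses (w0 : forall j, 0 <= w j) (del0 : 0 <= del).
Local Notation T3 := (R * R * R)%type.
Local Notation s := (D / n%:R).
Local Notation LA := (sup_density A).
Local Notation LdA := (sup_grad A).
Hypothesis hw : forall j, n%:R ^+ 4 * `|w j - A (center D j) * s ^+ 3| <= del.
Implicit Types (j : box n) (y : T3) (x a : vec3 R).

Let nR : 0 < n%:R :> R. Proof. by rewrite ltr0n. Qed.
Let n1 : 1 <= n%:R :> R. Proof. by rewrite ler1n. Qed.
Let s0 : 0 < s. Proof. by rewrite divr_gt0. Qed.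
Let LA0 : 0 <= LA. Proof. exact: (sup_density_ge0 D0 hA). Qed.
Let LdA0 : 0 <= LdA. Proof. exact: (sup_grad_ge0 D0 hA). Qed.

Definition sample_sum x : R := \sum_j w j / enorm (x - center D j).
(** The summand 1 makes it at least 1, so that it can absorb numbers and its own lower powers. *)
Definition size_const : R := 1 + LA * D ^+ 2 + LdA * D ^+ 3 + del / D.
Local Notation M := size_const.

Lemma size_const_ge1 : 1 <= M.
Proof.
have q1 : 0 <= LA * D ^+ 2 by rewrite mulr_ge0 ?exprn_ge0 ?(ltW D0).
have q2 : 0 <= LdA * D ^+ 3 by rewrite mulr_ge0 ?exprn_ge0 ?(ltW D0).
have q3 : 0 <= del / D by rewrite divr_ge0 ?(ltW D0).
by rewrite /size_const; lra.
Qed.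

(** [eA] bounds the difference between A and w_j/s^3 on box j: the l^1 distance from the center is
    at most 3s/2, and the rest is the defect. [errE] is the resulting error of the integrand on one
    box. *)
Let eA : R := 3 / 2 * s * LdA + del / (n%:R ^+ 4 * s ^+ 3).
Let errE x j : R := 18 * s * LA / `|x - center D j| ^+ 2 + 2 * eA / `|x - center D j|.

(** Without the gradient term of [size_const]: this bound is what the threshold for n rests on, and
    that has to be of class C. *)
Lemma weight_le4 j : w j <= D * (1 + LA * D ^+ 2 + del / D) / n%:R ^+ 3.
Proof.
have h := hw j.
have n4 : 0 < n%:R ^+ 4 :> R by rewrite exprn_gt0.
have h1 : w j <= A (center D j) * s ^+ 3 + del / n%:R ^+ 4.
  rewrite -lerBlDl; apply: le_trans (ler_norm _) _.
  by rewrite ler_pdivlMr// mulrC.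
apply: (le_trans h1).
have -> : D * (1 + LA * D ^+ 2 + del / D) / n%:R ^+ 3 = LA * s ^+ 3 + del / n%:R ^+ 3 + D / n%:R ^+ 3.
  by field; rewrite !gt_eqF.
rewrite -[leLHS]addr0; apply: lerD; last by rewrite divr_ge0 ?exprn_ge0 ?(ltW D0) ?(ltW nR).
apply: lerD; first by rewrite ler_wpM2r ?exprn_ge0 ?(ltW s0)//; exact: (density_le D0 hA).
rewrite ler_wpM2l// lef_pV2 ?posrE ?exprn_gt0//.
by rewrite [leRHS]exprS ler_peMl ?exprn_ge0 ?(ltW nR).
Qed.

Lemma weight_le j : w j <= D * M / n%:R ^+ 3.
Proof.
apply: le_trans (weight_le4 j) _.
rewrite ler_pM2r ?invr_gt0 ?exprn_gt0// ler_pM2l// /size_const.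
have q2 : 0 <= LdA * D ^+ 3 by rewrite mulr_ge0 ?exprn_ge0 ?(ltW D0).
by lra.
Qed.

Let in_box_enorm j y : half_open_box D j y ->
  \sum_i `|to_vec y 0 i - center D j 0 i| <= 3 / 2 * s.
Proof.
move=> /half_open_boxP h.
apply: (@le_trans _ _ (\sum_(i < 3) s / 2)).
  by apply: ler_sum => i _; have := h i; rewrite ler_norml => /andP[h1 h2]; apply/andP; split; lra.
by rewrite sumr_const card_ord -mulr_natl; move: (s) => e; lra.
Qed.

(** The integrand is taken at [x] and the sum at a nearby point [a], because a curve through [x]
    will be replaced by one through [a]. At 8s from the center, moving by 3s or by 3s/2 changes
    distances by less than half, and the two distances differ by at most 3s + 3s/2 = 9s/2; hence 18
    = 4 * 9/2. *)
Lemma far_estimate x a j y : enorm (x - a) <= 3 * s -> 8 * s <= `|x - center D j| ->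
  half_open_box D j y ->
  `|A (to_vec y) / enorm (x - to_vec y) - w j / s ^+ 3 / enorm (a - center D j)| <= errE x j.
Proof.
rewrite /errE; set p := center D j; set t := `|x - p|; set z := to_vec y => hxa hj hy.
have hz := in_box_enorm hy; rewrite -/p -/z in hz.
have hzp : enorm (z - p) <= 3 / 2 * s.
  apply: le_trans (enorm_le_sum _) _.
  by rewrite (_ : \sum_(i < 3) _ = \sum_(i < 3) `|z 0 i - p 0 i|)//; apply: eq_bigr => i _; rewrite !mxE.
have t0 : 0 < t by apply: lt_le_trans hj; rewrite mulr_gt0.
have tp : t <= enorm (x - p) by exact: norm_le_enorm.
have h1 := enorm_triangle z x p.
have h2 := enorm_triangle a x p.
have h3 := enorm_triangle a x z.
have h4 := enorm_triangle p a z.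
have h5 := enorm_triangle x a p; rewrite (enormBC a x) in h5.
have h6 : enorm (p - z) = enorm (z - p) by exact: enormBC.
have -> : 18 * s * LA / t ^+ 2 + 2 * eA / t = 4 * (9 / 2 * s) * LA / t ^+ 2 + 2 * eA / t.
  by congr (_ + _); field; rewrite !gt_eqF.
apply: far_quotient => //.
- by move: (s) s0 hj hzp hxa => e; lra.
- by move: (s) s0 hj hzp hxa => e; lra.
- by rewrite ler_norml; move: (s) s0 hj hzp hxa => e; lra.
- by rewrite (density_ge0 hA) (density_le D0 hA).
rewrite -(subrKA (A p)); apply: le_trans (ler_normD _ _) _; apply: lerD.
  rewrite [leRHS]mulrC; apply: le_trans (density_lipschitz D0 hA _ _) _.
  by rewrite ler_wpM2l.
have h := hw j; rewrite -/p in h.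
have s3 : 0 < s ^+ 3 by rewrite exprn_gt0.
move: (s ^+ 3) s3 h => u u0 h.
have n4 : 0 < n%:R ^+ 4 :> R by rewrite exprn_gt0.
have -> : A p - w j / u = (A p * u - w j) / u by field; rewrite gt_eqF.
rewrite normrM normfV (gtr0_norm u0) ler_pdivrMr// distrC.
have -> : del / (n%:R ^+ 4 * u) * u = del / n%:R ^+ 4 by field; rewrite !gt_eqF.
by rewrite ler_pdivlMr// mulrC.
Qed.

(** The two lattice sums with constants 56 and 32 give the coefficients 18 * 56 = 1008, 2 * 3/2 * 32
    = 96 and 2 * 32 = 64. *)
Let sum_errE x : s ^+ 3 * \sum_(j | 8 * s <= `|x - center D j|) errE x j <= 1008 * M / n%:R.
Proof.
have e0 : 0 <= eA.
  apply: addr_ge0; first by rewrite mulr_ge0// mulr_ge0// ltW.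
  by rewrite divr_ge0// mulr_ge0// exprn_ge0// ltW.
have ext (F : box n -> R) : (forall j, 0 <= F j) ->
    \sum_(j | 8 * s <= `|x - center D j|) F j <= \sum_(j | s <= `|x - center D j|) F j.
  move=> F0; rewrite [leRHS](bigID (fun j => 8 * s <= `|x - center D j|)) /= -[leLHS]addr0.
  apply: lerD; last exact: sumr_ge0.
  rewrite le_eqVlt; apply/orP; left; apply/eqP; apply: eq_bigl => j.
  by apply/idP/andP => [h|[]//]; split => //; apply: le_trans h; move: (s) s0 => e; lra.
rewrite big_split /= -!big_distrr /=.
have h1 := lattice_sum_inv_sq D0 n0 x.
have h2 := lattice_sum_inv D0 n0 x.
set S1 := \sum_(i | _) _; set S2 := \sum_(i | _) _.
have k1 : S1 <= 56 * n%:R ^+ 3 / D ^+ 2.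
  by apply: le_trans h1; apply: ext => j; rewrite invr_ge0 exprn_ge0.
have k2 : S2 <= 32 * n%:R ^+ 3 / D by apply: le_trans h2; apply: ext => j; rewrite invr_ge0.
apply: (@le_trans _ _ (s ^+ 3 * (18 * s * LA * (56 * n%:R ^+ 3 / D ^+ 2) + 2 * eA * (32 * n%:R ^+ 3 / D)))).
  rewrite ler_wpM2l ?exprn_ge0 ?(ltW s0)//; apply: lerD; rewrite ler_wpM2l ?mulr_ge0 ?(ltW s0) ?(ltW D0)//.
have -> : s ^+ 3 * (18 * s * LA * (56 * n%:R ^+ 3 / D ^+ 2) + 2 * eA * (32 * n%:R ^+ 3 / D)) =
   (1008 * (LA * D ^+ 2) + 96 * (LdA * D ^+ 3) + 64 * (del / D)) / n%:R.
  by rewrite /eA; field; rewrite !gt_eqF.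
rewrite ler_pM2r ?invr_gt0// /size_const.
have q1 : 0 <= LA * D ^+ 2 by rewrite mulr_ge0 ?exprn_ge0 ?(ltW D0).
have q2 : 0 <= LdA * D ^+ 3 by rewrite mulr_ge0 ?exprn_ge0 ?(ltW D0).
have q3 : 0 <= del / D by rewrite divr_ge0 ?(ltW D0).
by move: q1 q2 q3; move: (LA * _) (LdA * _) (del / D) => a b c; lra.
Qed.

Definition newton x : \bar R :=
  (\int[leb3 R]_y (A (to_vec y) / enorm (x - to_vec y))%:E)%E.

Lemma measurable_newton_integrand x :
  measurable_fun [set: T3] (fun y => A (to_vec y) / enorm (x - to_vec y)).
Proof.
apply: (@measurable_to_vec _ (fun z => A z / enorm (x - z)) x) => z zx.
have -> : (fun z => A z / enorm (x - z)) = A \* (fun z => (enorm (z - x))^-1).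
  by apply/funext => t /=; rewrite enormBC.
by apply: (@continuousM R (vec3 R)); [exact: (density_continuous hA)|exact: inv_enorm_continuous].
Qed.

Let far x j := 8 * s <= `|x - center D j|.

(** The integrand is dominated by a step function on the far boxes, and by the singular kernel on a
    cube about [x] that contains the other boxes. Their centers are within 8s and their points
    within another s/2, so half side 9s suffices; it contributes 22 * 81 = 1782 times LA s^2. *)
Lemma newton_le x a : enorm (x - a) <= 3 * s ->
  (newton x <= (sample_sum a + 2790 * M / n%:R)%:E)%E.
Proof.
move=> hxa.
pose c j := if far x j then w j / s ^+ 3 / enorm (a - center D j) + errE x j else 0.
have q0 j : 0 <= w j / s ^+ 3 / enorm (a - center D j).
  by rewrite divr_ge0 ?enorm_ge0// divr_ge0// exprn_ge0// ltW.
have e0 : 0 <= eA.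
  apply: addr_ge0; first by rewrite mulr_ge0// mulr_ge0// ltW.
  by rewrite divr_ge0// mulr_ge0// exprn_ge0// ltW.
have er0 j : 0 <= errE x j.
  by apply: addr_ge0; rewrite divr_ge0 ?exprn_ge0// mulr_ge0// mulr_ge0// ltW.
have c0 j : 0 <= c j by rewrite /c; case: ifP => // _; exact: addr_ge0.
have s9 : 0 < 9 * s by rewrite mulr_gt0.
pose g y := (enorm (x - to_vec y))^-1 * \1_(cube x (9 * s)) y.
have mg : measurable_fun [set: T3] g.
  apply: measurable_funM; last by apply: measurable_indic; exact: measurable_cube.
  apply: (@measurable_to_vec _ (fun z => (enorm (x - z))^-1) x) => z zx.
  have -> : (fun z => (enorm (x - z))^-1) = (fun z => (enorm (z - x))^-1).
    by apply/funext => t; rewrite enormBC.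
  exact: inv_enorm_continuous.
have g0 y : 0 <= g y by rewrite mulr_ge0// invr_ge0 enorm_ge0.
apply: (@le_trans _ _ (\int[leb3 R]_y (LA%:E * (g y)%:E + (step D c y)%:E))%E).
  apply: ge0_le_integral => //.
  - by move=> y _; rewrite lee_fin divr_ge0 ?enorm_ge0 ?(density_ge0 hA).
  - by apply/measurable_EFinP; exact: measurable_newton_integrand.
  - apply/measurable_EFinP; apply: measurable_funD; last exact: measurable_step.
    by apply: measurable_funM => //; exact: measurable_cst.
  - move=> y _; rewrite -EFinM -EFinD lee_fin; set z := to_vec y.
    have [[j hj]|ny] := pselect (exists j, half_open_box D j y); last first.
      suff -> : A z = 0 by rewrite mul0r; apply: addr_ge0; [exact: mulr_ge0|exact: step_ge0].
      apply: contrapT => Az; apply: ny; apply: half_open_box_cover => // k.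
      rewrite ltNge; apply/negP => hk; apply: Az.
      exact: (density_edge hA hk).
    rewrite (step_in _ _ _ hj)// /c.
    case: ifP => hf.
      have := far_estimate hxa hf hj; rewrite -/z ler_norml => /andP[_].
      have : 0 <= LA * g y by rewrite mulr_ge0.
      lra.
    rewrite addr0 /g indicE mem_set ?mulr1; last first.
      apply/cubeP => //; rewrite -/z.
      have h1 : `|x - center D j| < 8 * s by rewrite ltNge; apply/negP; rewrite -/(far x j) hf.
      have h2 : `|z - center D j| <= s / 2.
        rewrite [leLHS]/Num.norm /= mx_normrE; apply/bigmax_leP; split.
          by rewrite divr_ge0// ltW.
        move=> -[i k] _ /=; rewrite ord1 !mxE.
        have /half_open_boxP /(_ k) := hj; rewrite -/z !mxE => /andP[h2 h3].
        by rewrite ler_norml; apply/andP; split; lra.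
      have -> : z - x = (z - center D j) - (x - center D j) by rewrite opprB addrA subrK.
      apply: le_lt_trans (ler_normB _ _) _.
      by move: (s) s0 h1 h2 => e; lra.
    by rewrite ler_wpM2r ?invr_ge0 ?enorm_ge0// (density_le D0 hA).
rewrite ge0_integralD//; last 4 first.
- by move=> y _; rewrite mule_ge0 ?lee_fin.
- by apply/measurable_EFinP; apply: measurable_funM => //; exact: measurable_cst.
- by move=> y _; rewrite lee_fin; exact: step_ge0.
- by apply/measurable_EFinP; exact: measurable_step.
rewrite ge0_integralZl_EFin//; last first.
- by apply/measurable_EFinP.
- by move=> y _; rewrite lee_fin.
rewrite integral_step//.
apply: (@le_trans _ _ (LA%:E * (22 * (9 * s) ^+ 2)%:E + (s ^+ 3 * \sum_j c j)%:E)%E).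
  by rewrite leeD2r// lee_wpmul2l ?lee_fin//; exact: integral_inv_cube.
rewrite -EFinM -EFinD lee_fin.
have -> : \sum_j c j = \sum_(j | far x j) w j / s ^+ 3 / enorm (a - center D j) + \sum_(j | far x j) errE x j.
  by rewrite -big_split /= [RHS]big_mkcond.
rewrite mulrDr addrCA; apply: lerD.
  rewrite big_distrr /= /sample_sum [leRHS](bigID (far x)) /= -[leLHS]addr0; apply: lerD.
    rewrite le_eqVlt; apply/orP; left; apply/eqP; apply: eq_bigr => j _.
    by rewrite mulrA mulrCA mulfV ?mulr1// expf_neq0// gt_eqF.
  by apply: sumr_ge0 => j _; rewrite divr_ge0 ?enorm_ge0.
have h1 := sum_errE x.
have h2 : LA * (22 * (9 * s) ^+ 2) <= 1782 * M / n%:R.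
  have -> : LA * (22 * (9 * s) ^+ 2) = 1782 * (LA * D ^+ 2) / n%:R / n%:R by field; rewrite gt_eqF.
  rewrite ler_pM2r ?invr_gt0// ler_pdivrMr//.
  have q1 : 0 <= LA * D ^+ 2 by rewrite mulr_ge0 ?exprn_ge0 ?(ltW D0).
  have q2 : 0 <= LdA * D ^+ 3 by rewrite mulr_ge0 ?exprn_ge0 ?(ltW D0).
  have q3 : 0 <= del / D by rewrite divr_ge0 ?(ltW D0).
  have q4 : LA * D ^+ 2 <= M by rewrite /size_const; lra.
  have q5 : 0 <= M by lra.
  have q6 : M <= M * n%:R by rewrite ler_peMr.
  lra.
have -> : 2790 * M / n%:R = 1782 * M / n%:R + 1008 * M / n%:R by ring.
exact: lerD.
Qed.

Lemma newton_ge0 x : (0 <= newton x)%E.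
Proof. by apply: integral_ge0 => y _; rewrite lee_fin divr_ge0 ?enorm_ge0 ?(density_ge0 hA). Qed.

Lemma newton_fin x : newton x \is a fin_num.
Proof.
rewrite ge0_fin_numE ?newton_ge0//; apply: le_lt_trans (ltry _).
by apply: (@newton_le x x); rewrite subrr enorm0 mulr_ge0// ltW.
Qed.

Lemma potentialE x : potential A x = 1 + fine (newton x). Proof. by []. Qed.

Lemma potential_ge1 x : 1 <= potential A x.
Proof. by rewrite potentialE lerDl fine_ge0 ?newton_ge0. Qed.

Lemma potential_le x a : enorm (x - a) <= 3 * s ->
  potential A x <= 1 + sample_sum a + lattice_const * (M / n%:R).
Proof.
move=> /newton_le; rewrite -(fineK (newton_fin x)) lee_fin potentialE -(mulrA 2790).
have : 0 <= M / n%:R by rewrite divr_ge0 ?(ltW nR)//; apply: le_trans size_const_ge1.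
have := @lattice_const_ge R; move: lattice_const (M / n%:R) => k e; nra.
Qed.

(** This is where the scale D/n^2 comes from: a weight of order D/n^3 seen from distance D/(2n^2)
    contributes at most 2M/n, so boundedly many of them are negligible. *)
Lemma clear_sum_le a : (forall j, w j != 0 -> D / (2 * n%:R ^+ 2) <= enorm (a - center D j)) ->
  forall (P : pred (box n)) (m : nat), (#|P| <= m)%N ->
  \sum_(j | P j) w j / enorm (a - center D j) <= 2 * m%:R * M / n%:R.
Proof.
move=> cl P m hm.
have M0 : 0 <= M by apply: le_trans size_const_ge1.
apply: (@le_trans _ _ (\sum_(j | P j) 2 * M / n%:R)).
  apply: ler_sum => j _; have [->|wj] := eqVneq (w j) 0.
    by rewrite mul0r divr_ge0 ?mulr_ge0 ?(ltW nR).
  have h := cl j wj; have r0 : 0 < D / (2 * n%:R ^+ 2) by rewrite divr_gt0 ?mulr_gt0 ?exprn_gt0.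
  rewrite ler_pdivrMr; last exact: lt_le_trans h.
  apply: le_trans (weight_le j) _.
  have -> : D * M / n%:R ^+ 3 = 2 * M / n%:R * (D / (2 * n%:R ^+ 2)) by field; rewrite gt_eqF.
  by rewrite ler_wpM2l// divr_ge0 ?mulr_ge0 ?(ltW nR).
rewrite sumr_const -[X in X <= _]mulr_natl.
have -> : 2 * m%:R * M / n%:R = m%:R * (2 * M / n%:R) by ring.
by rewrite ler_wpM2r ?ler_nat// divr_ge0 ?mulr_ge0 ?(ltW nR).
Qed.

(** The far boxes cost 1008 M/n as before. At most 16^3 boxes are near, and each contributes at most
    2M/n to the sum: 2 * 4096 + 1008 = 9200. *)
Lemma sample_sum_le x a : enorm (x - a) <= 3 * s ->
  (forall j, w j != 0 -> D / (2 * n%:R ^+ 2) <= enorm (a - center D j)) ->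
  1 + sample_sum a <= potential A x + lattice_const * (M / n%:R).
Proof.
move=> hxa cl; apply: (@le_trans _ _ (potential A x + 9200 * (M / n%:R))); last first.
  rewrite lerD2l; have : 0 <= M / n%:R by rewrite divr_ge0 ?(ltW nR)//; apply: le_trans size_const_ge1.
  by have := @lattice_const_ge R; move: lattice_const (M / n%:R) => k e; nra.
have M0 : 0 <= M by apply: le_trans size_const_ge1.
pose c j := if far x j then w j / s ^+ 3 / enorm (a - center D j) else 0.
pose d j := if far x j then errE x j else 0.
have q0 j : 0 <= w j / s ^+ 3 / enorm (a - center D j).
  by rewrite divr_ge0 ?enorm_ge0// divr_ge0// exprn_ge0// ltW.
have e0 : 0 <= eA.
  apply: addr_ge0; first by rewrite mulr_ge0// mulr_ge0// ltW.
  by rewrite divr_ge0// mulr_ge0// exprn_ge0// ltW.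
have er0 j : 0 <= errE x j.
  by apply: addr_ge0; rewrite divr_ge0 ?exprn_ge0// mulr_ge0// mulr_ge0// ltW.
have c0 j : 0 <= c j by rewrite /c; case: ifP.
have d0 j : 0 <= d j by rewrite /d; case: ifP.
have f0 y : 0 <= A (to_vec y) / enorm (x - to_vec y) by rewrite divr_ge0 ?enorm_ge0 ?(density_ge0 hA).
have : (\int[leb3 R]_y (step D c y)%:E <= newton x + (s ^+ 3 * \sum_j d j)%:E)%E.
  rewrite -integral_step// -ge0_integralD//; last 4 first.
  - by move=> y _; rewrite lee_fin.
  - by apply/measurable_EFinP; exact: measurable_newton_integrand.
  - by move=> y _; rewrite lee_fin; exact: step_ge0.
  - by apply/measurable_EFinP; exact: measurable_step.
  apply: ge0_le_integral => //.
  - by move=> y _; rewrite lee_fin; exact: step_ge0.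
  - by apply/measurable_EFinP; exact: measurable_step.
  - apply/measurable_EFinP; apply: measurable_funD; last exact: measurable_step.
    exact: measurable_newton_integrand.
  - move=> y _; rewrite -EFinD lee_fin.
    have [[j hj]|ny] := pselect (exists j, half_open_box D j y); last first.
      by rewrite step_out//; apply: addr_ge0 => //; exact: step_ge0.
    rewrite !(step_in _ _ _ hj)// /c /d; case: ifP => hf; last by rewrite addr0.
    have := far_estimate hxa hf hj; rewrite ler_norml => /andP[+ _]; lra.
rewrite integral_step// -(fineK (newton_fin x)) -EFinD lee_fin potentialE.
have h1 := sum_errE x; rewrite big_mkcond /= -/d in h1.
have -> : s ^+ 3 * \sum_j c j = \sum_(j | far x j) w j / enorm (a - center D j).
  rewrite [in LHS]/c -big_mkcond /= big_distrr /=; apply: eq_bigr => j _.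
  by rewrite mulrA mulrCA mulfV ?mulr1// expf_neq0// gt_eqF.
have cnt : (#|[pred j | ~~ far x j]| <= 4096)%N.
  apply: leq_trans (lattice_count D0 n0 x 8).
  by apply: subset_leq_card; apply/fintype.subsetP => j; rewrite !inE /far -ltNge.
have := clear_sum_le cl cnt.
have -> : sample_sum a = \sum_(j | far x j) w j / enorm (a - center D j) +
    \sum_(j | ~~ far x j) w j / enorm (a - center D j) by rewrite /sample_sum (bigID (far x)).
rewrite /=.
have : 0 <= M / n%:R by rewrite divr_ge0 ?(ltW nR).
rewrite -(mulrA (2 * 4096)).
move: h1; rewrite -(mulrA 1008).
by rewrite /d; move: (M / n%:R) => e; lra.
Qed.

(** At most 8 boxes are within s and contribute 16 M; the lattice sum bounds the others by 32 M;
    with the constant 1 this makes 49 M. *)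
Lemma clear_sum_bound a :
  (forall j, w j != 0 -> D / (2 * n%:R ^+ 2) <= enorm (a - center D j)) ->
  1 + sample_sum a <= lattice_const * M.
Proof.
move=> cl; apply: (@le_trans _ _ (49 * M)); last first.
  have := size_const_ge1; have := @lattice_const_ge R; move: lattice_const M => k e; nra.
have M1 := size_const_ge1.
have M0 : 0 <= M by lra.
have cnt : (#|[pred j : box n | ~~ (s <= `|a - center D j|)%R]| <= 8)%N.
  apply: (@leq_trans #|near_boxes D n a (1%:R * s)|); last exact: (lattice_count D0 n0 a 1).
  by apply: subset_leq_card; apply/fintype.subsetP => j; rewrite !inE mul1r -ltNge.
have h1 := clear_sum_le cl cnt.
have h2 : \sum_(j | s <= `|a - center D j|) w j / enorm (a - center D j) <= 32 * M.
  apply: (@le_trans _ _ (\sum_(j | s <= `|a - center D j|) D * M / n%:R ^+ 3 * `|a - center D j|^-1)).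
    apply: ler_sum => j hj; apply: ler_pM => //; rewrite ?invr_ge0 ?enorm_ge0 ?weight_le//.
    have t0 : 0 < `|a - center D j| by exact: lt_le_trans hj.
    by rewrite lef_pV2 ?posrE ?norm_le_enorm//; apply: lt_le_trans (norm_le_enorm _).
  rewrite -big_distrr /=.
  have -> : 32 * M = D * M / n%:R ^+ 3 * (32 * n%:R ^+ 3 / D) by field; rewrite !gt_eqF.
  by rewrite ler_wpM2l ?lattice_sum_inv// divr_ge0 ?mulr_ge0 ?exprn_ge0 ?(ltW D0) ?(ltW nR).
rewrite /sample_sum (bigID (fun j => s <= `|a - center D j|)) /=.
have h3 : 2 * 8 * M / n%:R <= 16 * M.
  by rewrite ler_pdivrMr// -natrM; have : M <= M * n%:R by [rewrite ler_peMr]; lra.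
move: h1; rewrite -[X in _ <= X]/(2 * 8 * M / n%:R) => h1.
have := le_trans h1 h3; rewrite /=; lra.
Qed.

End SamplePotential.

Lemma small_quotient (R : realType) (c e : R) : 0 < e ->
  exists2 n : nat, (8 <= n)%N & c / n%:R < e.
Proof.
move=> e0; set b := Num.bound `|c / e|.
have hb : `|c / e| < b%:R by exact: archi_boundP.
exists (8 + b)%N; first exact: leq_addr.
rewrite ltr_pdivrMr; last by rewrite ltr0n.
rewrite mulrC -ltr_pdivrMr//; apply: le_lt_trans (ler_norm _) _.
by apply: lt_le_trans hb _; rewrite ler_nat leq_addl.
Qed.

(** * Position of the centers *)

Section Centers.
Context {R : realType}.
Variables (D : R) (n : nat).
Hypotheses (D0 : 0 < D) (n0 : (0 < n)%N).
Local Notation s := (D / n%:R).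
Implicit Types (j k : box n).

Let nR : 0 < n%:R :> R. Proof. by rewrite ltr0n. Qed.
Let s0 : 0 < s. Proof. by rewrite divr_gt0. Qed.

Lemma center_dist j k : j != k -> s <= enorm (center D j - center D k).
Proof.
move=> jk; have [i ji] : exists i, j i != k i.
  by apply/existsP; apply: contraNT jk => /existsPn h; apply/eqP/ffunP => i; apply/eqP; rewrite -[_ == _]negbK h.
apply: le_trans (coord_le_enorm _ i); rewrite !mxE.
rewrite (_ : _ - _ = ((j i)%:R - (k i)%:R) * s); last by ring.
rewrite normrM (gtr0_norm s0) ler_peMl ?(ltW s0)//.
have : (j i)%:R - (k i)%:R = ((j i)%:Z - (k i)%:Z)%:~R :> R by rewrite rmorphB /= -!pmulrn.
move=> ->; rewrite -intr_norm (ler_int R 1) -gtz0_ge1 normr_gt0 subr_eq0.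
by apply: contraNneq ji => -[] /val_inj ->.
Qed.

Lemma enorm_center j : enorm (center D j) <= Num.sqrt 3 * (D - s / 2).
Proof.
have b i : `|center D j 0 i| <= D - s / 2.
  rewrite !mxE ler_norml; have hi : (j i)%:R + 1 <= 2 * n%:R :> R.
    by rewrite natr1 -natrM ler_nat.
  have hi2 : ((j i)%:R + 1) * s <= 2 * D.
    rewrite (_ : 2 * D = 2 * n%:R * s); last by field; rewrite gt_eqF.
    by rewrite ler_pM2r.
  have hi3 : 0 <= (j i)%:R * s by rewrite mulr_ge0// ltW.
  by move: (s) s0 hi2 hi3 => e e0 h1 h2; apply/andP; split; lra.
have d0 : 0 <= D - s / 2 by apply: le_trans (b 0).
rewrite -[X in _ * X](ger0_norm d0) -sqrtr_sqr -sqrtrM// ler_wsqrtr//.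
rewrite !big_ord_recl big_ord0 addr0.
have q i : center D j 0 i ^+ 2 <= (D - s / 2) ^+ 2.
  by rewrite -real_normK ?num_real// ler_pXn2r ?nnegrE.
have := q ord0; have := q (lift ord0 ord0); have := q (lift ord0 (lift ord0 ord0)); lra.
Qed.

(** A point closer than r to some center is replaced by a point of the sphere of radius r about it,
    from which the other centers are at least s - r away. It remains in the ball because the centers
    keep distance s/2 from the faces of the cube. *)
Lemma good_point (r : R) x : 0 <= r <= s / 8 -> exists a : vec3 R,
  [/\ enorm (x - a) <= 2 * r, forall j, r <= enorm (a - center D j) &
      forall rho, Num.sqrt 3 * D < rho -> enorm x < rho -> enorm a < rho].
Proof.
move=> /andP[r0 rs].
have [h|/existsNP[j /negP]] := pselect (forall j, r <= enorm (x - center D j)).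
  by exists x; rewrite subrr enorm0; split => //; rewrite mulr_ge0.
rewrite -ltNge => hj; pose a := center D j + r *: delta_mx 0 0.
have aj : enorm (a - center D j) = r.
  by rewrite /a addrC addKr enormZ enorm_delta mulr1 ger0_norm.
exists a; split.
- have := enorm_triangle (center D j) x a; rewrite (enormBC (center D j)) aj; lra.
- move=> k; have [<-|jk] := eqVneq j k; first by rewrite aj.
  have := center_dist jk; have := enorm_triangle a (center D j) (center D k).
  by rewrite (enormBC (center D j) a) aj; move: (s) s0 rs => e e0; lra.
- move=> rho hrho _; apply: le_lt_trans hrho.
  have := enorm_triangle (center D j) a 0; rewrite !subr0 aj.
  have := enorm_center j; have : 1 <= Num.sqrt 3 :> R by rewrite -[leLHS]sqrtr1 ler_wsqrtr// ler1n.
  by move: (Num.sqrt 3) (s) s0 rs => q e e0; nra.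
Qed.

End Centers.

(** * Boundedness and continuity of the Newtonian potential *)

Section PotentialContinuous.
Context {R : realType}.
Variables (D : R) (A : vec3 R -> R).
Hypothesis D0 : 0 < D.
Hypothesis hA : admissible_density D A.
Local Notation M := (size_const D A 0).

(** The comparison with sums is applied to the exact Riemann sums of [A], whose defect is 0. Two
    nearby points are compared with the sum at one common point, so that their potentials differ by
    O(1/n) for every n >= 8; this gives continuity, and n = 8 gives an explicit bound. *)
Let exact_sample n (j : box n) : R := A (center D j) * (D / n%:R) ^+ 3.

Let exact_ge0 n (j : box n) : 0 <= exact_sample j.
Proof. by rewrite mulr_ge0 ?(density_ge0 hA)// exprn_ge0// divr_ge0// ltW. Qed.

Let exact_defect n (j : box n) :
  n%:R ^+ 4 * `|exact_sample j - A (center D j) * (D / n%:R) ^+ 3| <= 0.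
Proof. by rewrite subrr normr0 mulr0. Qed.

Let clear_point n x : (8 <= n)%N -> exists a : vec3 R, enorm (x - a) <= 2 * (D / n%:R) /\
  forall j : box n, D / (2 * n%:R ^+ 2) <= enorm (a - center D j).
Proof.
move=> n8; have n0 : (0 < n)%N by exact: leq_trans n8.
have nR : 8 <= n%:R :> R by rewrite ler_nat.
have nR0 : 0 < n%:R :> R by rewrite ltr0n.
have e1 : D / (2 * n%:R ^+ 2) = D / n%:R / (2 * n%:R) by field; rewrite gt_eqF.
have e2 : D / n%:R / (2 * n%:R) <= D / n%:R / 8.
  by rewrite ler_pM2l ?divr_gt0// lef_pV2 ?posrE ?mulr_gt0//; lra.
have rb : 0 <= D / (2 * n%:R ^+ 2) <= D / n%:R / 8.
  by rewrite e1 e2 divr_ge0 ?divr_ge0 ?mulr_ge0 ?(ltW D0).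
have [a [h1 h2 _]] := @good_point R D n D0 n0 (D / (2 * n%:R ^+ 2)) x rb.
exists a; split => //; apply: le_trans h1 _; rewrite e1.
by have : 0 < D / n%:R by [rewrite divr_gt0]; move: e2; move: (D / n%:R) => e; lra.
Qed.

Let potential_close n x y a : (0 < n)%N -> enorm (x - a) <= 3 * (D / n%:R) -> enorm (y - a) <= 3 * (D / n%:R) ->
  (forall j : box n, D / (2 * n%:R ^+ 2) <= enorm (a - center D j)) ->
  potential A x <= potential A y + 2 * lattice_const * (M / n%:R).
Proof.
move=> n0 xa ya cl.
have := @potential_le R D n D0 n0 A hA _ 0 (@exact_ge0 n) (lexx _) (@exact_defect n) _ _ xa.
have := @sample_sum_le R D n D0 n0 A hA _ 0 (@exact_ge0 n) (lexx _) (@exact_defect n) _ _ ya (fun j _ => cl j).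
by move: lattice_const (M / n%:R) => k e; lra.
Qed.

Lemma potential_bound x : potential A x <= 2 * lattice_const * M.
Proof.
have [a [xa cl]] := @clear_point 8 x isT.
have xa3 : enorm (x - a) <= 3 * (D / 8%:R) by move: xa; have := D0; lra.
have := @potential_le R D 8 D0 isT A hA _ 0 (@exact_ge0 8) (lexx _) (@exact_defect 8) _ _ xa3.
have := @clear_sum_bound R D 8 D0 isT A hA _ 0 (@exact_ge0 8) (lexx _) (@exact_defect 8) _ (fun j _ => cl j).
have := @size_const_ge1 R D D0 A hA 0 (lexx _).
have := @lattice_const_ge R; move: lattice_const (sample_sum _ _ _) M => k S m; nra.
Qed.

Lemma potential_continuous : continuous (potential A).
Proof.
move=> x; apply/(@cvgrPdist_lt R R _ (nbhs x)) => e e0.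
have M1 := @size_const_ge1 R D D0 A hA 0 (lexx _).
have [n n8] := small_quotient (2 * lattice_const * M) e0; rewrite -mulrA => small.
have n0 : (0 < n)%N by exact: leq_trans n8.
have [a [xa cl]] := @clear_point n x n8.
have s0 : 0 < D / n%:R by rewrite divr_gt0// ltr0n.
apply: filterS (eball_nbhs x s0) => y; rewrite /eball /= => yx.
have xa3 : enorm (x - a) <= 3 * (D / n%:R) by move: xa; lra.
have ya3 : enorm (y - a) <= 3 * (D / n%:R) by have := enorm_triangle x y a; move: xa; lra.
have := potential_close n0 xa3 ya3 cl; have := potential_close n0 ya3 xa3 cl.
by rewrite ltr_norml; move: small; move: (2 * _ * (M / n%:R)) => b; lra.
Qed.

End PotentialContinuous.

(** * Derivatives of the potential sums *)

Section InvEnormDerive.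
Context {R : realType}.
Implicit Types (f : vec3 R -> R) (x q v z : vec3 R).

Lemma is_derive_of_line f x v d :
  is_derive 0 (1 : R) (fun t : R => f (x + t *: v)) d -> is_derive x v f d.
Proof.
have e : (fun t : R => t^-1 *: ((f \o shift x) (t *: v) - f x)) =
  (fun t : R => t^-1 *: (((fun t : R => f (x + t *: v)) \o shift 0) (t *: (1 : R)) -
    f (x + 0 *: v))).
  apply/funext => t /=.
  have -> : t *: (1 : R) = t by exact: mulr1.
  by rewrite !addr0 scale0r addr0 [_ + x]addrC.
by move=> [h1 h2]; split; [rewrite /derivable e|rewrite /derive e].
Qed.

Lemma enorm_line_sqr z (i : 'I_3) (t : R) :
  enorm (z + t *: delta_mx 0 i) ^+ 2 = enorm z ^+ 2 + 2 * z 0 i * t + t * t.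
Proof.
have h1 : dot z (delta_mx 0 i) = z 0 i.
  rewrite /dot (bigD1 i)//= mxE !eqxx mulr1 big1 ?addr0// => k ki.
  by rewrite mxE (negbTE ki) andbF mulr0.
rewrite -!dot_enorm !dotE (dotC (delta_mx 0 i) z) h1 (dot_enorm (delta_mx 0 i)) enorm_delta.
by ring.
Qed.

Lemma is_derive_inv_enorm q x (i : 'I_3) : x != q ->
  is_derive x (delta_mx 0 i) (fun y => (enorm (y - q))^-1)
    (- (x - q) 0 i / enorm (x - q) ^+ 3).
Proof.
move=> xq; apply: is_derive_of_line; set z := x - q.
have z0 : 0 < enorm z by rewrite enorm_gt0 subr_eq0.
pose Q (t : R) := enorm z ^+ 2 + 2 * z 0 i * t + t * t.
have e t : enorm (x + t *: delta_mx 0 i - q) = Num.sqrt (Q t).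
  rewrite -[LHS]ger0_norm ?enorm_ge0// -sqrtr_sqr; congr Num.sqrt.
  by rewrite addrAC enorm_line_sqr.
have -> : (fun t : R => (enorm (x + t *: delta_mx 0 i - q))^-1) = (fun t => (Num.sqrt (Q t))^-1).
  by apply/funext => t; rewrite e.
have Q0 : Q 0 = enorm z ^+ 2 by rewrite /Q !mulr0 !addr0.
have sQ0 : Num.sqrt (Q 0) = enorm z by rewrite Q0 sqrtr_sqr ger0_norm ?enorm_ge0.
have dQ : is_derive (0 : R) (1 : R) Q (2 * z 0 i).
  rewrite /Q; apply: is_derive_eq.
  by rewrite /GRing.scale /=; ring.
have dS : is_derive (Q 0) (1 : R) Num.sqrt (2 * enorm z)^-1.
  by rewrite -sQ0; apply: is_derive1_sqrt; rewrite Q0 exprn_gt0.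
have dC := @is_derive1_comp R Num.sqrt Q 0 _ _ dS dQ.
have nz : (Num.sqrt \o Q) 0 != 0 by rewrite /= sQ0 gt_eqF.
have := is_deriveV nz dC.
rewrite /= sQ0 => h; apply: is_derive_eq h _.
by rewrite /GRing.scale /=; field; rewrite gt_eqF.
Qed.

End InvEnormDerive.

Lemma is_derive_finsum (R : realType) (I : Type) (s : seq I) (h : I -> vec3 R -> R) dh x v :
  (forall i, is_derive x v (h i) (dh i)) ->
  is_derive x v (fun y => \sum_(i <- s) h i y) (\sum_(i <- s) dh i).
Proof.
move=> hd; elim: s => [|i s IH].
  rewrite big_nil; have -> : (fun y => \sum_(i <- [::]) h i y) = cst 0.
    by apply/funext => y; rewrite big_nil.
  exact: is_derive_cst.
rewrite big_cons; have -> : (fun y => \sum_(j <- i :: s) h j y) = h i + (fun y => \sum_(j <- s) h j y).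
  by apply/funext => y; rewrite big_cons.
exact: (is_deriveD (hd i) IH).
Qed.

Lemma continuous_finsum (R : realType) (I : Type) (s : seq I) (h : I -> vec3 R -> R) x :
  (forall i, {for x, continuous (h i)}) ->
  {for x, continuous (fun y => \sum_(i <- s) h i y)}.
Proof.
move=> hd; elim: s => [|i s IH].
  have -> : (fun y => \sum_(i <- [::]) h i y) = cst 0.
    by apply/funext => y; rewrite big_nil.
  exact: cst_continuous.
have -> : (fun y => \sum_(j <- i :: s) h j y) = h i \+ (fun y => \sum_(j <- s) h j y).
  by apply/funext => y; rewrite big_cons.
exact: (continuousD (hd i) IH).
Qed.

Section PotentialSum.
Context {R : realType}.
Variables (D : R) (w : forall n, box n -> R) (n : nat).
Implicit Types (x v : vec3 R).

Lemma is_derive_potential_sum x (k : 'I_3) : (forall j : box n, x != center D j) ->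
  is_derive x (delta_mx 0 k) (potential_sum D w n)
    (\sum_(j : box n) w j * (- (x - center D j) 0 k / enorm (x - center D j) ^+ 3)).
Proof.
move=> hx.
pose h (j : box n) : vec3 R -> R := fun y => w j * (enorm (y - center D j))^-1.
have hd (j : box n) : is_derive x (delta_mx 0 k) (h j) (w j * (- (x - center D j) 0 k / enorm (x - center D j) ^+ 3)).
  exact: (@is_deriveZ _ _ _ (fun y : vec3 R => (enorm (y - center D j))^-1) (w j) _ _ _ (is_derive_inv_enorm k (hx j))).
have hs := is_derive_finsum (index_enum _) hd.
have hc : is_derive x (delta_mx 0 k) (cst (1 : R) : vec3 R -> R) 0 by exact: is_derive_cst.
by have := is_deriveD hc hs; rewrite add0r.
Qed.

Lemma potential_sum_continuous x : (forall j : box n, w j != 0 -> x != center D j) ->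
  {for x, continuous (potential_sum D w n)}.
Proof.
move=> hx.
pose h (j : box n) : vec3 R -> R := fun y => w j * (enorm (y - center D j))^-1.
have hd (j : box n) : {for x, continuous (h j)}.
  have [e|wj] := eqVneq (w j) 0.
    have -> : h j = cst 0 by apply/funext => y; rewrite /h e mul0r.
    exact: cst_continuous.
  exact: (continuousM (@cst_continuous _ _ (w j) x) (inv_enorm_continuous (hx j wj))).
have hs := @continuous_finsum R _ (index_enum _) h x hd.
exact: (continuousD (@cst_continuous _ _ (1 : R) x) hs).
Qed.

End PotentialSum.

(** * The potential sums near a pole *)

Section NearPole.
Context {R : realType}.
Variables (D : R) (n : nat) (w : forall n, box n -> R) (m : R).
Hypotheses (D0 : 0 < D) (n0 : (0 < n)%N) (m1 : 1 <= m).
Hypothesis hw : forall j : box n, 0 <= w j <= D * m / n%:R ^+ 3.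
Local Notation s := (D / n%:R).
Variables (i : box n) (x : vec3 R).
Hypothesis hx : 0 < enorm (x - center D i) <= s / 2.
Implicit Types (j : box n).

Let nR : 0 < n%:R :> R. Proof. by rewrite ltr0n. Qed.
Let s0 : 0 < s. Proof. by rewrite divr_gt0. Qed.
Local Notation p := (center D i).

Let sup_dist j : j != i -> s <= `|p - center D j|.
Proof.
move=> ji; have [k jk] : exists k, j k != i k.
  by apply/existsP; apply: contraNT ji => /existsPn h; apply/eqP/ffunP => k; apply/eqP; rewrite -[_ == _]negbK h.
apply: le_trans (coord_le_norm _ k); rewrite !mxE.
rewrite (_ : _ - _ = ((i k)%:R - (j k)%:R) * s); last by ring.
rewrite normrM (gtr0_norm s0) ler_peMl ?(ltW s0)//.
have : (i k)%:R - (j k)%:R = ((i k)%:Z - (j k)%:Z)%:~R :> R by rewrite rmorphB /= -!pmulrn.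
move=> ->; rewrite -intr_norm (ler_int R 1) -gtz0_ge1 normr_gt0 subr_eq0.
by apply: contraNneq jk => -[] /val_inj ->.
Qed.

(** It lets the lattice sums about the center p control sums about [x], with a factor 2 for each
    power of the distance. *)
Let dist_ge j : j != i -> `|p - center D j| / 2 <= enorm (x - center D j).
Proof.
move=> ji; have h1 := sup_dist ji; have h2 := norm_le_enorm (p - center D j).
have h3 := enorm_triangle x p (center D j); rewrite (enormBC p x) in h3.
by have /andP[_ h4] := hx; move: (s) s0 h1 h4 => e e0; lra.
Qed.

Lemma near_pole_neq j : x != center D j.
Proof.
have [->|ji] := eqVneq j i; first by rewrite -subr_eq0 -enorm_eq0 gt_eqF//; case/andP: hx.
rewrite -subr_eq0 -enorm_eq0 gt_eqF//; apply: lt_le_trans (dist_ge ji).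
by rewrite divr_gt0// (lt_le_trans s0) ?sup_dist.
Qed.

Definition pole_rest : R := 1 + \sum_(j | j != i) w j / enorm (x - center D j).

Lemma pole_restE : potential_sum D w n x = w i / enorm (x - p) + pole_rest.
Proof. by rewrite /potential_sum (bigD1 i)//= /pole_rest; ring. Qed.

Lemma pole_rest_ge1 : 1 <= pole_rest.
Proof.
rewrite lerDl; apply: sumr_ge0 => j _; rewrite divr_ge0 ?enorm_ge0//.
by case/andP: (hw j).
Qed.

(** The constant is 1 + 2 * 32, with 32 from the lattice sum and 2 from the change of base point. *)
Lemma pole_rest_le : pole_rest <= 65 * m.
Proof.
have c0 : 0 <= D * m / n%:R ^+ 3 by case/andP: (hw i) => h1 h2; exact: le_trans h2.
have : \sum_(j | j != i) w j / enorm (x - center D j) <= 64 * m; last by move: m1; rewrite /pole_rest; move: (\sum_(_ | _) _) => S; lra.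
apply: (@le_trans _ _ (\sum_(j | s <= `|p - center D j|) D * m / n%:R ^+ 3 * 2 * `|p - center D j|^-1)); last first.
  rewrite -big_distrr /=.
  have -> : 64 * m = D * m / n%:R ^+ 3 * 2 * (32 * n%:R ^+ 3 / D) by field; rewrite !gt_eqF.
  by apply: ler_wpM2l; [rewrite mulr_ge0 | exact: lattice_sum_inv].
rewrite [leRHS](bigID (fun j => j != i)) /= -[leLHS]addr0; apply: lerD; last first.
  by apply: sumr_ge0 => j _; apply: divr_ge0; rewrite // mulr_ge0.
apply: (@le_trans _ _ (\sum_(j | j != i) D * m / n%:R ^+ 3 * 2 * `|p - center D j|^-1)); last first.
  rewrite le_eqVlt; apply/orP; left; apply/eqP; apply: eq_bigl => j.
  by apply/idP/andP => [h|[]//]; split => //; exact: sup_dist.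
apply: ler_sum => j ji; have t0 := lt_le_trans s0 (sup_dist ji); have h := dist_ge ji.
have /andP[w0 wle] := hw j.
rewrite -mulrA; apply: ler_pM; rewrite ?invr_ge0 ?enorm_ge0//.
rewrite -[X in X / _]invrK -invfM lef_pV2 ?posrE ?mulr_gt0//; first by rewrite mulrC.
by apply: lt_le_trans h; rewrite divr_gt0.
Qed.

(** The derivative of the sum without the pole p, at [x] in the direction x - p. *)
Definition pole_rest_radial : R :=
  \sum_(j | j != i) - w j * dot (x - center D j) (x - p) / enorm (x - center D j) ^+ 3.

(** The constant is 2^2 * 56, with 56 from the lattice sum of inverse squares. *)
Lemma pole_rest_radial_le : `|pole_rest_radial| <= 224 * m / D * enorm (x - p).
Proof.
have c0 : 0 <= D * m / n%:R ^+ 3 by case/andP: (hw i) => h1 h2; exact: le_trans h2.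
apply: le_trans (ler_norm_sum _ _ _) _.
apply: (@le_trans _ _ (\sum_(j | s <= `|p - center D j|) D * m / n%:R ^+ 3 * 4 * enorm (x - p) * (`|p - center D j| ^+ 2)^-1)); last first.
  rewrite -big_distrr /=.
  have -> : 224 * m / D * enorm (x - p) = D * m / n%:R ^+ 3 * 4 * enorm (x - p) * (56 * n%:R ^+ 3 / D ^+ 2).
    by field; rewrite !gt_eqF.
  apply: ler_wpM2l; last exact: lattice_sum_inv_sq.
  by rewrite mulr_ge0 ?enorm_ge0// mulr_ge0.
rewrite [leRHS](bigID (fun j => j != i)) /= -[leLHS]addr0; apply: lerD; last first.
  by apply: sumr_ge0 => j _; apply: divr_ge0; rewrite ?exprn_ge0// mulr_ge0 ?enorm_ge0// mulr_ge0.
apply: (@le_trans _ _ (\sum_(j | j != i) D * m / n%:R ^+ 3 * 4 * enorm (x - p) * (`|p - center D j| ^+ 2)^-1)); last first.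
  rewrite le_eqVlt; apply/orP; left; apply/eqP; apply: eq_bigl => j.
  by apply/idP/andP => [h|[]//]; split => //; exact: sup_dist.
apply: ler_sum => j ji; have t0 := lt_le_trans s0 (sup_dist ji); have h := dist_ge ji.
have e0 : 0 < enorm (x - center D j) by apply: lt_le_trans h; rewrite divr_gt0.
have /andP[w0 wle] := hw j.
have CS : `|dot (x - center D j) (x - p)| <= enorm (x - center D j) * enorm (x - p).
  move: (x - center D j) (x - p) => a b; have h1 := CauchySchwarz a b.
  have h2 := CauchySchwarz (- a) b; rewrite dotNl enormN in h2.
  by rewrite ler_norml h1 lerNl h2.
move: (dot _ _) CS h e0 t0; move: (enorm (x - center D j)) (`|p - center D j|) => E T d CS h E0 T0.
rewrite mulNr normrM normrN normfV normrM (ger0_norm w0) (gtr0_norm (exprn_gt0 3 E0)).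
rewrite ler_pdivrMr ?exprn_gt0//.
apply: (@le_trans _ _ (D * m / n%:R ^+ 3 * (E * enorm (x - p)))); first exact: ler_pM.
have -> : D * m / n%:R ^+ 3 * 4 * enorm (x - p) / T ^+ 2 * E ^+ 3 =
   D * m / n%:R ^+ 3 * ((E * enorm (x - p)) * (2 * E / T) ^+ 2) by field; rewrite !gt_eqF.
rewrite ler_wpM2l// ler_peMr ?mulr_ge0 ?enorm_ge0 ?(ltW E0)//.
rewrite -[leLHS](expr1n _ 2) ler_pXn2r ?nnegrE ?divr_ge0 ?mulr_ge0 ?(ltW E0) ?(ltW T0)//.
by rewrite ler_pdivlMr// mul1r; lra.
Qed.

Lemma potential_sum_radial :
  dot (grad (potential_sum D w n) x) (x - p) = - (w i / enorm (x - p)) + pole_rest_radial.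
Proof.
have e0 : 0 < enorm (x - p) by case/andP: hx.
have g k : partial k (potential_sum D w n) x =
    \sum_(j : box n) w j * (- (x - center D j) 0 k / enorm (x - center D j) ^+ 3).
  have h := is_derive_potential_sum w k near_pole_neq.
  by rewrite /partial; exact: derive_val.
rewrite /dot (eq_bigr (fun k => \sum_(j : box n) - w j / enorm (x - center D j) ^+ 3 *
    ((x - center D j) 0 k * (x - p) 0 k))); last first.
  move=> k _; rewrite mxE g big_distrl /=; apply: eq_bigr => j _.
  by move: (enorm _) => E; ring.
rewrite exchange_big /= (bigD1 i)//=; congr (_ + _); last first.
  by apply: eq_bigr => j _; rewrite -big_distrr /= mulrAC.
rewrite -big_distrr /= -[X in _ * X]/(dot (x - p) (x - p)) dot_enorm.
by field; rewrite gt_eqF.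
Qed.

End NearPole.

(** * Size of the necks *)

(** The left-hand side is u + (x - p) . grad u for u the product of al/rho + a and be/rho + b, where
    [da] and [db] are the radial derivatives of [a] and [b], multiplied by rho. Its sign is that of
    the mean curvature of a sphere about p. The terms of order 1/rho cancel. With y = m^2/n the
    remainder is at most (2 * 65 * 112 + 2 * 224) y = 15008 y, which is below 1/2 as 40000 y <=
    1. *)
Lemma neck_balance (R : realFieldType) (D n m rho al be a b da db : R) :
  0 < D -> 1 <= n -> 1 <= m -> 200 * (200 * (m * m)) <= n ->
  0 < rho -> rho <= D / n / 2 ->
  0 <= al <= D * m / n ^+ 3 -> 0 <= be <= D * m / n ^+ 3 ->
  1 <= a <= 65 * m -> 1 <= b <= 65 * m ->
  `|da| <= 224 * m / D * rho -> `|db| <= 224 * m / D * rho ->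
  exists E, `|E| <= 2^-1 /\
  (al / rho + a) * (be / rho + b) + ((al / rho + a) * (- (be / rho) + db) +
     (be / rho + b) * (- (al / rho) + da)) = - (al * be / rho ^+ 2) + a * b + E.
Proof.
move=> D0 n1 m1 nm r0 rs /andP[al0 alD] /andP[be0 beD] /andP[a1 am] /andP[b1 bm] hda hdb.
have n0 : 0 < n by lra.
pose y := m * m / n.
have y0 : 0 <= y by rewrite divr_ge0 ?mulr_ge0//; lra.
have y1 : 200 * (200 * y) <= 1 by rewrite /y !mulrA ler_pdivrMr// mul1r -!mulrA.
exists (a * db + b * da + (al * db / rho + be * da / rho)); split; last by field; rewrite gt_eqF.
have mn0 : 0 <= m / n by rewrite divr_ge0//; lra.
have small d : `|d| <= 224 * m / D * rho -> `|d| <= 112 * (m / n).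
  move=> h; apply: le_trans h _; apply: (@le_trans _ _ (224 * m / D * (D / n / 2))).
    by rewrite ler_wpM2l// divr_ge0 ?mulr_ge0 ?(ltW D0)//; lra.
  by rewrite le_eqVlt; apply/orP; left; apply/eqP; field; rewrite !gt_eqF.
have P1 c d : 1 <= c <= 65 * m -> `|d| <= 224 * m / D * rho -> `|c * d| <= 65 * (112 * y).
  move=> /andP[c1 cm] /small hd; rewrite normrM ger0_norm; last by lra.
  have -> : 65 * (112 * y) = (65 * m) * (112 * (m / n)) by rewrite /y; field; rewrite gt_eqF.
  by apply: ler_pM => //; lra.
have P2 c d : 0 <= c <= D * m / n ^+ 3 -> `|d| <= 224 * m / D * rho -> `|c * d / rho| <= 224 * y.
  move=> /andP[c0 cm] hd; rewrite normrM normrM (ger0_norm c0) (gtr0_norm (_ : 0 < rho^-1)) ?invr_gt0//.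
  rewrite ler_pdivrMr//.
  apply: (@le_trans _ _ (D * m / n ^+ 3 * (224 * m / D * rho))); first exact: ler_pM.
  have -> : D * m / n ^+ 3 * (224 * m / D * rho) = 224 * (m * m / n ^+ 3) * rho.
    by field; rewrite !gt_eqF.
  rewrite ler_pM2r// ler_pM2l// ler_wpM2l ?mulr_ge0//; try lra.
  by rewrite lef_pV2 ?posrE ?exprn_gt0// ler_eXnr.
have h1 := P1 a db; have h2 := P1 b da; have h3 := P2 al db; have h4 := P2 be da.
apply: le_trans (ler_normD _ _) _.
have k1 := ler_normD (a * db) (b * da); have k2 := ler_normD (al * db / rho) (be * da / rho).
have g1 : `|a * db| <= 65 * (112 * y) by apply: h1 => //; apply/andP.
have g2 : `|b * da| <= 65 * (112 * y) by apply: h2 => //; apply/andP.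
have g3 : `|al * db / rho| <= 224 * y by apply: h3 => //; apply/andP.
have g4 : `|be * da / rho| <= 224 * y by apply: h4 => //; apply/andP.
clear h1 h2 h3 h4 P1 P2 small.
by move: g1 g2 g3 g4 k1 k2 y1; move: `|_ + _| `|_ + _| `|_| `|_| `|_| `|_| => q1 q2 q3 q4 q5 q6; lra.
Qed.

Section NeckRadius.
Context {R : realType}.
Variables (D : R) (n : nat) (alpha beta : forall n, box n -> R) (m : R).
Hypotheses (D0 : 0 < D) (n0 : (0 < n)%N) (m1 : 1 <= m) (nm : 200 * (200 * (m * m)) <= n%:R).
Hypothesis ha : forall j : box n, 0 <= alpha j <= D * m / n%:R ^+ 3.
Hypothesis hb : forall j : box n, 0 <= beta j <= D * m / n%:R ^+ 3.
Variables (i : box n) (S : set (vec3 R)).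
Local Notation p := (center D i).
Local Notation u := (factor_n D alpha beta n).
Hypothesis mS : closed_minimal_surface u S.
Hypothesis Ss : S `<=` [set x | enorm (x - p) <= D / (2 * n%:R)].
Hypothesis S0 : forall x, S x -> 0 < enorm (x - p).

Let neck_sign x0 (sg : R) : sg = 1 \/ sg = -1 -> S x0 ->
  (forall x, S x -> sg * (enorm (x - p) ^+ 2 - enorm (x0 - p) ^+ 2) <= 0) ->
  exists ab E : R, [/\ 1 <= ab <= 65 * (65 * (m * m)), `|E| <= 2^-1 &
    sg * (- (alpha i * beta i / enorm (x0 - p) ^+ 2) + ab + E) <= 0].
Proof.
move=> hsg Sx0 hext.
have r0 := S0 Sx0; have nR : 1 <= n%:R :> R by rewrite ler1n.
have rs : enorm (x0 - p) <= D / n%:R / 2.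
  by have := Ss Sx0; rewrite /= invfM mulrA mulrAC.
have hx : 0 < enorm (x0 - p) <= D / n%:R / 2 by rewrite r0 rs.
have np := near_pole_neq D0 n0 hx.
have da k := is_derive_potential_sum alpha k np.
have db k := is_derive_potential_sum beta k np.
have dM k := is_deriveM (da k) (db k).
have a1 := pole_rest_ge1 ha i x0; have b1 := pole_rest_ge1 hb i x0.
have aE := pole_restE D alpha i x0; have bE := pole_restE D beta i x0.
have al0 : 0 <= alpha i / enorm (x0 - p) by rewrite divr_ge0 ?enorm_ge0//; case/andP: (ha i).
have be0 : 0 <= beta i / enorm (x0 - p) by rewrite divr_ge0 ?enorm_ge0//; case/andP: (hb i).
have := minimal_surface_barrier hsg mS Sx0 r0.
have uE : u = potential_sum D alpha n * potential_sum D beta n by [].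
move=> /(_ _ _ hext) bar.
have {}bar : sg * (u x0 + dot (grad u x0) (x0 - p)) <= 0.
  apply: bar => [k|]; first by rewrite uE; exact: (@ex_derive _ _ _ _ _ _ _ (dM k)).
  by rewrite uE /= mulr_gt0// ?aE ?bE; lra.
have gE : dot (grad u x0) (x0 - p) =
   potential_sum D alpha n x0 * dot (grad (potential_sum D beta n) x0) (x0 - p) +
   potential_sum D beta n x0 * dot (grad (potential_sum D alpha n) x0) (x0 - p).
  rewrite -!dotZl -dotDl; congr (dot _ _); apply/rowP => k; rewrite !mxE /partial uE.
  rewrite (@derive_val _ _ _ _ _ _ _ (dM k)) (@derive_val _ _ _ _ _ _ _ (da k)) (@derive_val _ _ _ _ _ _ _ (db k)).
  by [].
move: bar; rewrite gE (potential_sum_radial alpha D0 n0 hx) (potential_sum_radial beta D0 n0 hx).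
have -> : u x0 = potential_sum D alpha n x0 * potential_sum D beta n x0 by [].
rewrite aE bE.
have ga := pole_rest_radial_le D0 n0 ha hx; have gb := pole_rest_radial_le D0 n0 hb hx.
have a2 := pole_rest_le D0 n0 m1 ha hx; have b2 := pole_rest_le D0 n0 m1 hb hx.
have A12 : 1 <= pole_rest D alpha i x0 <= 65 * m by rewrite a1 a2.
have B12 : 1 <= pole_rest D beta i x0 <= 65 * m by rewrite b1 b2.
have [E [E1 ->]] := neck_balance D0 nR m1 nm r0 rs (ha i) (hb i) A12 B12 ga gb.
move=> bar; exists (pole_rest D alpha i x0 * pole_rest D beta i x0), E; split => //.
apply/andP; split; first by nra.
rewrite (_ : 65 * (65 * (m * m)) = (65 * m) * (65 * m)); last by ring.
by apply: ler_pM => //; lra.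
Qed.

(** The barrier is applied at the nearest and at the farthest point of S. At the nearest one alpha
    beta / rho^2 <= ab + E, and ab <= 65^2 m^2, which leaves room below 10^4 m^2; at the farthest
    one alpha beta / rho^2 >= ab + E >= 1/2. *)
Lemma neck_radius x : S x ->
  alpha i * beta i <= 10 ^+ 4 * (m * m) * enorm (x - p) ^+ 2 /\
  enorm (x - p) ^+ 2 <= 2 * (alpha i * beta i).
Proof.
move=> Sx; have [Sne cS _] := mS.
have cn : continuous (fun x : vec3 R => enorm (x - p)).
  move=> z; apply: (@continuous_comp _ _ _ (fun w : vec3 R => w - p) (@enorm R)).
    exact: subr_continuous.
  exact: enorm_continuous.
have m2 : 1 <= m * m by rewrite -[leLHS](mulr1 1); apply: ler_pM.
split.
  have [c cin hc] := EVT_min_rV Sne cS (@continuous_subspaceT _ _ S _ cn).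
  rewrite inE in cin.
  have [|ab [E [/andP[h1 h2] hE h3]]] := @neck_sign c (-1) (or_intror erefl) cin.
    move=> y Sy; rewrite mulN1r oppr_le0 subr_ge0 ler_pXn2r ?nnegrE ?enorm_ge0//.
    by apply: hc; rewrite inE.
  have c0 := S0 cin.
  have cx : enorm (c - p) ^+ 2 <= enorm (x - p) ^+ 2.
    by rewrite ler_pXn2r ?nnegrE ?enorm_ge0//; apply: hc; rewrite inE.
  apply: (@le_trans _ _ (10 ^+ 4 * (m * m) * enorm (c - p) ^+ 2)); last first.
    by rewrite ler_wpM2l// mulr_ge0 ?exprn_ge0//; lra.
  rewrite -ler_pdivrMr ?exprn_gt0//.
  move: h3 hE; rewrite mulN1r oppr_le0 ler_norml => h3 /andP[_ hE].
  by move: h3; move: (_ / _) => q; lra.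
have [c cin hc] := EVT_max_rV Sne cS (@continuous_subspaceT _ _ S _ cn).
rewrite inE in cin.
have [|ab [E [/andP[h1 h2] hE h3]]] := @neck_sign c 1 (or_introl erefl) cin.
  move=> y Sy; rewrite mul1r subr_le0 ler_pXn2r ?nnegrE ?enorm_ge0//.
  by apply: hc; rewrite inE.
have c0 := S0 cin.
have cx : enorm (x - p) ^+ 2 <= enorm (c - p) ^+ 2.
  by rewrite ler_pXn2r ?nnegrE ?enorm_ge0//; apply: hc; rewrite inE.
apply: (le_trans cx).
have : 2^-1 <= alpha i * beta i / enorm (c - p) ^+ 2.
  move: h3 hE; rewrite mul1r ler_norml => h3 /andP[hE _].
  by move: h3; move: (_ / _ ^+ 2) => q; lra.
by rewrite ler_pdivlMr ?exprn_gt0//; lra.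
Qed.

End NeckRadius.

(** * Comparison of the conformal factors *)

Section Defect.
Context {R : realType}.
Variables (D : R) (A : vec3 R -> R) (alpha : forall n, box n -> R).
Hypothesis hd : (defect D A alpha < +oo)%E.

Let defect_ubE n (j : box n) :
  ((n%:R ^+ 4 * `|alpha j - A (center D j) * (D / n%:R) ^+ 3|)%:E <= defect D A alpha)%E.
Proof. by apply: ereal_sup_ubound; exists n, j. Qed.

Let defect_fin : defect D A alpha \is a fin_num.
Proof.
rewrite ge0_fin_numE//.
pose j : box 1 := [ffun=> ord0].
by apply: le_trans (defect_ubE j); rewrite lee_fin mulr_ge0// exprn_ge0.
Qed.

Lemma defect_ub n (j : box n) :
  n%:R ^+ 4 * `|alpha j - A (center D j) * (D / n%:R) ^+ 3| <= fine (defect D A alpha).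
Proof. by rewrite -lee_fin fineK. Qed.

Lemma fine_defect_ge0 : 0 <= fine (defect D A alpha).
Proof.
pose j : box 1 := [ffun=> ord0].
by apply: le_trans (defect_ub j); rewrite mulr_ge0// exprn_ge0.
Qed.

End Defect.

Lemma product_compare (R : realFieldType) (x y a b L e : R) :
  1 <= x -> 1 <= y -> x <= L -> y <= L -> 0 <= e -> e <= L ->
  0 <= a -> 0 <= b -> a <= x + e -> b <= y + e -> a * b <= x * y + 3 * L * e.
Proof.
move=> x1 y1 xL yL e0 eL a0 b0 ax by_.
apply: (@le_trans _ _ ((x + e) * (y + e))); first by apply: ler_pM.
have -> : (x + e) * (y + e) = x * y + (x + y + e) * e by ring.
by rewrite lerD2l ler_wpM2r//; lra.
Qed.

(** Here a and b have no upper bound, as [factor_n] is unbounded near poles; they are first cut off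
    at x and y. *)
Lemma product_compare_min (R : realFieldType) (x y a b L e : R) :
  1 <= x -> 1 <= y -> x <= L -> y <= L -> 0 <= e -> e <= L ->
  1 <= a -> 1 <= b -> x <= a + e -> y <= b + e -> x * y <= a * b + 3 * L * e.
Proof.
move=> x1 y1 xL yL e0 eL a1 b1 xa yb.
pose a' := Num.min a x; pose b' := Num.min b y.
have a'1 : 1 <= a' by rewrite le_min a1.
have b'1 : 1 <= b' by rewrite le_min b1.
have a'x : a' <= x by rewrite ge_min lexx orbT.
have b'y : b' <= y by rewrite ge_min lexx orbT.
apply: (@le_trans _ _ (a' * b' + 3 * L * e)).
  apply: product_compare => //; try lra.
  - by rewrite /a' addr_minl le_min xa lerDl.
  - by rewrite /b' addr_minl le_min yb lerDl.
rewrite lerD2r; apply: ler_pM; try lra.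
- by rewrite /a' ge_min lexx.
- by rewrite /b' ge_min lexx.
Qed.

Section Comparison.
Context {R : realType}.
Variables (D : R) (A B : vec3 R -> R) (alpha beta : forall n, box n -> R).
Hypothesis hS : BLR_sum D A B alpha beta.
Local Notation u n := (factor_n D alpha beta n).
Local Notation v := (limit_factor A B).

(** One plus the variables of class C; the next constant adds those with gradients. The size of the
    necks, and with it the threshold for n, depends on [base_const] only. *)
Definition base_const : R :=
  1 + sup_density A * D ^+ 2 + sup_density B * D ^+ 2 + fine (defect D A alpha) / D + fine (defect D B beta) / D.

Definition full_const : R := base_const + sup_grad A * D ^+ 3 + sup_grad B * D ^+ 3.

(** With L = 2 * lattice_const * full_const, the limit potentials are at most L and the sums
    approximate them up to L/n. So 3L^2 serves both as a bound for the limit factor and as n times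
    the error 3L * L/n of the products. *)
Definition factor_const : R := 3 * (2 * lattice_const * full_const) ^+ 2.

Local Notation M4 := base_const.
Local Notation M6 := full_const.
Local Notation W := factor_const.
Local Notation kk := (2 * lattice_const : R).

Let D0 : 0 < D. Proof. by case: hS. Qed.
Let hA : admissible_density D A. Proof. by case: hS. Qed.
Let hB : admissible_density D B. Proof. by case: hS. Qed.
Let a0 n (j : box n) : 0 <= alpha j. Proof. by case: hS. Qed.
Let b0 n (j : box n) : 0 <= beta j. Proof. by case: hS. Qed.
Let dA n (j : box n) := defect_ub (BLR_alpha_defect hS) j.
Let dB n (j : box n) := defect_ub (BLR_beta_defect hS) j.
Let dA0 : 0 <= fine (defect D A alpha).
Proof. by apply: fine_defect_ge0; case: hS. Qed.
Let dB0 : 0 <= fine (defect D B beta).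
Proof. by apply: fine_defect_ge0; case: hS. Qed.
Let qA0 : 0 <= sup_density A * D ^+ 2.
Proof. by rewrite mulr_ge0 ?exprn_ge0 ?(sup_density_ge0 D0)// ltW. Qed.
Let qB0 : 0 <= sup_density B * D ^+ 2.
Proof. by rewrite mulr_ge0 ?exprn_ge0 ?(sup_density_ge0 D0)// ltW. Qed.
Let gA0 : 0 <= sup_grad A * D ^+ 3.
Proof. by rewrite mulr_ge0 ?exprn_ge0 ?(sup_grad_ge0 D0)// ltW. Qed.
Let gB0 : 0 <= sup_grad B * D ^+ 3.
Proof. by rewrite mulr_ge0 ?exprn_ge0 ?(sup_grad_ge0 D0)// ltW. Qed.
Let dA1 : 0 <= fine (defect D A alpha) / D. Proof. by rewrite divr_ge0 ?(ltW D0). Qed.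
Let dB1 : 0 <= fine (defect D B beta) / D. Proof. by rewrite divr_ge0 ?(ltW D0). Qed.

Lemma base_const_ge1 : 1 <= M4.
Proof. by move: qA0 qB0 gA0 gB0 dA1 dB1; rewrite /size_const /full_const /base_const; move: (sup_density A * _) (sup_density B * _) (sup_grad A * _) (sup_grad B * _) (fine (defect D A _) / D) (fine (defect D B _) / D) => x1 x2 x3 x4 x5 x6; lra. Qed.

Lemma base_le_full : M4 <= M6.
Proof. by move: qA0 qB0 gA0 gB0 dA1 dB1; rewrite /size_const /full_const /base_const; move: (sup_density A * _) (sup_density B * _) (sup_grad A * _) (sup_grad B * _) (fine (defect D A _) / D) (fine (defect D B _) / D) => x1 x2 x3 x4 x5 x6; lra. Qed.

Let sA d : 0 <= d -> d <= fine (defect D A alpha) -> size_const D A d <= M6.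
Proof.
move=> d0 dd; have : d / D <= fine (defect D A alpha) / D by rewrite ler_pM2r ?invr_gt0.
move: qA0 qB0 gA0 gB0 dA1 dB1; rewrite /size_const /full_const /base_const; move: (sup_density A * _) (sup_density B * _) (sup_grad A * _) (sup_grad B * _) (fine (defect D A _) / D) (fine (defect D B _) / D) => x1 x2 x3 x4 x5 x6.
by move: (_ / _) => g; lra.
Qed.

Let sB d : 0 <= d -> d <= fine (defect D B beta) -> size_const D B d <= M6.
Proof.
move=> d0 dd; have : d / D <= fine (defect D B beta) / D by rewrite ler_pM2r ?invr_gt0.
move: qA0 qB0 gA0 gB0 dA1 dB1; rewrite /size_const /full_const /base_const; move: (sup_density A * _) (sup_density B * _) (sup_grad A * _) (sup_grad B * _) (fine (defect D A _) / D) (fine (defect D B _) / D) => x1 x2 x3 x4 x5 x6.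
by move: (_ / _) => g; lra.
Qed.

Let M61 : 1 <= M6. Proof. by apply: le_trans base_le_full; exact: base_const_ge1. Qed.

Lemma alpha_weight n (j : box n) : (0 < n)%N -> 0 <= alpha j <= D * M4 / n%:R ^+ 3.
Proof.
move=> n0; rewrite a0 /=; apply: le_trans (weight_le4 D0 n0 hA dA0 (@dA n) j) _.
rewrite ler_pM2r ?invr_gt0 ?exprn_gt0 ?ltr0n// ler_pM2l//.
by move: qA0 qB0 gA0 gB0 dA1 dB1; rewrite /size_const /full_const /base_const; move: (sup_density A * _) (sup_density B * _) (sup_grad A * _) (sup_grad B * _) (fine (defect D A _) / D) (fine (defect D B _) / D) => x1 x2 x3 x4 x5 x6; lra.
Qed.

Lemma beta_weight n (j : box n) : (0 < n)%N -> 0 <= beta j <= D * M4 / n%:R ^+ 3.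
Proof.
move=> n0; rewrite b0 /=; apply: le_trans (weight_le4 D0 n0 hB dB0 (@dB n) j) _.
rewrite ler_pM2r ?invr_gt0 ?exprn_gt0 ?ltr0n// ler_pM2l//.
by move: qA0 qB0 gA0 gB0 dA1 dB1; rewrite /size_const /full_const /base_const; move: (sup_density A * _) (sup_density B * _) (sup_grad A * _) (sup_grad B * _) (fine (defect D A _) / D) (fine (defect D B _) / D) => x1 x2 x3 x4 x5 x6; lra.
Qed.

Let k1 : 1 <= lattice_const :> R.
Proof. by have := @lattice_const_ge R; lra. Qed.

Let kM : 1 <= kk * M6.
Proof. by move: k1 M61; move: lattice_const M6 => k m; nra. Qed.

Let kS c S : 0 <= c -> c <= kk -> S <= M6 -> c * S <= kk * M6.
Proof.
move=> c0 ck SM; apply: (@le_trans _ _ (c * M6)); first exact: ler_wpM2l.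
by apply: ler_wpM2r => //; move: M61; lra.
Qed.

Let kk0 : 0 <= kk. Proof. by move: k1; move: lattice_const => k; lra. Qed.
Let k_le : lattice_const <= kk. Proof. by move: k1; move: lattice_const => k; lra. Qed.
Let k_ge0 : 0 <= lattice_const :> R. Proof. by move: k1; move: lattice_const => k; lra. Qed.

Let pot_A x : potential A x <= kk * M6.
Proof. by apply: (le_trans (potential_bound D0 hA x)); apply: kS => //; exact: sA. Qed.

Let pot_B x : potential B x <= kk * M6.
Proof. by apply: (le_trans (potential_bound D0 hB x)); apply: kS => //; exact: sB. Qed.

Lemma limit_factor_ge1 x : 1 <= v x.
Proof.
rewrite /limit_factor -[leLHS](mulr1 1); apply: ler_pM => //;
  [exact: (potential_ge1 hA)|exact: (potential_ge1 hB)].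
Qed.

Lemma limit_factor_continuous : continuous v.
Proof.
move=> x.
have cA := @potential_continuous R D A D0 hA x.
have cB := @potential_continuous R D B D0 hB x.
exact: (continuousM cA cB).
Qed.

Lemma factor_const_ge1 : 1 <= W.
Proof. by have := kM; rewrite /factor_const; move: (kk * M6) => y y1; nra. Qed.

Lemma limit_factor_le x : v x <= W.
Proof.
apply: (@le_trans _ _ (kk * M6 * (kk * M6))).
  apply: ler_pM; rewrite ?pot_A ?pot_B//; apply: (@le_trans _ _ 1) => //;
    [exact: (potential_ge1 hA)|exact: (potential_ge1 hB)].
by rewrite /factor_const; move: kM; move: (kk * M6) => y y1; nra.
Qed.

Lemma potential_sum_ge1 (w : forall n, box n -> R) n x : (forall j : box n, 0 <= w n j) ->
  1 <= potential_sum D w n x.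
Proof. by move=> w0; rewrite lerDl; apply: sumr_ge0 => j _; rewrite divr_ge0 ?enorm_ge0. Qed.

Lemma factor_n_ge1 n x : 1 <= u n x.
Proof.
by rewrite /factor_n -[leLHS](mulr1 1); apply: ler_pM => //; exact: potential_sum_ge1.
Qed.

Definition clear n (a : vec3 R) := forall j : box n, alpha j + beta j != 0 ->
  D / (2 * n%:R ^+ 2) <= enorm (a - center D j).

Let clear_alpha n a : clear n a -> forall j : box n, alpha j != 0 ->
  D / (2 * n%:R ^+ 2) <= enorm (a - center D j).
Proof.
by move=> h j aj; apply: h; rewrite gt_eqF// ltr_pwDl// lt_def aj a0.
Qed.

Let clear_beta n a : clear n a -> forall j : box n, beta j != 0 ->
  D / (2 * n%:R ^+ 2) <= enorm (a - center D j).
Proof.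
by move=> h j bj; apply: h; rewrite gt_eqF// ltr_wpDl// lt_def bj b0.
Qed.

Section Fixed.
Variables (n : nat) (n0 : (0 < n)%N).
Let nR : 1 <= n%:R :> R. Proof. by rewrite ler1n. Qed.
Let e := kk * (M6 / n%:R).

Let Mn0 : 0 <= M6 / n%:R. Proof. by rewrite divr_ge0//; move: M61; lra. Qed.
Let e0 : 0 <= e. Proof. exact: mulr_ge0. Qed.
Let eL : e <= kk * M6.
Proof.
apply: ler_wpM2l => //; rewrite ler_pdivrMr; last by apply: lt_le_trans nR.
by rewrite ler_peMr//; move: M61; lra.
Qed.

Let errW : 3 * (kk * M6) * e = W / n%:R.
Proof. by rewrite /e /factor_const; move: lattice_const => k; ring. Qed.

Let scale_err S : S <= M6 -> 1 <= S -> lattice_const * (S / n%:R) <= e.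
Proof.
move=> SM S1; apply: ler_pM => //; first by rewrite divr_ge0//; lra.
by rewrite ler_pM2r ?invr_gt0//; exact: lt_le_trans nR.
Qed.

Let err_A : lattice_const * (size_const D A (fine (defect D A alpha)) / n%:R) <= e.
Proof. by apply: scale_err; rewrite ?sA// (size_const_ge1 D0 hA). Qed.

Let err_B : lattice_const * (size_const D B (fine (defect D B beta)) / n%:R) <= e.
Proof. by apply: scale_err; rewrite ?sB// (size_const_ge1 D0 hB). Qed.

Lemma factor_n_le_limit x a : enorm (x - a) <= 3 * (D / n%:R) -> clear n a ->
  u n a <= v x + W / n%:R.
Proof.
move=> xa ca; rewrite -errW; apply: product_compare => //.
- exact: (potential_ge1 hA).
- exact: (potential_ge1 hB).
- by apply: le_trans (potential_sum_ge1 _ (@a0 n)).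
- by apply: le_trans (potential_sum_ge1 _ (@b0 n)).
- apply: le_trans (sample_sum_le D0 n0 hA (@a0 n) dA0 (@dA n) xa (clear_alpha ca)) _.
  by rewrite lerD2l; exact: err_A.
- apply: le_trans (sample_sum_le D0 n0 hB (@b0 n) dB0 (@dB n) xa (clear_beta ca)) _.
  by rewrite lerD2l; exact: err_B.
Qed.

Lemma limit_le_factor_n x a : enorm (x - a) <= 3 * (D / n%:R) -> v x <= u n a + W / n%:R.
Proof.
move=> xa; rewrite -errW; apply: product_compare_min => //.
- exact: (potential_ge1 hA).
- exact: (potential_ge1 hB).
- exact: potential_sum_ge1.
- exact: potential_sum_ge1.
- apply: le_trans (potential_le D0 n0 hA (@a0 n) dA0 (@dA n) xa) _.
  by rewrite lerD2l; exact: err_A.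
- apply: le_trans (potential_le D0 n0 hB (@b0 n) dB0 (@dB n) xa) _.
  by rewrite lerD2l; exact: err_B.
Qed.

Lemma factor_n_continuous x : (forall j : box n, alpha j + beta j != 0 -> x != center D j) ->
  {for x, continuous (u n)}.
Proof.
move=> hx.
have ca : {for x, continuous (potential_sum D alpha n)}.
  by apply: potential_sum_continuous => j aj; apply: hx; rewrite gt_eqF// ltr_pwDl// lt_def aj a0.
have cb : {for x, continuous (potential_sum D beta n)}.
  by apply: potential_sum_continuous => j bj; apply: hx; rewrite gt_eqF// ltr_wpDl// lt_def bj b0.
exact: (continuousM ca cb).
Qed.

End Fixed.

End Comparison.

(** * Radial graphs *)

Section Gauge.
Context {R : realType}.
Variables (p : vec3 R) (S : set (vec3 R)) (r0 : R).
Hypotheses (cS : compact S) (gS : is_radial_graph p S).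
Hypotheses (r00 : 0 < r0) (hr0 : forall y, S y -> r0 <= enorm (y - p)).
Implicit Types (x y z : vec3 R).

Let cone (I : set R) : set (vec3 R) := (fun q : vec3 R * R => p + q.2 *: (q.1 - p)) @` (S `*` I).

Let cone_closed a b : closed (cone `[a, b]%classic).
Proof.
apply: compact_closed; first exact: norm_hausdorff.
apply: continuous_compact; last by apply: compact_setX => //; exact: segment_compact.
apply: continuous_subspaceT => q.
apply: (@cvgD _ (vec3 R) _ _ _ (fun=> p) (fun q : vec3 R * R => q.2 *: (q.1 - p))).
  exact: cvg_cst.
apply: (@cvgZ _ (vec3 R) _ _ _ (fun q : vec3 R * R => q.2) (fun q : vec3 R * R => q.1 - p)).
  exact: cvg_snd.
apply: (@cvgB _ (vec3 R) _ _ _ (fun q : vec3 R * R => q.1) (fun=> p)); first exact: cvg_fst.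
exact: cvg_cst.
Qed.

(** [phi] is the Minkowski gauge of the region inside S: |x - p| divided by the radius of S in the
    direction of x. The radius function is not assumed continuous. What is needed of it is drawn
    from the compactness of S: the cones p + t (S - p) with t in a compact interval are closed. *)
Lemma radial_gauge : exists phi : vec3 R -> R,
  [/\ forall x, S x <-> phi x = 1,
      forall x t, 0 <= t -> phi (p + t *: (x - p)) = t * phi x,
      forall x, x != p -> 0 < phi x,
      open [set x | phi x < 1] & open [set x | 1 < phi x]].
Proof.
have [s [s0 SE]] := gS.
pose dir x := (enorm (x - p))^-1 *: (x - p).
pose phi x := enorm (x - p) / s (dir x).
have dir1 x : x != p -> enorm (dir x) = 1.
  move=> xp; have h : 0 < enorm (x - p) by rewrite enorm_gt0 subr_eq0.
  by rewrite enormZ ger0_norm ?invr_ge0 ?(ltW h)// mulVf ?gt_eqF.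
have phi_pos x : x != p -> 0 < phi x.
  by move=> xp; rewrite divr_gt0 ?s0 ?dir1// enorm_gt0 subr_eq0.
have phip : phi p = 0 by rewrite /phi subrr enorm0 mul0r.
have hom x t : 0 <= t -> phi (p + t *: (x - p)) = t * phi x.
  rewrite le_eqVlt => /predU1P[<-|t0]; first by rewrite scale0r addr0 phip mul0r.
  have [->|xp] := eqVneq x p; first by rewrite subrr scaler0 addr0 phip mulr0.
  have h : 0 < enorm (x - p) by rewrite enorm_gt0 subr_eq0.
  have e : p + t *: (x - p) - p = t *: (x - p) by rewrite addrC addKr.
  have d : dir (p + t *: (x - p)) = dir x.
    rewrite /dir e enormZ (gtr0_norm t0) invfM scalerA mulrAC mulVf ?gt_eqF// mul1r.
    by [].
  by rewrite /phi d e enormZ (gtr0_norm t0) mulrA.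
have Sphi x : S x <-> phi x = 1.
  rewrite SE; split.
    move=> [w /= w1 <-]; have sw := s0 w w1.
    have e : p + s w *: w - p = s w *: w by rewrite addrC addKr.
    rewrite /phi /dir e enormZ w1 mulr1 (gtr0_norm sw) scalerA mulVf ?gt_eqF// scale1r.
    by rewrite mulfV ?gt_eqF.
  have [->|xp] := eqVneq x p; first by rewrite phip => /esym/eqP; rewrite oner_eq0.
  move=> x1; have h : 0 < enorm (x - p) by rewrite enorm_gt0 subr_eq0.
  exists (dir x) => /=; first exact: dir1.
  have -> : s (dir x) = enorm (x - p).
    have sp := s0 _ (dir1 _ xp).
    by rewrite -[LHS]mul1r -x1 /phi divfK ?gt_eqF.
  by rewrite /dir scalerA mulfV ?gt_eqF// scale1r addrC subrK.
have on_cone x : x != p -> exists y, S y /\ x = p + phi x *: (y - p).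
  move=> xp; have fx := phi_pos x xp; exists (p + (phi x)^-1 *: (x - p)); split.
    by apply/Sphi; rewrite hom ?invr_ge0 ?(ltW fx)// mulVf ?gt_eqF.
  by rewrite [_ - p]addrC addKr scalerA mulfV ?gt_eqF// scale1r addrC subrK.
have phi_cone y t : S y -> 0 <= t -> phi (p + t *: (y - p)) = t.
  by move=> /Sphi y1 t0; rewrite hom// y1 mulr1.
exists phi; split => //.
(* On the unit ball about [x0] the gauge is at most [T], since points of S are at least [r0] away
   from p; so the cone over [1, T] contains all points of this ball with gauge at least 1. *)
- rewrite openE => x0 /= x01; pose T := (enorm (x0 - p) + 1) / r0.
  have cl := @cone_closed 1 T.
  have o1 : open (~` cone `[1, T]%classic) by exact: closed_openC.
  have nx0 : (~` cone `[1, T]%classic) x0.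
    move=> [[y t] /= [Sy]]; rewrite in_itv /= => /andP[t1 _] e; move: x01; rewrite -e.
    by rewrite phi_cone// ?ltNge ?t1//; lra.
  have : nbhs x0 (~` cone `[1, T]%classic `&` eball x0 1).
    by apply: filterI; [exact: (open_nbhs_nbhs (conj o1 nx0))|exact: (eball_nbhs x0 ltr01)].
  apply: filterS => x [nx]; rewrite /eball /= => xx0; rewrite ltNge; apply/negP => x1.
  have xp : x != p by apply: contraTneq x1 => ->; rewrite phip -ltNge.
  have [y [Sy xE]] := on_cone x xp.
  apply: nx; exists (y, phi x) => //=; split => //; rewrite in_itv /= x1 /=.
  rewrite ler_pdivlMr//; apply: (@le_trans _ _ (enorm (x - p))).
    rewrite {2}xE [p + _]addrC addrK enormZ ger0_norm; last by lra.
    by apply: ler_wpM2l; [lra|exact: hr0].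
  by have := enorm_triangle x0 x p; lra.
- have -> : [set x | 1 < phi x] = ~` (cone `[0, 1]%classic `|` [set p]).
    apply/seteqP; split => x /=.
      move=> x1 [[[y t] /= [Sy]]|]; last by move=> e; move: x1; rewrite e phip; lra.
      by rewrite in_itv /= => /andP[t0 t1] e; move: x1; rewrite -e phi_cone//; lra.
    move=> nx; rewrite ltNge; apply/negP => x1.
    have xp : x != p by apply/eqP => e; apply: nx; right.
    have [y [Sy xE]] := on_cone x xp.
    apply: nx; left; exists (y, phi x) => //=; split => //.
    by rewrite in_itv /= x1 (ltW (phi_pos x xp)).
  apply: closed_openC; apply: closedU => //; exact: (accessible_closed_set1 (hausdorff_accessible (@norm_hausdorff _ (vec3 R)))).
Qed.

(** Points with gauge below 1 are joined to p by a segment on which the gauge stays below 1. Away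
    from S, the set of points with gauge above 1 is open and closed, so a connected set through one
    of them does not reach p. *)
Lemma Out_gauge (rho : R) : eball 0 rho p -> exists phi : vec3 R -> R,
  [/\ forall x, S x <-> phi x = 1,
      forall x t, 0 <= t -> phi (p + t *: (x - p)) = t * phi x,
      forall x, x != p -> 0 < phi x &
      forall x, Out rho p S x <-> eball 0 rho x /\ 1 < phi x].
Proof.
move=> Bp; have [phi [Sphi hom pos oI oE]] := radial_gauge.
have phip : phi p = 0 by have := hom p 0 (lexx _); rewrite scale0r addr0 mul0r.
exists phi; split => // x; split.
  move=> [[Bx Sx] nc]; split => //; rewrite ltNge; apply/negP; rewrite le_eqVlt => /predU1P[e|x1].
    by apply: Sx; apply/Sphi.
  apply: nc; pose c (t : R) := p + t *: (x - p).
  have cc : continuous c.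
    move=> t; apply: cvgD; first exact: cvg_cst.
    by apply: cvgZr_tmp; exact: cvg_id.
  exists (c @` `[0, 1]%classic); last by exists 0; rewrite /c /= ?in_itv /= ?lexx ?ler01// scale0r addr0.
  split.
  - by exists 1; rewrite /c /= ?in_itv /= ?lexx ?ler01// scale1r addrC subrK.
  - move=> z [t /=]; rewrite in_itv /= => /andP[t0 t1] <-; split.
      have := @eball_convex R 0 rho p x t Bp Bx; rewrite t0 t1 => /(_ isT).
      by [].
    move=> /Sphi; rewrite hom// => e; have : t * phi x < 1; last by rewrite e ltxx.
    have [e0|ne] := eqVneq x p; first by rewrite e0 phip mulr0.
    by have := pos x ne; nra.
  - apply: connected_continuous_connected; first exact: segment_connected.
    exact: continuous_subspaceT.
move=> [Bx x1]; split; first by split => // /Sphi; lra.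
move=> [C [Cx CB cC] Cp].
suff : C `&` [set x | 1 < phi x] = C by move=> e; move: Cp; rewrite -e => -[_] /=; rewrite phip; lra.
apply: cC.
- by exists x.
- by exists [set x | 1 < phi x].
- exists (~` [set x | phi x < 1]); first exact: open_closedC.
  apply/seteqP; split => y /= [Cy h]; split => //; first by apply/negP; rewrite -leNgt ltW.
  move/negP: h; rewrite -leNgt le_eqVlt => /predU1P[e|//].
  by have [_] := CB y Cy; case; apply/Sphi.
Qed.

End Gauge.

(** * The region outside the necks *)

Lemma sqr_large (R : realFieldType) (N m : R) :
  200 * (200 * (m * m)) <= N -> 1 <= N -> 1 <= m -> 8 * (m * m) < N ^+ 2.
Proof.
move=> h1 h2 h3; have : 1 <= m * m by rewrite -[leLHS](mulr1 1); apply: ler_pM.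
by move: (m * m) h1 => q h1 q1; nra.
Qed.

Section Region.
Context {R : realType}.
Variables (D : R) (A B : vec3 R -> R) (alpha beta : forall n, box n -> R).
Hypothesis hS : BLR_sum D A B alpha beta.
Variables (n : nat) (Sigma : box n -> set (vec3 R)) (rho : R).
Local Notation M4 := (base_const D A B alpha beta).
Hypotheses (n0 : (0 < n)%N) (nlarge : 200 * (200 * (M4 * M4)) <= n%:R).
Hypothesis hrho : Num.sqrt 3 * D < rho.
Hypothesis hSig : forall i : box n, alpha i * beta i != 0 -> neck_surface D alpha beta i (Sigma i).
Local Notation V := (V_region D alpha beta Sigma rho).
Local Notation s := (D / n%:R).
Local Notation r1 := (D / (2 * n%:R ^+ 2)).
Implicit Types (x y z : vec3 R) (i j : box n).

Let D0 : 0 < D. Proof. by case: hS. Qed.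
Let nR : 1 <= n%:R :> R. Proof. by rewrite ler1n. Qed.
Let nR0 : 0 < n%:R :> R. Proof. exact: lt_le_trans nR. Qed.
Let s0 : 0 < s. Proof. by rewrite divr_gt0. Qed.
Let M41 : 1 <= M4. Proof. exact: base_const_ge1. Qed.
Let r10 : 0 < r1. Proof. by rewrite divr_gt0// mulr_gt0// exprn_gt0. Qed.
Let a0 i : 0 <= alpha i. Proof. by case: hS. Qed.
Let b0 i : 0 <= beta i. Proof. by case: hS. Qed.

Lemma double_pole_sum i : alpha i * beta i != 0 -> alpha i + beta i != 0.
Proof.
move=> h; rewrite gt_eqF// ltr_pwDl// lt_def a0 andbT.
by apply: contraNneq h => ->; rewrite mul0r.
Qed.

Lemma near_center_ball i z : enorm (z - center D i) <= s / 2 -> eball 0 rho z.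
Proof.
move=> hz; rewrite /eball /= subr0; apply: le_lt_trans hrho.
have := enorm_triangle (center D i) z 0; rewrite !subr0.
have := enorm_center D0 n0 i; have : 1 <= Num.sqrt 3 :> R by rewrite -[leLHS]sqrtr1 ler_wsqrtr// ler1n.
by move: (Num.sqrt 3) (s) s0 hz => q e e0; nra.
Qed.

(** The squared radius is at most 2 alpha beta <= 2 (D M4/n^3)^2, which is 8 M4^2/n^2 times the
    square of D/(2n^2). *)
Lemma neck_points i y : alpha i * beta i != 0 -> Sigma i y ->
  [/\ 0 < enorm (y - center D i), alpha i * beta i <= 10 ^+ 4 * (M4 * M4) * enorm (y - center D i) ^+ 2 &
      enorm (y - center D i) < r1].
Proof.
move=> ab Sy; have [mS Ss [sg [sg0 SE]]] := hSig ab.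
have S0 z : Sigma i z -> 0 < enorm (z - center D i).
  rewrite SE => -[w /= w1 <-]; rewrite [center D i + _]addrC addrK enormZ w1 mulr1 normr_gt0 gt_eqF//.
  exact: sg0.
have ha j := alpha_weight hS j n0; have hb j := beta_weight hS j n0.
have [h1 h2] := neck_radius D0 n0 M41 nlarge ha hb mS Ss S0 Sy.
split => //; first exact: S0.
have q0 : 0 <= D * M4 / n%:R ^+ 3 by case/andP: (ha i) => h3 h4; exact: le_trans h4.
have ab2 : alpha i * beta i <= (D * M4 / n%:R ^+ 3) ^+ 2.
  by rewrite expr2; apply: ler_pM => //; [case/andP: (ha i)|case/andP: (hb i)].
rewrite -(ltr_pXn2r (n := 2)) ?nnegrE ?enorm_ge0 ?(ltW r10)//.
apply: (le_lt_trans h2); apply: (@le_lt_trans _ _ (2 * (D * M4 / n%:R ^+ 3) ^+ 2)).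
  by rewrite ler_pM2l.
have -> : 2 * (D * M4 / n%:R ^+ 3) ^+ 2 = (8 * (M4 * M4) / n%:R ^+ 2) * r1 ^+ 2.
  by field; rewrite gt_eqF.
rewrite gtr_pMl ?exprn_gt0// ltr_pdivrMr ?exprn_gt0// mul1r.
exact: sqr_large nlarge nR M41.
Qed.

Lemma neck_gauge i : alpha i * beta i != 0 -> exists phi : vec3 R -> R,
  [/\ forall x, Sigma i x <-> phi x = 1,
      forall x t, 0 <= t -> phi (center D i + t *: (x - center D i)) = t * phi x,
      forall x, x != center D i -> 0 < phi x &
      forall x, Out rho (center D i) (Sigma i) x <-> eball 0 rho x /\ 1 < phi x].
Proof.
move=> ab; have [[_ cS _] Ss gS] := hSig ab.
have ab0 : 0 < alpha i * beta i by rewrite lt_def ab mulr_ge0.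
have k0 : 0 < 10 ^+ 4 * (M4 * M4) by rewrite mulr_gt0 ?exprn_gt0// mulr_gt0//; move: M41; lra.
apply: (@Out_gauge R _ _ (Num.sqrt (alpha i * beta i / (10 ^+ 4 * (M4 * M4))))) => //.
- by rewrite sqrtr_gt0 divr_gt0.
- move=> y Sy; have [h1 h2 _] := neck_points ab Sy.
  rewrite -[leRHS]ger0_norm ?enorm_ge0// -sqrtr_sqr ler_wsqrtr// ler_pdivrMr//.
  by rewrite [leRHS]mulrC.
- by apply: (@near_center_ball i); rewrite subrr enorm0 divr_ge0// ltW.
Qed.

Let on_neck i phi x : (forall x, Sigma i x <-> phi x = 1) ->
   (forall x t, 0 <= t -> phi (center D i + t *: (x - center D i)) = t * phi x) ->
   0 < phi x -> exists2 y, Sigma i y & enorm (x - center D i) = phi x * enorm (y - center D i).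
Proof.
move=> Sphi hom fx; exists (center D i + (phi x)^-1 *: (x - center D i)).
  by apply/Sphi; rewrite hom ?invr_ge0 ?(ltW fx)// mulVf ?gt_eqF.
rewrite [center D i + _]addrC addrK enormZ ger0_norm ?invr_ge0 ?(ltW fx)//.
by rewrite mulrA mulfV ?gt_eqF// mul1r.
Qed.

Lemma Out_far i x : alpha i * beta i != 0 -> eball 0 rho x -> r1 <= enorm (x - center D i) ->
  Out rho (center D i) (Sigma i) x.
Proof.
move=> ab Bx hx; have [phi [Sphi hom pos OutE]] := neck_gauge ab.
apply/OutE; split => //.
have xp : x != center D i.
  by rewrite -subr_eq0 -enorm_eq0 gt_eqF//; exact: lt_le_trans hx.
have fx := pos x xp; have [y Sy e] := on_neck Sphi hom fx.
have [h1 _ h2] := neck_points ab Sy.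
by rewrite ltNge; apply/negP => h; have := hx; rewrite e; nra.
Qed.

Lemma V_ball x : V x -> eball 0 rho x. Proof. by case=> [[]]. Qed.

Lemma V_not_pole x j : V x -> alpha j + beta j != 0 -> x != center D j.
Proof. by move=> [_ np] aj; apply/eqP => e; apply: np; exists j. Qed.

Lemma V_clear x : eball 0 rho x -> clear D alpha beta n x -> V x.
Proof.
move=> Bx cl; split; first split => //.
  by move=> i /= ab; apply: Out_far => //; apply: cl; exact: double_pole_sum.
move=> [j /= aj e]; have := cl j aj; rewrite e subrr enorm0; move: r10; lra.
Qed.

(** A point of V is beyond the neck on its ray from the center, and the radius of the neck is
    bounded from below. *)
Lemma V_neck x i : V x -> alpha i * beta i <= 10 ^+ 4 * (M4 * M4) * enorm (x - center D i) ^+ 2.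
Proof.
move=> [[_ hO] _]; have [->|ab] := eqVneq (alpha i * beta i) 0.
  by rewrite mulr_ge0 ?exprn_ge0 ?enorm_ge0// mulr_ge0 ?exprn_ge0// mulr_ge0//; move: M41; lra.
have [phi [Sphi hom pos OutE]] := neck_gauge ab.
have /OutE[_ fx] := hO i ab; have fx0 : 0 < phi x by lra.
have [y Sy e] := on_neck Sphi hom fx0; have [h1 h2 _] := neck_points ab Sy.
apply: le_trans h2 _; rewrite ler_wpM2l//.
  by rewrite mulr_ge0 ?exprn_ge0// mulr_ge0//; move: M41; lra.
rewrite ler_pXn2r ?nnegrE ?enorm_ge0// e ler_peMl ?enorm_ge0//; exact: ltW.
Qed.

(** The gauge of the neck at p_i is homogeneous, so it grows along the ray; the other centers remain
    at distance at least D/(2n^2). *)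
Lemma V_radial x i t : V x -> 1 <= t -> t * enorm (x - center D i) <= s / 2 ->
  V (center D i + t *: (x - center D i)).
Proof.
move=> Vx t1 hz; set z := center D i + _.
have zi : z - center D i = t *: (x - center D i) by rewrite /z [center D i + _]addrC addrK.
have ez : enorm (z - center D i) <= s / 2 by rewrite zi enormZ ger0_norm//; lra.
have Bz := near_center_ball ez.
have rs : r1 <= s / 2.
  have -> : r1 = s / 2 / n%:R by field; rewrite gt_eqF.
  by rewrite ler_pdivrMr// ler_peMr// divr_ge0// ltW.
have far j : j != i -> r1 <= enorm (z - center D j).
  move=> ji; have := center_dist D0 n0 ji; have := enorm_triangle z (center D j) (center D i).
  by rewrite (enormBC (center D j) z); move: (s) rs ez => e; lra.
split; first split => //.
  move=> j /= ab; have [e|ji] := eqVneq j i; last exact: Out_far (far j ji).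
  rewrite e in ab *; have [phi [Sphi hom pos OutE]] := neck_gauge ab.
  case: Vx => -[_ /(_ i ab) /OutE[_ fx]] _; apply/OutE; split => //.
  by rewrite hom; nra.
move=> [j /= aj e]; have [ji|ji] := eqVneq j i.
  have := V_not_pole Vx aj; rewrite ji -subr_eq0 -(enorm_eq0 (x - _)) => xi.
  have : enorm (z - center D i) = 0 by rewrite -e ji subrr enorm0.
  rewrite zi enormZ => /eqP; rewrite mulf_eq0 (negbTE xi) orbF normr_eq0 => /eqP; lra.
by have := far j ji; rewrite -e subrr enorm0; move: r10; lra.
Qed.

End Region.

(** * Replacing curves by chains of short detours *)

Lemma orthogonal_unit (R : realType) (d v : vec3 R) :
  exists e : vec3 R, [/\ enorm e = 1, dot e d = 0 & 0 <= dot e v].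
Proof.
have [e [e1 ed]] : exists e : vec3 R, enorm e = 1 /\ dot e d = 0.
  have dot3 (x y : vec3 R) : dot x y = x 0 0 * y 0 0 + (x 0 1 * y 0 1 + x 0 2%:R * y 0 2%:R).
    rewrite /dot !big_ord_recl big_ord0 addr0.
    rewrite (_ : lift ord0 ord0 = 1 :> 'I_3); last exact: val_inj.
    by rewrite (_ : lift ord0 (lift ord0 ord0) = 2%:R :> 'I_3); last exact: val_inj.
  (* A quarter turn of the first two coordinates of [d]; if these vanish, a basis vector is
     orthogonal to [d]. *)
  pose w : vec3 R := \row_(j < 3) [:: - d 0 1; d 0 0; 0]`_j.
  have wd : dot w d = 0 by rewrite dot3 !mxE /=; ring.
  have [w0|wn] := eqVneq w 0.
    exists (delta_mx 0 0); split; first exact: enorm_delta.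
    have d0 : d 0 0 = 0 by move/matrixP : w0 => /(_ 0 1); rewrite !mxE.
    by rewrite dot3 !mxE /= d0; ring.
  have w1 : 0 < enorm w by rewrite enorm_gt0.
  exists ((enorm w)^-1 *: w); split; last by rewrite dotZl wd mulr0.
  by rewrite enormZ ger0_norm ?invr_ge0 ?(ltW w1)// mulVf ?gt_eqF.
have [h|h] := leP 0 (dot e v); first by exists e.
by exists (- e); rewrite enormN !dotNl ed oppr0 oppr_ge0 (ltW h).
Qed.

(** The alternative is additive in the parameter interval, so only smooth arcs need an argument: the
    earliest time at distance at least d exists by compactness, and the intermediate value theorem
    gives equality there. *)
Lemma exit_time (R : realType) (gamma : R -> vec3 R) (p : vec3 R) (d : R) :
  piecewise_smooth gamma -> forall a b : R, 0 <= a -> a <= b -> b <= 1 ->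
  enorm (gamma a - p) <= d ->
  (forall z, a <= z <= b -> enorm (gamma z - p) <= d) \/
  exists t, [/\ a <= t <= b, enorm (gamma t - p) = d & forall z, a <= z <= t -> enorm (gamma z - p) <= d].
Proof.
move=> pg; apply: (piecewise_smooth_rect _ _ pg (Q := fun a b => enorm (gamma a - p) <= d ->
  (forall z, a <= z <= b -> enorm (gamma z - p) <= d) \/
  exists t, [/\ a <= t <= b, enorm (gamma t - p) = d & forall z, a <= z <= t -> enorm (gamma z - p) <= d])).
  move=> a b c a0 ab bc c1 Qab Qbc ha; have [h1|[t [/andP[at_ tb] te ht]]] := Qab ha; last first.
    by right; exists t; rewrite at_ (le_trans tb bc).
  have hb : enorm (gamma b - p) <= d by apply: h1; rewrite ab lexx.
  have [h2|[t [/andP[bt tc] te ht]]] := Qbc hb.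
    left => z /andP[az zc]; have [zb|bz] := leP z b; first by apply: h1; rewrite az.
    by apply: h2; rewrite zc ltW.
  right; exists t; split => //; first by rewrite tc (le_trans ab bt).
  move=> z /andP[az zt]; have [zb|bz] := leP z b; first by apply: h1; rewrite az.
  by apply: ht; rewrite zt ltW.
move=> c a b sc a0 ab b1 gc ha.
pose f t := enorm (c t - p).
have cf : continuous f.
  move=> t; apply: (@continuous_comp _ _ _ (fun t => c t - p) (@enorm R)); last exact: enorm_continuous.
  apply: (@continuous_comp _ _ _ c (fun x => x - p)); first exact: smooth_curve_continuous.
  exact: subr_continuous.
have [h|] := pselect (forall z, a <= z <= b -> enorm (gamma z - p) <= d); first by left.
move=> /existsNP[z0] /not_implyP[hz0] /negP; rewrite -ltNge gc// -/(f z0) => fz0; right.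
pose E := `[a, b]%classic `&` f @^-1` [set x | d <= x].
have cE : compact E.
  apply: compact_closedI; first exact: segment_compact.
  by apply: closed_comp; [move=> x _; exact: cf|exact: closed_ge].
have E0 : E !=set0 by exists z0; split; [rewrite /= in_itv|exact: ltW].
have cid : {within E, continuous (@id R)} by apply: continuous_subspaceT => x; exact: cvg_id.
have [t tE tmin] := compact_EVT_min E0 cE cid.
move: tE; rewrite inE /E /= in_itv /= => -[/andP[at_ tb] dt].
have fa : f a <= d by rewrite /f -gc// lexx ab.
have hmm : Num.min (f a) (f t) <= d <= Num.max (f a) (f t) by rewrite ge_min fa /= le_max dt orbT.
have [c0 c0i c0d] := @IVT R f a t d at_ (continuous_subspaceT cf) hmm.
have tc0 : t <= c0.
  by apply: tmin; rewrite inE; split => /=; [move: c0i; rewrite !in_itv /= => /andP[-> h]; exact: le_trans tb|rewrite c0d].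
have ct : c0 = t by apply/eqP; rewrite eq_le tc0 andbT; move: c0i; rewrite in_itv /= => /andP[].
exists t; split; [by rewrite at_|by rewrite gc ?at_// -/(f t) -ct|].
move=> z /andP[az zt]; rewrite gc ?az ?(le_trans zt)// -/(f z) leNgt; apply/negP => dz.
have : t <= z by apply: tmin; rewrite inE; split => /=; [rewrite in_itv /= az (le_trans zt)|exact: ltW].
move=> tz; have : z = t by apply/eqP; rewrite eq_le zt.
by move=> e; move: dz; rewrite e -ct c0d ltxx.
Qed.

Section Chain.
Context {R : realType}.
Variables (D : R) (n : nat) (P : pred (box n)) (V : set (vec3 R)) (u un : vec3 R -> R) (W rho : R).
Hypotheses (D0 : 0 < D) (n16 : (16 <= n)%N) (hrho : Num.sqrt 3 * D < rho).
Local Notation s := (D / n%:R).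
Local Notation r := (D / n%:R ^+ 2).
Local Notation r1 := (D / (2 * n%:R ^+ 2)).
(** Vertices of a chain keep the distance r from the poles, its segments only r/2; the difference is
    the room for going around a pole. *)
Local Notation good x := (forall j : box n, P j -> r <= enorm (x - center D j)).
Local Notation free x := (forall j : box n, P j -> r1 <= enorm (x - center D j)).
Hypothesis Vcont : forall x, V x -> {for x, continuous un}.
Hypothesis un1 : forall x, 1 <= un x.
Hypothesis Vfree : forall x, eball 0 rho x -> free x -> V x.
Hypotheses (ucont : continuous u) (u1 : forall x, 1 <= u x) (uW : forall x, u x <= W).
Hypothesis un_le : forall x a, enorm (x - a) <= 3 * s -> free a -> un a <= u x + W / n%:R.
Implicit Types (x y z a b c : vec3 R).

Let n0 : (0 < n)%N. Proof. exact: leq_trans n16. Qed.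
Let nR : 16 <= n%:R :> R. Proof. by rewrite ler_nat. Qed.
Let nR0 : 0 < n%:R :> R. Proof. exact: lt_le_trans nR. Qed.
Let s0 : 0 < s. Proof. by rewrite divr_gt0. Qed.
Let rE : r = s / n%:R. Proof. by field; rewrite gt_eqF. Qed.
Let r1E : r1 = r / 2. Proof. by field; rewrite gt_eqF. Qed.
Let r0 : 0 < r. Proof. by rewrite rE divr_gt0. Qed.
Let rs : r <= s / 16.
Proof. by rewrite rE ler_wpM2l ?(ltW s0)// lef_pV2 ?posrE. Qed.
Let un0 x : V x -> 0 <= un x. Proof. by move=> _; apply: le_trans (un1 x). Qed.

Lemma segment_cost a b U :
  (forall t, 0 <= t <= 1 -> eball 0 rho (a + t *: (b - a)) /\ free (a + t *: (b - a))) ->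
  (forall t, 0 <= t <= 1 -> un (a + t *: (b - a)) <= U) ->
  (conf_dist un V a b <= (U * enorm (b - a))%:E)%E.
Proof.
move=> h1 h2; apply: (conf_dist_segment Vcont un0) => // t ht.
by have [hB hf] := h1 t ht; exact: Vfree.
Qed.

(** The centers keep distance s/2 from the faces of the cube, which leaves a margin of (sqrt 3 / 2)
    s > 4/5 s. *)
Lemma ball_near_center (j : box n) z : enorm (z - center D j) <= 4 / 5 * s -> eball 0 rho z.
Proof.
move=> hz; rewrite /eball /= subr0; apply: le_lt_trans hrho.
have := enorm_triangle (center D j) z 0; rewrite !subr0.
have := enorm_center D0 n0 j.
have : 8 / 5 <= Num.sqrt 3 :> R.
  have h : (0 : R) <= 8 / 5 by lra.
  rewrite -[leLHS](ger0_norm h) -sqrtr_sqr ler_wsqrtr//; lra.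
by move: (Num.sqrt 3) (s) s0 hz => q e e0; nra.
Qed.

Let free_near (j : box n) z : P j -> r1 <= enorm (z - center D j) -> enorm (z - center D j) <= 4 / 5 * s -> free z.
Proof.
move=> Pj h1 h2 k Pk; have [->//|kj] := eqVneq k j.
have := center_dist D0 n0 kj; have := enorm_triangle z (center D k) (center D j).
by rewrite (enormBC (center D k) z) r1E; move: (s) s0 rs h2 => e e0; lra.
Qed.

(** If the segment comes within r/2 of a pole, it is replaced by the other three sides of the
    rectangle with vertices a, a + r e, b + r e, b, where e is orthogonal to b - a and points away
    from the pole. Along the two legs the distance from the pole does not decrease, and the long
    side has distance at least r from it. The extra length is 2r. *)
Lemma detour a b U : good a -> good b -> eball 0 rho a -> eball 0 rho b -> enorm (b - a) <= s / 2 ->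
  (forall c, free c -> enorm (c - a) <= s -> un c <= U) ->
  (conf_dist un V a b <= (U * (enorm (b - a) + 2 * r))%:E)%E.
Proof.
move=> ga gb Ba Bb hab hU.
have fr x : good x -> free x by move=> h j Pj; apply: le_trans (h j Pj); rewrite r1E; move: r0; lra.
have U0 : 0 <= U.
  apply: le_trans (hU a (fr a ga) _); last by rewrite subrr enorm0 ltW.
  by apply: le_trans (un1 a).
have seg t : 0 <= t <= 1 -> enorm (a + t *: (b - a) - a) <= s / 2.
  move=> /andP[t0 t1]; rewrite [a + _]addrC addrK enormZ ger0_norm//; apply: le_trans hab.
  by rewrite ler_piMl ?enorm_ge0.
have [hf|] := pselect (forall t, 0 <= t <= 1 -> free (a + t *: (b - a))).
  apply: (@le_trans _ _ (U * enorm (b - a))%:E).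
    apply: segment_cost => t ht; first by split; [exact: eball_convex|exact: hf].
    by apply: hU; [exact: hf|apply: le_trans (seg t ht) _; move: (s) s0 => e; lra].
  by rewrite lee_fin ler_wpM2l// lerDl mulr_ge0// ltW.
move=> /existsNP[t0] /not_implyP[ht0] /existsNP[j] /not_implyP[Pj] /negP; rewrite -ltNge => hz.
set p := center D j in hz *.
have segp t : 0 <= t <= 1 -> enorm (a + t *: (b - a) - p) <= s / 2 + r1.
  move=> /andP[t_0 t1]; move: ht0 => /andP[t00 t01].
  apply: le_trans (enorm_triangle (a + t0 *: (b - a)) _ _) _; apply: lerD; last exact: ltW.
  have -> : a + t *: (b - a) - (a + t0 *: (b - a)) = (t - t0) *: (b - a).
    by rewrite opprD addrACA subrr add0r scalerBl.
  rewrite enormZ; apply: le_trans hab; rewrite ler_piMl ?enorm_ge0// ler_norml; apply/andP; split; lra.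
have apS : enorm (a - p) <= s / 2 + r1.
  by have := @segp 0; rewrite scale0r addr0 lexx ler01; apply.
have bpS : enorm (b - p) <= s / 2 + r1.
  by have := @segp 1; rewrite scale1r (addrC a) subrK lexx ler01; apply.
have [e [e1 ed ep]] := orthogonal_unit (b - a) (a - p).
have ebp : 0 <= dot e (b - p).
  by have -> : b - p = (b - a) + (a - p) by [rewrite addrA subrK]; rewrite dotDr ed add0r.
have outward x t : good x -> 0 <= dot e (x - p) -> 0 <= t -> r1 <= enorm (x + t *: e - p).
  move=> gx ex t_0; apply: le_trans (_ : enorm (x - p) <= _).
    by apply: le_trans (gx j Pj); rewrite r1E; move: r0; lra.
  rewrite -(ler_pXn2r (n := 2)) ?nnegrE ?enorm_ge0// -!dot_enorm.
  have -> : x + t *: e - p = (x - p) + t *: e by rewrite addrAC.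
  move: (x - p) ex => z ez.
  rewrite !(dotDl, dotDr, dotZl, dotZr) (dotC z e) (dot_enorm e) e1.
  have : 0 <= t * dot e z by rewrite mulr_ge0.
  have : 0 <= t * t by rewrite mulr_ge0.
  by lra.
have near t x : enorm (x - a) <= s / 2 -> enorm (x - p) <= s / 2 + r1 -> 0 <= t <= r -> enorm (x + t *: e - p) <= 4 / 5 * s /\ enorm (x + t *: e - a) <= s.
  move=> xa xp /andP[t_0 tr].
  have h1 : enorm (x + t *: e - a) <= s / 2 + r.
    have -> : x + t *: e - a = (x - a) + t *: e by rewrite addrAC.
    by apply: le_trans (enormD _ _) _; rewrite enormZ e1 ger0_norm//; lra.
  have h2 : enorm (x + t *: e - p) <= s / 2 + r1 + r.
    have -> : x + t *: e - p = (x - p) + t *: e by rewrite addrAC.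
    by apply: le_trans (enormD _ _) _; rewrite enormZ e1 ger0_norm//; lra.
  by move: h1 h2 rs; rewrite r1E; move: (s) s0 => q q0; lra.
have aa : enorm (a - a) <= s / 2 by rewrite subrr enorm0 divr_ge0// ltW.
have ok t x : enorm (x - a) <= s / 2 -> enorm (x - p) <= s / 2 + r1 -> 0 <= t <= r -> r1 <= enorm (x + t *: e - p) ->
    [/\ eball 0 rho (x + t *: e), free (x + t *: e) & un (x + t *: e) <= U].
  move=> xa xp ht h1; have [h2 h3] := near t x xa xp ht.
  have hf : free (x + t *: e) by exact: (@free_near j).
  by split => //; [exact: (@ball_near_center j)|exact: hU].
have leg x : good x -> 0 <= dot e (x - p) -> enorm (x - a) <= s / 2 -> enorm (x - p) <= s / 2 + r1 ->
    (conf_dist un V x (x + r *: e) <= (U * r)%:E)%E.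
  move=> gx ex xa xp.
  have er : enorm (x + r *: e - x) = r by rewrite [x + _]addrC addrK enormZ e1 mulr1 gtr0_norm.
  rewrite -[X in (U * X)%:E]er.
  have okt t : 0 <= t <= 1 -> [/\ eball 0 rho (x + t *: (x + r *: e - x)), free (x + t *: (x + r *: e - x)) & un (x + t *: (x + r *: e - x)) <= U].
    move=> /andP[t_0 t1].
    have -> : x + t *: (x + r *: e - x) = x + (t * r) *: e by rewrite [x + r *: e]addrC addrK scalerA.
    have tr0 : 0 <= t * r by rewrite mulr_ge0// ltW.
    apply: ok => //; last exact: outward.
    by rewrite tr0 /=; apply: ler_piMl => //; exact: ltW.
  by apply: segment_cost => t /okt[].
have mid : (conf_dist un V (a + r *: e) (b + r *: e) <= (U * enorm (b - a))%:E)%E.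
  have er : b + r *: e - (a + r *: e) = b - a by rewrite opprD addrACA subrr addr0.
  rewrite -[X in (U * enorm X)%:E]er.
  have okt t : 0 <= t <= 1 -> [/\ eball 0 rho (a + r *: e + t *: (b + r *: e - (a + r *: e))), free (a + r *: e + t *: (b + r *: e - (a + r *: e))) & un (a + r *: e + t *: (b + r *: e - (a + r *: e))) <= U].
    move=> ht; rewrite er.
    have -> : a + r *: e + t *: (b - a) = a + t *: (b - a) + r *: e by rewrite addrAC.
    apply: ok; [exact: seg|exact: segp|by rewrite lexx (ltW r0)|].
    apply: (@le_trans _ _ (dot e (a + t *: (b - a) + r *: e - p))).
      have -> : a + t *: (b - a) + r *: e - p = (a - p) + t *: (b - a) + r *: e.
        by rewrite addrAC (addrAC a).
      move: (a - p) (b - a) ep ed => z d ez ed'.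
      by rewrite !(dotDr, dotZr) ed' dot_enorm e1 r1E; move: r0; lra.
    by apply: le_trans (CauchySchwarz _ _) _; rewrite e1 mul1r.
  by apply: segment_cost => t /okt[].
have Lb : (conf_dist un V (b + r *: e) b <= (U * r)%:E)%E.
  by rewrite (conf_dist_sym Vcont un0); exact: (leg b gb ebp hab bpS).
apply: le_trans (conf_dist_triangle Vcont un0 (a + r *: e) _ _) _.
apply: le_trans (leeD (leg a ga ep aa apS) (le_trans (conf_dist_triangle Vcont un0 (b + r *: e) _ _) (leeD mid Lb))) _.
by rewrite -!EFinD lee_fin; lra.
Qed.

(** Let U be the supremum of [un] over the free points within s of a. Then u >= m along the arc,
    where m is the positive part of U - W/n, so the arc has length at least m q with q its chord.
    The detour costs at most U (q + 6r), and 6r W for the first excess and s W/n for the second make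
    7 W s/n. *)
Lemma chain_step (gamma : R -> vec3 R) (t t' : R) a b : piecewise_smooth gamma ->
  0 <= t -> t <= t' -> t' <= 1 ->
  (forall v : R, t <= v <= t' -> enorm (gamma v - gamma t) <= s / 4) ->
  good a -> good b -> eball 0 rho a -> eball 0 rho b ->
  enorm (a - gamma t) <= 2 * r -> enorm (b - gamma t') <= 2 * r ->
  (conf_dist un V a b <= arc_length u gamma t t' + (7 * (W * s / n%:R))%:E)%E.
Proof.
move=> pg t0 tt' t1 near ga gb Ba Bb at_ bt.
have W1 : 1 <= W by apply: le_trans (u1 0) (uW 0).
have hd : enorm (b - a) <= enorm (gamma t' - gamma t) + 4 * r.
  have h1 := enorm_triangle (gamma t') b a; have h2 := enorm_triangle (gamma t) (gamma t') a.
  rewrite (enormBC (gamma t) a) in h2; lra.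
have h4 : enorm (gamma t' - gamma t) <= s / 4 by apply: near; rewrite tt' lexx.
pose F := [set un c | c in [set c | free c /\ enorm (c - a) <= s]].
have ub (z : R) : t <= z <= t' -> ubound F (u (gamma z) + W / n%:R).
  move=> hz _ [c [fc ca] <-]; apply: un_le => //.
  have h1 := near z hz.
  have h2 := enorm_triangle (gamma t) (gamma z) c; have h3 := enorm_triangle a (gamma t) c.
  rewrite (enormBC a c) (enormBC (gamma t) a) in h3.
  by move: rs h1 h2 h3 ca at_; move: (s) s0 => e e0; lra.
have Fa : F (un a).
  exists a => //; split; last by rewrite subrr enorm0 ltW.
  by move=> j Pj; apply: le_trans (ga j Pj); rewrite r1E; move: r0; lra.
have tin : t <= t <= t' by rewrite lexx.
have supF : has_sup F by split; [exists (un a)|exists (u (gamma t) + W / n%:R); exact: ub].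
set U := sup F; pose m := Num.max 0 (U - W / n%:R).
have Wn : 0 <= W / n%:R by rewrite divr_ge0 ?(ltW nR0)//; lra.
have m0 : 0 <= m by rewrite le_max lexx.
have mu_ (z : R) : t <= z <= t' -> m <= u (gamma z).
  move=> hz; rewrite ge_max (le_trans ler01 (u1 _)) /= lerBlDr.
  by apply: ge_sup; [exists (un a)|exact: ub].
have Um : U <= m + W / n%:R by rewrite -lerBlDr le_max lexx orbT.
have mW : m <= W by apply: le_trans (mu_ t tin) (uW _).
have dl : enorm (b - a) <= s / 2 by move: rs hd h4; move: (s) s0 => e e0; lra.
have := @detour a b U ga gb Ba Bb dl (fun c fc ca => ub_le_sup supF.2 (ex_intro2 _ _ c (conj fc ca) erefl)).
move=> h; apply: (le_trans h).
have cu : forall x, setT x -> {for x, continuous u} by move=> x _; exact: ucont.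
have u0 x : setT x -> 0 <= u x by move=> _; apply: le_trans (u1 x).
have := @speed_integral_ge R u setT cu u0 gamma t t' m pg (fun _ _ => I) t0 tt' t1 m0 mu_.
move=> arc; apply: (@le_trans _ _ ((m * enorm (gamma t' - gamma t))%:E + (7 * (W * s / n%:R))%:E)%E); last first.
  exact: leeD2r.
rewrite -EFinD lee_fin.
set q := enorm (gamma t' - gamma t) in hd h4 *.
apply: (@le_trans _ _ ((m + W / n%:R) * (q + 6 * r))).
  apply: ler_pM => //; last by lra.
    by apply: le_trans (ub_le_sup supF.2 Fa); apply: le_trans (un1 a).
  by rewrite addr_ge0 ?enorm_ge0// mulr_ge0// ltW.
have e1 : W * s / n%:R = W * r by rewrite rE; ring.
have e2 : W / n%:R * s = W * r by rewrite rE; ring.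
have -> : 7 * (W * s / n%:R) = 6 * (W * r) + W / n%:R * s by rewrite e1 e2; ring.
have h5 : m * r <= W * r by rewrite ler_pM2r.
have h6 : W / n%:R * (q + 6 * r) <= W / n%:R * s.
  by rewrite ler_wpM2l//; move: rs h4; move: (s) s0 => e e0; lra.
have -> : (m + W / n%:R) * (q + 6 * r) = m * q + 6 * (m * r) + W / n%:R * (q + 6 * r) by ring.
by lra.
Qed.

Let arc_length_ge (gamma : R -> vec3 R) (x y : R) : piecewise_smooth gamma ->
  0 <= x -> x <= y -> y <= 1 -> ((1 * enorm (gamma y - gamma x))%:E <= arc_length u gamma x y)%E.
Proof.
move=> pg x0 xy y1.
have cu : forall x, setT x -> {for x, continuous u} by move=> z _; exact: ucont.
have u0 z : setT z -> 0 <= u z by move=> _; apply: le_trans (u1 z).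
by apply: (speed_integral_ge cu u0 pg) => // t _; exact: u1.
Qed.

(** The curve is cut whenever it has moved away by s/4. As u >= 1, every cut uses up at least s/4 of
    the length; so [k] bounds the number of cuts, and there are at most 4l/s + 1 steps. *)
Lemma chain (gamma : R -> vec3 R) b : piecewise_smooth gamma ->
  (forall v : R, 0 <= v <= 1 -> eball 0 rho (gamma v)) ->
  good b -> eball 0 rho b -> enorm (b - gamma 1) <= 2 * r ->
  forall (k : nat) (t : R) a (l : R), 0 <= t <= 1 -> good a -> eball 0 rho a -> enorm (a - gamma t) <= 2 * r ->
  arc_length u gamma t 1 = l%:E -> l < k.+1%:R * (s / 4) ->
  (conf_dist un V a b <= (l + (4 * l / s + 1) * (7 * (W * s / n%:R)))%:E)%E.
Proof.
move=> pg gB gb Bb b1.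
have cu : forall x, setT x -> {for x, continuous u} by move=> x _; exact: ucont.
have u0 x : setT x -> 0 <= u x by move=> _; apply: le_trans (u1 x).
have W1 : 1 <= W by apply: le_trans (u1 0) (uW 0).
set E := 7 * (W * s / n%:R).
have E0 : 0 <= E by rewrite mulr_ge0// divr_ge0 ?(ltW nR0)// mulr_ge0 ?(ltW s0)//; lra.
have arc_ge (x y : R) : 0 <= x -> x <= y -> y <= 1 -> ((1 * enorm (gamma y - gamma x))%:E <= arc_length u gamma x y)%E.
  exact: arc_length_ge.
have arc0 (x y : R) : 0 <= x -> x <= y -> y <= 1 -> (0 <= arc_length u gamma x y)%E.
  by move=> x0 xy y1; apply: le_trans (arc_ge x y x0 xy y1); rewrite lee_fin mul1r enorm_ge0.
elim=> [|k IH] t a l /andP[t0 t1] ga Ba at_ al lk.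
all: have l0 : 0 <= l by [have := arc0 t 1 t0 t1 (lexx _); rewrite al lee_fin].
all: have d0 : enorm (gamma t - gamma t) <= s / 4 by rewrite subrr enorm0 divr_ge0// ltW.
all: have [near|[t' [/andP[tt' t'1] e4 near]]] := exit_time pg t0 t1 (lexx _) d0.
- have := chain_step pg t0 t1 (lexx _) near ga gb Ba Bb at_ b1; rewrite al -EFinD -/E => h.
  apply: (le_trans h); rewrite lee_fin lerD2l ler_peMl// lerDr.
  by apply: divr_ge0; [exact: mulr_ge0|exact: ltW].
- have h1 := arc_ge t t' t0 tt' t'1; have h2 := arc0 t' 1 (le_trans t0 tt') t'1 (lexx _).
  have := speed_integral_cat cu u0 pg (fun _ _ => I) t0 tt' t'1 (lexx _); rewrite al => h3.
  have : ((s / 4)%:E <= l%:E)%E by rewrite h3 -e4; apply: le_trans (leeDl _ h2); rewrite -[X in (X%:E <= _)%E]mul1r.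
  by rewrite lee_fin leNgt; move: lk; rewrite mul1r => ->.
- have := chain_step pg t0 t1 (lexx _) near ga gb Ba Bb at_ b1; rewrite al -EFinD -/E => h.
  apply: (le_trans h); rewrite lee_fin lerD2l ler_peMl// lerDr.
  by apply: divr_ge0; [exact: mulr_ge0|exact: ltW].
have h1 := arc_ge t t' t0 tt' t'1; have h2 := arc0 t' 1 (le_trans t0 tt') t'1 (lexx _).
have h1' := arc0 t t' t0 tt' t'1.
have := speed_integral_cat cu u0 pg (fun _ _ => I) t0 tt' t'1 (lexx _); rewrite al => h3.
have f1 : arc_length u gamma t t' \is a fin_num.
  by rewrite ge0_fin_numE//; apply: le_lt_trans (ltry l); rewrite h3 leeDl.
have f2 : arc_length u gamma t' 1 \is a fin_num.
  by rewrite ge0_fin_numE//; apply: le_lt_trans (ltry l); rewrite h3 leeDr.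
have [l1 l1E] : exists l1, arc_length u gamma t t' = l1%:E by exists (fine (arc_length u gamma t t')); rewrite fineK.
have [l2 l2E] : exists l2, arc_length u gamma t' 1 = l2%:E by exists (fine (arc_length u gamma t' 1)); rewrite fineK.
move: h3 h1 h2; rewrite l1E l2E -EFinD !lee_fin mul1r e4 => -[lE] l1s l20.
have rb : 0 <= r <= s / 8 by rewrite (ltW r0) /=; move: rs; move: (s) s0 => e e0; lra.
have t'0 := le_trans t0 tt'.
have t'i : 0 <= t' <= 1 by rewrite t'0.
have [c [c1 c2 c3]] := good_point D0 n0 (gamma t') rb.
have gc : good c by move=> j _.
have Bc : eball 0 rho c by have := c3 rho hrho; have := gB t' t'i; rewrite /eball /= !subr0 => h; apply.
have ct : enorm (c - gamma t') <= 2 * r by rewrite enormBC.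
have near' (z : R) : t <= z <= t' -> enorm (gamma z - gamma t) <= s / 4 by exact: near.
have S1 := chain_step pg t0 tt' t'1 near' ga gc Ba Bc at_ ct.
have lk2 : l2 < k.+1%:R * (s / 4).
  have -> : k.+1%:R * (s / 4) = k.+2%:R * (s / 4) - s / 4 by rewrite -[k.+2%:R]natr1; ring.
  by move: lk l1s; rewrite lE; set y : R := _ * (s / 4); set z : R := s / 4; lra.
have S2 := IH t' c l2 t'i gc Bc ct l2E lk2.
apply: le_trans (conf_dist_triangle Vcont un0 c _ _) _.
apply: le_trans (leeD S1 S2) _.
rewrite l1E -!EFinD lee_fin -/E.
have -> : 4 * l / s = 4 * l1 / s + 4 * l2 / s by rewrite lE; ring.
have h4 : 1 <= 4 * l1 / s by rewrite ler_pdivlMr// mul1r; lra.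
have h5 : E <= 4 * l1 / s * E by rewrite ler_peMl.
move: h5; move: (4 * l1 / s) (4 * l2 / s) => y z h5; rewrite lE.
have -> : (y + z + 1) * E = y * E + (z + 1) * E by ring.
by lra.
Qed.

Lemma chain_dist x y a b (l : R) : good a -> good b -> eball 0 rho a -> eball 0 rho b ->
  enorm (a - x) <= 2 * r -> enorm (b - y) <= 2 * r ->
  (conf_dist u (eball 0 rho) x y < l%:E)%E ->
  (conf_dist un V a b <= (l + (4 * l / s + 1) * (7 * (W * s / n%:R)))%:E)%E.
Proof.
move=> ga gb Ba Bb ax by_ /ereal_inf_lt[_ [gamma [pg g0 g1 gB]] <-]; rewrite conf_lengthE => hl.
have cu : forall x, setT x -> {for x, continuous u} by move=> z _; exact: ucont.
have u0 z : setT z -> 0 <= u z by move=> _; apply: le_trans (u1 z).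
have arc0 : (0 <= arc_length u gamma 0 1)%E.
  apply: le_trans (arc_length_ge pg (lexx 0) ler01 (lexx 1)).
  by rewrite lee_fin mul1r enorm_ge0.
have f1 : arc_length u gamma 0 1 \is a fin_num by rewrite ge0_fin_numE//; exact: lt_trans hl (ltry _).
have [k kE] : exists k, arc_length u gamma 0 1 = k%:E by exists (fine (arc_length u gamma 0 1)); rewrite fineK.
rewrite kE lte_fin in hl; rewrite kE lee_fin in arc0.
have W1 : 1 <= W by apply: le_trans (u1 0) (uW 0).
have E0 : 0 <= 7 * (W * s / n%:R) by rewrite mulr_ge0// divr_ge0 ?(ltW nR0)// mulr_ge0 ?(ltW s0)//; lra.
have hm := archi_boundP (divr_ge0 arc0 (divr_ge0 (ltW s0) (ler0n R 4))).
have km : k < (Num.bound (k / (s / 4))).+1%:R * (s / 4).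
  rewrite -ltr_pdivrMr ?divr_gt0//; apply: lt_le_trans hm _; rewrite ler_nat//.
have := @chain gamma b pg gB gb Bb _ _ 0 a k _ ga Ba _ kE km.
rewrite g0 g1 lexx ler01 => /(_ by_ isT ax) h.
apply: (le_trans h); rewrite lee_fin; apply: lerD; first exact: ltW.
by rewrite ler_wpM2r// lerD2r ler_pM2r ?invr_gt0// ler_pM2l// ltW.
Qed.

End Chain.

(** * Escaping from a pole *)

Lemma ln4_ge1 (R : realType) : 1 <= ln 4 :> R.
Proof.
have h : expR 1 <= 4 :> R.
  have h1 : 2^-1 <= expR (- 2^-1) :> R by apply: le_trans (expR_ge1Dx _); lra.
  have h2 : expR (2^-1) <= 2 :> R by rewrite -[leLHS]invrK -expRN -[leRHS]invrK lef_pV2 ?posrE ?expR_gt0 ?invr_gt0.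
  have h3 : expR (2^-1) * expR (2^-1) <= 2 * 2 :> R by apply: ler_pM => //; rewrite expR_ge0.
  have e1 : 2^-1 + 2^-1 = 1 :> R by lra.
  by move: h3; rewrite -expRD e1; lra.
by rewrite -[leLHS]expRK ler_ln ?posrE ?expR_gt0.
Qed.

Lemma nat_le_ln (R : realType) (k : nat) (q : R) : 0 < q -> 4 ^+ k <= q^-1 -> k%:R <= `|ln q|.
Proof.
move=> q0 h; have h4 : ln (4 ^+ k) <= ln q^-1 by rewrite ler_ln ?posrE ?exprn_gt0 ?invr_gt0.
rewrite lnXn// lnV ?posrE// in h4; rewrite -normrN; apply: le_trans (ler_norm _); apply: le_trans h4.
by rewrite -[leRHS]mulr_natl ler_peMr// ln4_ge1.
Qed.

Section ConfDistScale.
Context {R : realType}.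
Variables (u u' : vec3 R -> R) (V V' : set (vec3 R)) (c : R).
Hypotheses (VV' : V `<=` V') (c0 : 0 <= c).
Hypothesis u_cont : forall x, V' x -> {for x, continuous u}.
Hypothesis u'_cont : forall x, V x -> {for x, continuous u'}.
Hypothesis u0 : forall x, V' x -> 0 <= u x.
Hypothesis u'0 : forall x, V x -> 0 <= u' x.
Hypothesis uu' : forall x, V x -> u x <= c * u' x.

(** A curve in V is admissible in V' as it stands, so only the integrands are compared. *)
Lemma conf_dist_scale x y (l : R) : (conf_dist u' V x y < l%:E)%E ->
  (conf_dist u V' x y <= (c * l)%:E)%E.
Proof.
move=> /ereal_inf_lt[_ [gamma [pg g0 g1 gV]] <-] hl.
have gV' t : 0 <= t <= 1 -> V' (gamma t) by move=> /gV /VV'.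
apply: (@le_trans _ _ (conf_length u gamma)).
  by apply: conf_dist_le; split.
apply: (@le_trans _ _ (c%:E * conf_length u' gamma)%E); last first.
  by rewrite EFinM lee_wpmul2l// ltW.
have m' := speed_measurable u'_cont pg gV (lexx 0) ler01 (lexx 1).
have mm := speed_measurable u_cont pg gV' (lexx 0) ler01 (lexx 1).
rewrite !conf_lengthE /arc_length -ge0_integralZl//; last first.
  by move=> t; rewrite /= in_itv /= => /gV h; exact: (speed_ge0 u'0 h).
apply: ge0_le_integral => //.
- by move=> t; rewrite /= in_itv /= => /gV' h; exact: (speed_ge0 u0 h).
- by apply: measurable_funeM.
- move=> t; rewrite /= in_itv /= => /gV h; rewrite /speed -EFinM lee_fin mulrA.
  by rewrite ler_wpM2r ?enorm_ge0// uu'.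
Qed.

End ConfDistScale.

Section Endpoint.
Context {R : realType}.
Variables (D : R) (A B : vec3 R -> R) (alpha beta : forall n, box n -> R).
Hypothesis hS : BLR_sum D A B alpha beta.
Variables (n : nat) (Sigma : box n -> set (vec3 R)) (rho : R).
Local Notation M4 := (base_const D A B alpha beta).
Hypotheses (n0 : (0 < n)%N) (nlarge : 200 * (200 * (M4 * M4)) <= n%:R).
Hypothesis hrho : Num.sqrt 3 * D < rho.
Hypothesis hSig : forall i : box n, alpha i * beta i != 0 -> neck_surface D alpha beta i (Sigma i).
Local Notation V := (V_region D alpha beta Sigma rho).
Local Notation un := (factor_n D alpha beta n).
Local Notation s := (D / n%:R).
Local Notation r := (D / n%:R ^+ 2).
Implicit Types (x y z w : vec3 R) (i j : box n).

Let D0 : 0 < D. Proof. by case: hS. Qed.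
Let nR : 1 <= n%:R :> R. Proof. by rewrite ler1n. Qed.
Let nR0 : 0 < n%:R :> R. Proof. exact: lt_le_trans nR. Qed.
Let s0 : 0 < s. Proof. by rewrite divr_gt0. Qed.
Let M41 : 1 <= M4. Proof. exact: base_const_ge1. Qed.
Let a0 i : 0 <= alpha i. Proof. by case: hS. Qed.
Let b0 i : 0 <= beta i. Proof. by case: hS. Qed.

Lemma V_continuous x : V x -> {for x, continuous un}.
Proof. by move=> Vx; apply: (factor_n_continuous hS) => j; exact: V_not_pole Vx. Qed.

Lemma factor_n_near i (sg : R) w t : enorm w = 1 -> 0 < sg -> sg <= t -> t <= s / 2 ->
  un (center D i + t *: w) <= alpha i * beta i / sg ^+ 2 + 65 * M4 * (alpha i + beta i) / sg + 65 * M4 * (65 * M4).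
Proof.
move=> w1 sg0 st ts; have t0 := lt_le_trans sg0 st.
have e : enorm (center D i + t *: w - center D i) = t.
  by rewrite [center D i + _]addrC addrK enormZ w1 mulr1 gtr0_norm.
have hx : 0 < enorm (center D i + t *: w - center D i) <= s / 2 by rewrite e t0.
have ha j := alpha_weight hS j n0; have hb j := beta_weight hS j n0.
have a1 := pole_rest_ge1 ha i (center D i + t *: w); have b1 := pole_rest_ge1 hb i (center D i + t *: w).
have a2 := pole_rest_le D0 n0 M41 ha hx; have b2 := pole_rest_le D0 n0 M41 hb hx.
rewrite /factor_n (pole_restE D alpha i) (pole_restE D beta i) e.
apply: (@le_trans _ _ ((alpha i / sg + 65 * M4) * (beta i / sg + 65 * M4))); last first.
  by rewrite le_eqVlt; apply/orP; left; apply/eqP; field; rewrite gt_eqF.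
have q (c : R) : 0 <= c -> c / t <= c / sg by move=> c0; rewrite ler_wpM2l// lef_pV2 ?posrE.
apply: ler_pM.
- by rewrite addr_ge0 ?divr_ge0 ?(ltW t0)//; apply: le_trans a1.
- by rewrite addr_ge0 ?divr_ge0 ?(ltW t0)//; apply: le_trans b1.
- by apply: lerD => //; exact: q.
- by apply: lerD => //; exact: q.
Qed.

Let un0 x : V x -> 0 <= un x.
Proof. by move=> _; apply: le_trans ler01 (factor_n_ge1 hS _ _). Qed.

Lemma radial_leg i (sg t : R) w : enorm w = 1 -> 0 < sg -> sg <= t -> t <= 2 * sg -> t <= s / 2 ->
  V (center D i + sg *: w) ->
  V (center D i + t *: w) /\
  (conf_dist un V (center D i + sg *: w) (center D i + t *: w) <=
   (alpha i * beta i / sg + 65 * M4 * (alpha i + beta i) + 65 * M4 * (65 * M4) * (t - sg))%:E)%E.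
Proof.
move=> w1 sg0 st t2 ts Vs.
have Vt v : sg <= v -> v <= s / 2 -> V (center D i + v *: w).
  move=> sv vs; have e : center D i + sg *: w - center D i = sg *: w by rewrite [center D i + _]addrC addrK.
  have := @V_radial R D A B alpha beta hS n Sigma rho n0 nlarge hrho hSig _ i (v / sg) Vs.
  rewrite e scalerA divfK ?gt_eqF//; apply; first by rewrite ler_pdivlMr// mul1r.
  by rewrite enormZ w1 mulr1 gtr0_norm// divfK ?gt_eqF.
split; first exact: Vt.
have e v : center D i + sg *: w + v *: (center D i + t *: w - (center D i + sg *: w)) = center D i + (sg + v * (t - sg)) *: w.
  rewrite opprD addrACA subrr add0r -scalerBl scalerA -addrA -scalerDl.
  by [].
have en : enorm (center D i + t *: w - (center D i + sg *: w)) = t - sg.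
  by rewrite opprD addrACA subrr add0r -scalerBl enormZ w1 mulr1 ger0_norm// subr_ge0.
have vb v : 0 <= v <= 1 -> sg <= sg + v * (t - sg) /\ sg + v * (t - sg) <= s / 2.
  move=> /andP[v0 v1]; have h : 0 <= t - sg by rewrite subr_ge0.
  split; first by rewrite lerDl mulr_ge0.
  by apply: le_trans ts; have := ler_piMl h v1; lra.
have h1 v : 0 <= v <= 1 -> V (center D i + sg *: w + v *: (center D i + t *: w - (center D i + sg *: w))).
  by move=> /vb[h2 h3]; rewrite e; exact: Vt.
have h2 v : 0 <= v <= 1 -> un (center D i + sg *: w + v *: (center D i + t *: w - (center D i + sg *: w))) <=
   alpha i * beta i / sg ^+ 2 + 65 * M4 * (alpha i + beta i) / sg + 65 * M4 * (65 * M4).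
  by move=> /vb[h2 h3]; rewrite e; exact: factor_n_near.
have := conf_dist_segment V_continuous un0 h1 h2; rewrite en => h; apply: (le_trans h).
have ab0 : 0 <= alpha i * beta i by rewrite mulr_ge0.
have c10 : 0 <= 65 * M4 * (alpha i + beta i) by rewrite mulr_ge0 ?addr_ge0// mulr_ge0//; move: M41; lra.
rewrite lee_fin mulrDl lerD2r mulrDl; apply: lerD.
  rewrite expr2 invfM mulrA -mulrA -[leRHS]mulr1 ler_wpM2l ?divr_ge0 ?(ltW sg0)//.
  by rewrite mulrC ler_pdivrMr// mul1r; lra.
rewrite -mulrA -[leRHS]mulr1 ler_wpM2l//.
by rewrite mulrC ler_pdivrMr// mul1r; lra.
Qed.

(* Each doubling of the radius costs the second term; the first one is a geometric sum. *)
Lemma radial_doubling i w : enorm w = 1 -> forall (k : nat) (sg : R),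
  0 < sg -> sg <= r -> r <= 2 ^+ k * sg -> r <= s / 2 -> V (center D i + sg *: w) ->
  (conf_dist un V (center D i + sg *: w) (center D i + r *: w) <=
   (2 * (alpha i * beta i / sg) + k%:R * (65 * M4 * (alpha i + beta i)) + 65 * M4 * (65 * M4) * (r - sg))%:E)%E.
Proof.
move=> w1; have ab0 : 0 <= alpha i * beta i by rewrite mulr_ge0.
have c10 : 0 <= 65 * M4 * (alpha i + beta i) by rewrite mulr_ge0 ?addr_ge0// mulr_ge0//; move: M41; lra.
elim=> [|k IH] sg sg0 sr rk rs Vs.
  have -> : r = sg by apply/eqP; rewrite eq_le sr andbT; move: rk; rewrite expr0 mul1r.
  rewrite (conf_dist_refl V_continuous un0 Vs) lee_fin subrr mulr0 mul0r !addr0.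
  by rewrite mulr_ge0// divr_ge0// ltW.
have q0 : 0 <= alpha i * beta i / sg by rewrite divr_ge0// ltW.
have [r2|r2] := leP r (2 * sg).
  have [_ h] := radial_leg w1 sg0 sr r2 rs Vs; apply: (le_trans h).
  rewrite lee_fin -natr1; move: c10 q0 => h1 h2.
  have h3 : 0 <= k%:R * (65 * M4 * (alpha i + beta i)) by rewrite mulr_ge0.
  by rewrite mulrDl mul1r; lra.
have sg2 : sg <= 2 * sg by lra.
have [V2 h] := radial_leg w1 sg0 sg2 (lexx _) (le_trans (ltW r2) rs) Vs.
have sg20 : 0 < 2 * sg by lra.
have rk2 : r <= 2 ^+ k * (2 * sg) by rewrite mulrA -exprSr.
have h2 := IH _ sg20 (ltW r2) rk2 rs V2.
apply: le_trans (conf_dist_triangle V_continuous un0 (center D i + (2 * sg) *: w) _ _) _.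
apply: le_trans (leeD h h2) _; rewrite -EFinD lee_fin.
have -> : alpha i * beta i / (2 * sg) = alpha i * beta i / sg / 2 by field; rewrite gt_eqF.
rewrite -natr1; move: (alpha i * beta i / sg) (65 * M4 * (alpha i + beta i)) (65 * M4 * (65 * M4)) => y z v.
by lra.
Qed.

Let r0 : 0 < r. Proof. by rewrite divr_gt0// exprn_gt0. Qed.
Let rs16 : r <= s / 16.
Proof.
have -> : r = s / n%:R by field; rewrite gt_eqF.
rewrite ler_wpM2l ?(ltW s0)// lef_pV2 ?posrE//.
have : 1 <= M4 * M4 by rewrite -[leLHS](mulr1 1); apply: ler_pM.
by move: nlarge; move: (M4 * M4) (n%:R : R) => q N; lra.
Qed.

Variable l : R.
Hypothesis l0 : 0 <= l.
Hypothesis hdouble : forall i, alpha i + beta i != 0 -> alpha i * beta i != 0.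
Hypothesis hl : forall i, alpha i + beta i != 0 ->
  (alpha i + beta i) * `|ln (alpha i * beta i / D ^+ 2)| <= D * l.

(** As sg is at least the neck radius up to a factor, and 2^k sg < r, the product 4^k alpha beta is
    at most 10^4 M4^2 r^2 = 10^4 M4^2 D^2/n^4 <= D^2. The logarithm of this bounds k because ln 4 >=
    1. *)
Lemma doubling_number i (sg : R) : 0 < alpha i * beta i -> 0 < sg -> sg < r ->
  alpha i * beta i <= 10 ^+ 4 * (M4 * M4) * sg ^+ 2 ->
  exists k : nat, r <= 2 ^+ k * sg /\ k%:R <= 1 + `|ln (alpha i * beta i / D ^+ 2)|.
Proof.
move=> ab0 sg0 sr hab; have [k /andP[k1 k2]] := dyadic_scale sg0 sr.
exists k.+1; split; first by rewrite [leRHS]mulrC -ler_pdivrMr ?exprn_gt0.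
rewrite -natr1 addrC lerD2l; apply: nat_le_ln; first by rewrite divr_gt0// exprn_gt0.
have k3 : 2 ^+ k * sg < r by rewrite [ltLHS]mulrC -ltr_pdivlMr ?exprn_gt0.
have -> : 4 ^+ k = (2 ^+ k) ^+ 2 :> R by rewrite -exprM mulnC exprM; congr (_ ^+ _); ring.
rewrite invf_div ler_pdivlMr//.
apply: (@le_trans _ _ ((2 ^+ k) ^+ 2 * (10 ^+ 4 * (M4 * M4) * sg ^+ 2))).
  by rewrite ler_wpM2l// exprn_ge0// exprn_ge0.
have -> : (2 ^+ k) ^+ 2 * (10 ^+ 4 * (M4 * M4) * sg ^+ 2) = 10 ^+ 4 * (M4 * M4) * (2 ^+ k * sg) ^+ 2 by ring.
have m1 : 1 <= M4 * M4 by rewrite -[leLHS](mulr1 1); apply: ler_pM.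
apply: (@le_trans _ _ (10 ^+ 4 * (M4 * M4) * r ^+ 2)).
  apply: ler_wpM2l; first by rewrite mulr_ge0 ?exprn_ge0//; lra.
  by rewrite ler_pXn2r ?nnegrE ?mulr_ge0 ?exprn_ge0 ?(ltW r0) ?(ltW sg0)// ltW.
have -> : 10 ^+ 4 * (M4 * M4) * r ^+ 2 = (10 ^+ 4 * (M4 * M4) / n%:R ^+ 4) * D ^+ 2.
  by field; rewrite gt_eqF.
rewrite ler_piMl ?exprn_ge0 ?(ltW D0)// ler_pdivrMr ?exprn_gt0// mul1r.
apply: (@le_trans _ _ (200 * (200 * (M4 * M4)))).
  have -> : 10 ^+ 4 = 100 * 100 :> R by ring.
  by move: m1; move: (M4 * M4) => q; lra.
by apply: (le_trans nlarge); rewrite ler_eXnr.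
Qed.

(** A point within r of a pole is moved radially to the sphere of radius r. In units of M4^2 D/n the
    terms are 2 * 100 for the geometric sum, 130 for the additional doubling and 65^2 for the
    regular part, below 70^2 in total; the logarithm costs 65 M4 D l. *)
Lemma endpoint x : V x -> exists a : vec3 R,
  [/\ forall j, alpha j + beta j != 0 -> r <= enorm (a - center D j), eball 0 rho a,
      enorm (a - x) <= 2 * r &
      (conf_dist un V x a <= (70 * (70 * (M4 * M4 * D * (n%:R^-1 + l))))%:E)%E].
Proof.
move=> Vx; have Bx := V_ball Vx.
have q0 : 0 <= M4 * M4 * D * (n%:R^-1 + l).
  by rewrite mulr_ge0 ?addr_ge0 ?invr_ge0// ?(ltW nR0)// mulr_ge0 ?(ltW D0)// mulr_ge0//; move: M41; lra.
have [h|/existsNP[i] /not_implyP[Pi /negP]] := pselect (forall j, alpha j + beta j != 0 -> r <= enorm (x - center D j)).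
  exists x; split => //; first by rewrite subrr enorm0 mulr_ge0// ltW.
  rewrite (conf_dist_refl V_continuous un0 Vx) lee_fin; lra.
rewrite -ltNge; set sg := enorm _ => sr.
have sg0 : 0 < sg by rewrite enorm_gt0 subr_eq0; exact: V_not_pole Vx Pi.
pose w := sg^-1 *: (x - center D i).
have w1 : enorm w = 1 by rewrite enormZ ger0_norm ?invr_ge0 ?(ltW sg0)// mulVf ?gt_eqF.
have xE : x = center D i + sg *: w by rewrite scalerA mulfV ?gt_eqF// scale1r addrC subrK.
have ab0 : 0 < alpha i * beta i by rewrite lt_def hdouble// mulr_ge0.
have hab := V_neck hS n0 nlarge hrho hSig i Vx; rewrite -/sg in hab.
have [k [rk kl]] := doubling_number ab0 sg0 sr hab.
have rs2 : r <= s / 2 by move: rs16; move: (s) s0 => e e0; lra.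
have ea : enorm (center D i + r *: w - center D i) = r.
  by rewrite [center D i + _]addrC addrK enormZ w1 mulr1 gtr0_norm.
exists (center D i + r *: w); split.
- move=> j Pj; have [->|ji] := eqVneq j i; first by rewrite ea.
  have h1 := center_dist D0 n0 ji; have h2 := enorm_triangle (center D i + r *: w) (center D j) (center D i).
  rewrite ea (enormBC (center D j) (_ + _)) in h2.
  by move: h1 h2 rs16; move: (s) s0 => e e0; lra.
- by apply: (near_center_ball hS n0 hrho (i := i)); rewrite ea.
- rewrite [X in enorm (_ - X)]xE opprD addrACA subrr add0r -scalerBl enormZ w1 mulr1 ger0_norm ?subr_ge0 ?(ltW sr)//.
  by move: sg0 r0; lra.
have Vx' : V (center D i + sg *: w) by rewrite -xE.
have := radial_doubling w1 sg0 (ltW sr) rk rs2 Vx'; rewrite -xE => h; apply: (le_trans h).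
have c1 := hl Pi; have /andP[_ ha] := alpha_weight hS i n0; have /andP[_ hb] := beta_weight hS i n0.
have m0 : 0 <= M4 by move: M41; lra.
have n3 : D * M4 / n%:R ^+ 3 <= D * M4 / n%:R.
  rewrite ler_wpM2l ?mulr_ge0 ?(ltW D0)// lef_pV2 ?posrE ?exprn_gt0//.
  by rewrite ler_eXnr.
(* The square of the left-hand side is alpha beta times alpha beta / sg^2; the weights bound the
   first factor and the neck radius bounds the second. *)
have t1 : alpha i * beta i / sg <= 100 * (M4 * M4 * D / n%:R).
  have t0 : 0 <= 100 * (M4 * M4 * D / n%:R) by rewrite mulr_ge0// divr_ge0 ?mulr_ge0 ?(ltW D0) ?(ltW nR0).
  rewrite -(ler_pXn2r (n := 2)) ?nnegrE ?divr_ge0 ?(ltW ab0) ?(ltW sg0)//.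
  have -> : (alpha i * beta i / sg) ^+ 2 = (alpha i * beta i) * (alpha i * beta i / sg ^+ 2) by field; rewrite gt_eqF.
  have -> : (100 * (M4 * M4 * D / n%:R)) ^+ 2 = ((D * M4 / n%:R) * (D * M4 / n%:R)) * (10 ^+ 4 * (M4 * M4)) by field; rewrite gt_eqF.
  apply: ler_pM; rewrite ?divr_ge0 ?exprn_ge0 ?(ltW ab0) ?(ltW sg0)//; last by rewrite ler_pdivrMr ?exprn_gt0.
  by apply: ler_pM => //; [apply: le_trans ha _|apply: le_trans hb _].
have t2 : k%:R * (65 * M4 * (alpha i + beta i)) <= 65 * M4 * (D * l) + 130 * (M4 * M4 * D / n%:R).
  apply: (@le_trans _ _ ((1 + `|ln (alpha i * beta i / D ^+ 2)|) * (65 * M4 * (alpha i + beta i)))).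
    by rewrite ler_wpM2r// mulr_ge0 ?addr_ge0// mulr_ge0.
  have -> : (1 + `|ln (alpha i * beta i / D ^+ 2)|) * (65 * M4 * (alpha i + beta i)) =
     65 * M4 * ((alpha i + beta i) * `|ln (alpha i * beta i / D ^+ 2)|) + 65 * M4 * (alpha i + beta i) by ring.
  apply: lerD; first by rewrite ler_wpM2l// mulr_ge0.
  have -> : 130 * (M4 * M4 * D / n%:R) = 65 * M4 * (2 * (D * M4 / n%:R)) by ring.
  by rewrite ler_wpM2l ?mulr_ge0//; move: (le_trans ha n3) (le_trans hb n3); lra.
have t3 : 65 * M4 * (65 * M4) * (r - sg) <= 65 * (65 * (M4 * M4 * D / n%:R)).
  apply: (@le_trans _ _ (65 * M4 * (65 * M4) * (D / n%:R))).
    rewrite ler_wpM2l ?mulr_ge0//; apply: (@le_trans _ _ r); first by rewrite lerBlDr lerDl ltW.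
    by rewrite ler_wpM2l ?(ltW D0)// lef_pV2 ?posrE ?exprn_gt0// ler_eXnr.
  by rewrite le_eqVlt; apply/orP; left; apply/eqP; ring.
rewrite lee_fin.
have y0 : 0 <= M4 * M4 * D / n%:R by rewrite divr_ge0 ?mulr_ge0 ?(ltW D0) ?(ltW nR0).
have z0 : 0 <= D * l by rewrite mulr_ge0// ltW.
have t4 : 65 * M4 * (D * l) <= 65 * (M4 * M4 * (D * l)).
  by rewrite -mulrA ler_pM2l// -mulrA ler_peMl// mulr_ge0.
have t5 : 0 <= M4 * M4 * (D * l) by rewrite mulr_ge0// mulr_ge0.
have -> : M4 * M4 * D * (n%:R^-1 + l) = M4 * M4 * D / n%:R + M4 * M4 * (D * l) by ring.
move: t1 t2 t3 t4 t5 y0; move: (M4 * M4 * D / n%:R) (M4 * M4 * (D * l)) (65 * M4 * (D * l)) => y v z.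
by move: (_ / sg) (k%:R * _) (_ * (r - sg)) => p1 p2 p3; lra.
Qed.

End Endpoint.

(** * The Gromov-Hausdorff bound *)

Section FineMetric.
Context {R : realType}.
Variables (u : vec3 R -> R) (V : set (vec3 R)).
Hypothesis u_cont : forall x, V x -> {for x, continuous u}.
Hypothesis u1 : forall x, 1 <= u x.
Hypothesis u_fin : forall x y, V x -> V y -> (conf_dist u V x y < +oo)%E.
Implicit Types (x y z : vec3 R).

(** The gluing works with real-valued distances; [real_distE] shows that [fine] loses nothing once
    distances are finite. *)
Definition real_dist x y : R := fine (conf_dist u V x y).

Let u0 x : V x -> 0 <= u x. Proof. by move=> _; apply: le_trans (u1 x). Qed.

Lemma real_distE x y : V x -> V y -> conf_dist u V x y = (real_dist x y)%:E.
Proof. by move=> Vx Vy; rewrite fineK// ge0_fin_numE ?conf_dist_ge0 ?u_fin. Qed.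

Lemma real_dist_refl x : V x -> real_dist x x = 0.
Proof. by move=> Vx; rewrite /real_dist conf_dist_refl. Qed.

Lemma real_dist_pos x y : V x -> V y -> real_dist x y = 0 -> x = y.
Proof.
move=> Vx Vy e; have := conf_dist_ge u_cont u0 x y ler01 (fun z _ => u1 z).
rewrite real_distE// e lee_fin mul1r => h; apply/esym/eqP; rewrite -subr_eq0 -enorm_eq0.
by rewrite eq_le h enorm_ge0.
Qed.

Lemma real_dist_sym x y : V x -> V y -> real_dist x y = real_dist y x.
Proof. by move=> _ _; rewrite /real_dist (conf_dist_sym u_cont u0). Qed.

Lemma real_dist_tri y x z : V x -> V y -> V z -> real_dist x z <= real_dist x y + real_dist y z.
Proof.
move=> Vx Vy Vz; rewrite -lee_fin EFinD -!real_distE//.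
exact: (conf_dist_triangle u_cont u0).
Qed.

Lemma real_dist_ge0 x y : V x -> V y -> 0 <= real_dist x y.
Proof. by move=> Vx Vy; rewrite -lee_fin -real_distE// conf_dist_ge0. Qed.

End FineMetric.

Lemma base_sqr_le (R : realType) (D : R) (A B : vec3 R -> R) (alpha beta : forall n, box n -> R) :
  BLR_sum D A B alpha beta -> base_const D A B alpha beta * base_const D A B alpha beta <= factor_const D A B alpha beta.
Proof.
move=> hS; have M41 := base_const_ge1 hS; have M46 := base_le_full hS.
have k1 := @lattice_const_ge R; rewrite /factor_const.
have h : base_const D A B alpha beta <= 2 * lattice_const * full_const D A B alpha beta.
  by move: M41 M46 k1; move: lattice_const (base_const _ _ _ _ _) (full_const _ _ _ _ _) => k m p; nra.
have : base_const D A B alpha beta * base_const D A B alpha beta <= (2 * lattice_const * full_const D A B alpha beta) ^+ 2.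
  by rewrite expr2; apply: ler_pM => //; move: M41; lra.
have MM : 1 <= base_const D A B alpha beta * base_const D A B alpha beta by rewrite -[leLHS](mulr1 1); apply: ler_pM.
by move: (_ ^+ 2) MM => p; lra.
Qed.

Section FixedBound.
Local Opaque factor_const base_const full_const.
Context {R : realType}.
Variables (D : R) (A B : vec3 R -> R) (alpha beta : forall n, box n -> R).
Hypothesis hS : BLR_sum D A B alpha beta.
Variables (n : nat) (Sigma : box n -> set (vec3 R)) (rho : R).
Local Notation M4 := (base_const D A B alpha beta).
Local Notation W := (factor_const D A B alpha beta).
Hypotheses (n0 : (0 < n)%N) (nlarge : 200 * (200 * (M4 * M4)) <= n%:R).
Hypothesis hrho : Num.sqrt 3 * D < rho.
Hypothesis hSig : forall i : box n, alpha i * beta i != 0 -> neck_surface D alpha beta i (Sigma i).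
Variable l : R.
Hypothesis l0 : 0 <= l.
Hypothesis hdouble : forall i : box n, alpha i + beta i != 0 -> alpha i * beta i != 0.
Hypothesis hl : forall i : box n, alpha i + beta i != 0 ->
  (alpha i + beta i) * `|ln (alpha i * beta i / D ^+ 2)| <= D * l.
Local Notation V := (V_region D alpha beta Sigma rho).
Local Notation ball := (eball 0 rho).
Local Notation un := (factor_n D alpha beta n).
Local Notation u := (limit_factor A B).
Local Notation s := (D / n%:R).
Local Notation r := (D / n%:R ^+ 2).
Local Notation T := (n%:R^-1 + l).
Implicit Types (x y z : vec3 R).

Let D0 : 0 < D. Proof. by case: hS. Qed.
Let M41 : 1 <= M4. Proof. exact: base_const_ge1. Qed.
Let MM : 1 <= M4 * M4. Proof. by rewrite -[leLHS](mulr1 1); apply: ler_pM. Qed.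
Let nR : 16 <= n%:R :> R. Proof. by move: MM nlarge; move: (M4 * M4) => q; lra. Qed.
Let n16 : (16 <= n)%N. Proof. by have := nR; rewrite ler_nat. Qed.
Let nR0 : 0 < n%:R :> R. Proof. exact: lt_le_trans nR. Qed.
Let s0 : 0 < s. Proof. by rewrite divr_gt0. Qed.
Let W1 : 1 <= W. Proof. exact: factor_const_ge1. Qed.
Let Drho : D <= rho.
Proof.
apply: ltW; apply: le_lt_trans hrho; rewrite ler_peMl ?(ltW D0)//.
by rewrite -[leLHS]sqrtr1 ler_wsqrtr// ler1n.
Qed.
Let rho0 : 0 < rho. Proof. exact: lt_le_trans D0 Drho. Qed.
Let MW : M4 * M4 <= W. Proof. exact: base_sqr_le. Qed.

Let ucont : continuous u. Proof. exact: (limit_factor_continuous hS). Qed.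
Let u1 x : 1 <= u x. Proof. exact: (limit_factor_ge1 hS). Qed.
Let un1 x : 1 <= un x. Proof. exact: (factor_n_ge1 hS). Qed.
Let un_cont x : V x -> {for x, continuous un}. Proof. exact: (V_continuous hS). Qed.
Let uB x : ball x -> {for x, continuous u}. Proof. by move=> _; exact: ucont. Qed.
Let u0 x : ball x -> 0 <= u x. Proof. by move=> _; apply: le_trans (u1 x). Qed.
Let un0 x : V x -> 0 <= un x. Proof. by move=> _; apply: le_trans (un1 x). Qed.

Lemma limit_dist_le x y : ball x -> ball y ->
  (conf_dist u ball x y <= (W * enorm (y - x))%:E)%E.
Proof.
move=> Bx By; apply: (conf_dist_segment uB u0) => t ht; first exact: eball_convex.
exact: (limit_factor_le hS).
Qed.

Let dist2 x y : ball x -> ball y -> enorm (y - x) <= 2 * rho.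
Proof.
rewrite /eball /= !subr0 => hx hy.
by have := enorm_triangle 0 y x; rewrite subr0 (enormBC 0) subr0; lra.
Qed.

Let lim_fin x y : ball x -> ball y -> (conf_dist u ball x y < +oo)%E.
Proof. by move=> Bx By; apply: le_lt_trans (limit_dist_le Bx By) (ltry _). Qed.

Local Notation d_lim := (real_dist u ball).
Local Notation d_n := (real_dist un V).

Let d_lim_le x y : ball x -> ball y -> d_lim x y <= 2 * (W * rho).
Proof.
move=> Bx By; rewrite -lee_fin -(real_distE uB u1 lim_fin)//; apply: le_trans (limit_dist_le Bx By) _.
rewrite lee_fin mulrCA ler_wpM2l ?dist2//; move: W1; lra.
Qed.

Let T0 : 0 < T. Proof. by rewrite ltr_wpDr// invr_gt0. Qed.
Let nT : n%:R^-1 <= T. Proof. by rewrite lerDl. Qed.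
Let rT : rho / n%:R <= rho * T. Proof. by rewrite ler_pM2l. Qed.
Let rT0 : 0 < rho * T. Proof. by rewrite mulr_gt0. Qed.
Let Dn : D / n%:R <= rho / n%:R. Proof. by rewrite ler_pM2r ?invr_gt0. Qed.

Let Wq q : 0 <= q -> W * q <= W * W * q.
Proof.
move=> q0; have w0 : 0 <= W by move: W1; lra.
have -> : W * W * q = W * (W * q) by ring.
by rewrite ler_peMl// mulr_ge0.
Qed.

(** In units of W^2 rho T the two end points cost 2 * 4900. The chain costs 28 * 3 + 7, since L is
    at most 3 W rho, and replacing L by the distance costs 1: altogether less than 10^4. *)
Lemma dist_n_le x y : V x -> V y ->
  (conf_dist un V x y <= (d_lim x y + 100 * (100 * (W * W * (rho * T))))%:E)%E.
Proof.
move=> Vx Vy; have Bx := V_ball Vx; have By := V_ball Vy.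
have [a [ga Ba ax ha]] := endpoint hS n0 nlarge hrho hSig l0 hdouble hl Vx.
have [b [gb Bb bY hb]] := endpoint hS n0 nlarge hrho hSig l0 hdouble hl Vy.
pose P : pred (box n) := fun j => alpha j + beta j != 0.
(* The summand D/n makes L exceed the distance, so that a curve of length below L exists. *)
pose L := d_lim x y + D / n%:R.
have hL : (conf_dist u ball x y < L%:E)%E.
  by rewrite (real_distE uB u1 lim_fin Bx By) lte_fin ltrDl.
have Vf z : ball z -> (forall j, P j -> D / (2 * n%:R ^+ 2) <= enorm (z - center D j)) -> V z.
  by move=> Bz cz; exact: (V_clear hS n0 nlarge hrho hSig Bz cz).
have ule := factor_n_le_limit hS n0.
have C := chain_dist D0 n16 hrho un_cont un1 Vf ucont u1 (limit_factor_le hS) ule ga gb Ba Bb ax bY hL.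
have hb' : (conf_dist un V b y <= (70 * (70 * (M4 * M4 * D * (n%:R^-1 + l))))%:E)%E.
  by rewrite (conf_dist_sym un_cont un0).
apply: le_trans (conf_dist_triangle un_cont un0 a _ _) _.
apply: le_trans (leeD ha (le_trans (conf_dist_triangle un_cont un0 b _ _) (leeD C hb'))) _.
rewrite -!EFinD lee_fin.
have d0 : 0 <= d_lim x y by exact: (real_dist_ge0 uB u1 lim_fin).
have L3 : L <= 3 * (W * rho).
  have h1 := d_lim_le Bx By.
  have h2 : D / n%:R <= rho by apply: le_trans Dn _; rewrite ler_pdivrMr// ler_peMr ?(ltW rho0)//; move: nR; lra.
  have h3 : rho <= W * rho by rewrite ler_peMl// ltW.
  by rewrite /L; lra.
have L0 : 0 <= L by rewrite addr_ge0// ltW.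
have E1 : (4 * L / s + 1) * (7 * (W * s / n%:R)) = 28 * (W * L / n%:R) + 7 * (W * (D / n%:R) / n%:R).
  by field; rewrite !gt_eqF.
have X1 : M4 * M4 * D * T <= W * W * (rho * T).
  have -> : M4 * M4 * D * T = (M4 * M4) * (D * T) by ring.
  apply: (@le_trans _ _ (W * (rho * T))).
    by apply: ler_pM => //; [move: MM; lra|rewrite mulr_ge0 ?(ltW D0) ?(ltW T0)|rewrite ler_pM2r].
  exact: Wq (ltW rT0).
have W0 : 0 <= W by move: W1; lra.
have WW : W <= W * W by rewrite ler_peMl.
have X2 : W * L / n%:R <= 3 * (W * W * (rho * T)).
  apply: (@le_trans _ _ (W * (3 * (W * rho)) * T)).
    apply: ler_pM => //; [exact: mulr_ge0|exact: ler_wpM2l].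
  by rewrite le_eqVlt; apply/orP; left; apply/eqP; ring.
have nn : n%:R^-1 <= 1 :> R by rewrite invf_le1//; move: nR; lra.
have X3 : W * (D / n%:R) / n%:R <= W * W * (rho * T).
  apply: (@le_trans _ _ (W * (D / n%:R))).
    by rewrite ler_piMr// mulr_ge0// ltW.
  by apply: ler_pM => //; [exact: ltW|exact: le_trans Dn rT].
have X4 : D / n%:R <= W * W * (rho * T).
  apply: le_trans (le_trans Dn rT) _; rewrite ler_peMl ?(ltW rT0)//.
  by apply: le_trans WW.
have X5 : 0 <= W * W * (rho * T) by apply: le_trans X4; exact: ltW.
rewrite E1 /L in X2 *.
move: X1 X2 X3 X4 X5; move: (M4 * M4 * D * T) (W * W * (rho * T)) => q1 q2.
by move: (W * (d_lim x y + D / n%:R) / n%:R) (W * (D / n%:R) / n%:R) (D / n%:R) => q3 q4 q5; lra.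
Qed.

Let W0 : 0 <= W. Proof. by move: W1; lra. Qed.
Let Q0 : 0 < W * W * (rho * T).
Proof. by apply: mulr_gt0 => //; apply: mulr_gt0; apply: lt_le_trans W1. Qed.

Let n_fin x y : V x -> V y -> (conf_dist un V x y < +oo)%E.
Proof. by move=> Vx Vy; apply: le_lt_trans (dist_n_le Vx Vy) _; exact: ltry. Qed.

Lemma d_n_le x y : V x -> V y -> d_n x y <= d_lim x y + 100 * (100 * (W * W * (rho * T))).
Proof. by move=> Vx Vy; rewrite -lee_fin -(real_distE un_cont un1 n_fin Vx Vy) EFinD; exact: dist_n_le. Qed.

(** Scaling by 1 + W/n produces a term W/n times the distance in V, for which the previous lemma
    supplies an upper bound; this costs one more factor W. *)
Lemma d_lim_le_n x y : V x -> V y -> d_lim x y <= d_n x y + 100 * (100 * (W * (W * W * (rho * T)))).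
Proof.
move=> Vx Vy; have Bx := V_ball Vx; have By := V_ball Vy.
have VB : V `<=` ball by exact: V_ball.
have c0 : 0 <= 1 + W / n%:R by rewrite addr_ge0// divr_ge0// ltW.
have scale z : V z -> u z <= (1 + W / n%:R) * un z.
  move=> _; have h : enorm (z - z) <= 3 * s by rewrite subrr enorm0 mulr_ge0// ltW.
  apply: le_trans (limit_le_factor_n hS n0 h) _; rewrite mulrDl mul1r lerD2l.
  by rewrite ler_peMr// divr_ge0// ltW.
have hL : (conf_dist un V x y < (d_n x y + D / n%:R)%:E)%E.
  by rewrite (real_distE un_cont un1 n_fin Vx Vy) lte_fin ltrDl.
have := conf_dist_scale VB c0 uB un_cont u0 un0 scale hL.
rewrite (real_distE uB u1 lim_fin Bx By) lee_fin => h; apply: (le_trans h).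
have h1 := d_n_le Vx Vy; have h2 := d_lim_le Bx By.
have dn0 : 0 <= d_n x y by exact: (real_dist_ge0 un_cont un1 n_fin).
have Wn : W / n%:R * d_n x y <= 2 * (W * W * (rho * T)) + 100 * (100 / 16 * (W * (W * W * (rho * T)))).
  apply: (@le_trans _ _ (W / n%:R * (2 * (W * rho) + 100 * (100 * (W * W * (rho * T)))))).
    by apply: ler_wpM2l; [rewrite divr_ge0// ltW|lra].
  rewrite mulrDr; apply: lerD.
    have -> : W / n%:R * (2 * (W * rho)) = 2 * (W * W * (rho / n%:R)) by ring.
    by rewrite ler_pM2l// ler_wpM2l// mulr_ge0.
  have -> : W / n%:R * (100 * (100 * (W * W * (rho * T)))) = 100 * (100 * (W * (W * W * (rho * T)) / n%:R)) by ring.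
  have q : W * (W * W * (rho * T)) / n%:R <= 16^-1 * (W * (W * W * (rho * T))).
    rewrite [leLHS]mulrC; apply: ler_wpM2r; first by rewrite mulr_ge0// ltW.
    by rewrite lef_pV2 ?posrE.
  by move: q; move: (W * (W * W * (rho * T)) / n%:R) (W * (W * W * (rho * T))) => y1 y2; lra.
have WWW : W * W * (rho * T) <= W * (W * W * (rho * T)) by rewrite ler_peMl// ltW.
have WD : D / n%:R <= W * W * (rho * T).
  apply: le_trans (le_trans Dn rT) _; rewrite ler_peMl ?(ltW rT0)//.
  by rewrite -[leLHS](mulr1 1); apply: ler_pM.
have nn : n%:R^-1 <= 1 :> R by rewrite invf_le1//; move: nR; lra.
have WD2 : W / n%:R * (D / n%:R) <= W * (W * W * (rho * T)).
  apply: ler_pM => //; rewrite ?divr_ge0 ?(ltW D0) ?(ltW nR0)//.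
  by rewrite ler_piMr.
have -> : (1 + W / n%:R) * (d_n x y + D / n%:R) = d_n x y + D / n%:R + W / n%:R * d_n x y + W / n%:R * (D / n%:R) by ring.
move: Wn WWW WD WD2 Q0; move: (W / n%:R * d_n x y) (W / n%:R * (D / n%:R)) (D / n%:R) => p1 p2 p3.
by move: (W * (W * W * (rho * T))) (W * W * (rho * T)) => p4 p5; lra.
Qed.

Lemma V_dense y : ball y -> exists2 x, V x & d_lim x y <= 2 * (W * W * (rho * T)).
Proof.
move=> By.
have rb : 0 <= r <= s / 8.
  have rE : r = s / n%:R by field; rewrite gt_eqF.
  rewrite rE divr_ge0 ?(ltW s0) ?(ltW nR0)//= ler_wpM2l ?(ltW s0)// lef_pV2 ?posrE//.
  by move: nR; lra.
have [a [a1 a2 a3]] := good_point D0 n0 y rb.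
have Ba : ball a by have := a3 rho hrho; have := By; rewrite /eball /= !subr0 => h; apply.
have Va : V a.
  apply: (V_clear hS n0 nlarge hrho hSig Ba) => j _; apply: le_trans (a2 j).
  have -> : D / (2 * n%:R ^+ 2) = r / 2 by field; rewrite gt_eqF.
  by case/andP: rb; lra.
exists a => //; rewrite -lee_fin -(real_distE uB u1 lim_fin Ba By).
apply: le_trans (limit_dist_le Ba By) _; rewrite lee_fin.
have rr : r <= rho * T.
  apply: le_trans (le_trans Dn rT); rewrite ler_wpM2l ?(ltW D0)// lef_pV2 ?posrE ?exprn_gt0// expr2 ler_peMl ?(ltW nR0)//.
  by move: nR; lra.
apply: (@le_trans _ _ (W * (2 * (rho * T)))); first by rewrite ler_wpM2l//; lra.
by have := Wq (ltW rT0); move: (W * (rho * T)) (mulrCA W 2 (rho * T)) => q1 ->; lra.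
Qed.

Lemma GH_bound : (GH_dist V (conf_dist un V) ball (conf_dist u ball) <=
  (100 * (60 * (W * (W * W * (rho * T)))))%:E)%E.
Proof.
have Q30 : 0 < W * (W * W * (rho * T)) by apply: mulr_gt0 => //; exact: lt_le_trans W1.
have Q23 : W * W * (rho * T) <= W * (W * W * (rho * T)) by rewrite ler_peMl// ltW.
have B0 : ball 0 by rewrite /eball /= subrr enorm0.
have [x0 Vx0 _] := V_dense B0.
have VB : V `<=` ball by exact: V_ball.
(* The bridge length is half of the discrepancy 10^4 W^3 rho T that both comparisons allow. *)
have e0 : 0 < 50 * (100 * (W * (W * W * (rho * T)))) by apply: mulr_gt0 => //; exact: mulr_gt0.
have e'0 : 0 <= 2 * (W * W * (rho * T)) by rewrite mulr_ge0// ltW.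
have V0 : V !=set0 by exists x0.
apply: (@le_trans _ _ (50 * (100 * (W * (W * W * (rho * T)))) + 2 * (W * W * (rho * T)))%:E); last first.
  by rewrite lee_fin; move: Q30 Q23; move: (W * (W * W * (rho * T))) (W * W * (rho * T)) => q1 q2; lra.
apply: (@GH_dist_glue R (vec3 R) V ball d_n d_lim _ VB V0 e0) => //.
- by move=> x Vx; exact: (real_dist_refl un_cont un1).
- by move=> x y; exact: (real_dist_pos un_cont un1 n_fin).
- by move=> x y; exact: (real_dist_sym un_cont un1).
- by move=> y x z; exact: (real_dist_tri un_cont un1 n_fin).
- by move=> x Vx; exact: (real_dist_refl uB u1).
- by move=> x y; exact: (real_dist_pos uB u1 lim_fin).
- by move=> x y; exact: (real_dist_sym uB u1).
- by move=> y x z; exact: (real_dist_tri uB u1 lim_fin).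
- move=> x y Vx Vy; apply: le_trans (d_n_le Vx Vy) _; rewrite lerD2l.
  by move: Q23; move: (W * (W * W * (rho * T))) (W * W * (rho * T)) => q1 q2; lra.
- move=> x y Vx Vy; apply: le_trans (d_lim_le_n Vx Vy) _; rewrite lerD2l.
  by move: (W * (W * W * (rho * T))) => q1; lra.
- by move=> x y Vx Vy; exact: (real_distE un_cont un1 n_fin).
- by move=> x y Bx By; exact: (real_distE uB u1 lim_fin).
- move=> y By; have [x Vx h] := V_dense By; exists x => //.
Qed.

End FixedBound.

(** * The constants as polynomials *)

Section Coefficients.
Context {R : realType} {k : nat}.
Implicit Types (p q : mpoly.mpoly k R) (c : R).

Lemma nonneg_coefsC c : 0 <= c -> nonneg_coefs (mpoly.mpolyC k c).
Proof. by move=> c0 m; rewrite mpoly.mcoeffC mulr_ge0. Qed.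

Lemma nonneg_coefsM p q : nonneg_coefs p -> nonneg_coefs q -> nonneg_coefs (p * q).
Proof. by move=> hp hq m; rewrite mpoly.mcoeffM sumr_ge0// => i _; rewrite mulr_ge0. Qed.

Definition one_plus_vars : mpoly.mpoly k R :=
  mpoly.mpolyC k 1 + \sum_(i < k) mpoly.mpolyX R (mpoly.mnm1 i).

Lemma nonneg_one_plus_vars : nonneg_coefs one_plus_vars.
Proof.
move=> m; rewrite mpoly.mcoeffD mpoly.mcoeffC addr_ge0 ?mulr_ge0//.
rewrite raddf_sum /= sumr_ge0// => i _.
by rewrite mpoly.mcoeffX.
Qed.

Lemma meval_one_plus_vars (v : 'I_k -> R) :
  mpoly.meval v one_plus_vars = 1 + \sum_(i < k) v i.
Proof.
rewrite mpoly.mevalD mpoly.mevalC raddf_sum /=; congr (_ + _).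
by apply: eq_bigr => i _; rewrite mpoly.mevalXU.
Qed.

(** The polynomial form of 10^4 W^3. The bound obtained by gluing has 6000 instead, which leaves
    room for the strict inequality. *)
Definition bound_poly : mpoly.mpoly k R :=
  let v := mpoly.mpolyC k (2 * lattice_const) * one_plus_vars in
  let w := mpoly.mpolyC k 3 * (v * v) in
  mpoly.mpolyC k 100 * (mpoly.mpolyC k 100 * (w * (w * w))).

Lemma nonneg_bound_poly : nonneg_coefs bound_poly.
Proof.
have l0 : 0 <= 2 * @lattice_const R by rewrite mulr_ge0// ltW// lattice_const_ge0.
by rewrite /bound_poly; do !(apply: nonneg_coefsM || exact: nonneg_coefsC || exact: nonneg_one_plus_vars).
Qed.

Lemma meval_bound_poly (v : 'I_k -> R) :
  let w := 3 * (2 * lattice_const * (1 + \sum_(i < k) v i)) ^+ 2 in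
  mpoly.meval v bound_poly = 100 * (100 * (w * (w * w))).
Proof. by rewrite /bound_poly !mpoly.mevalM !mpoly.mevalC meval_one_plus_vars expr2. Qed.

End Coefficients.

Section Constants.
Context {R : realType}.
Variables (D : R) (A B : vec3 R -> R) (alpha beta : forall n, box n -> R).

Lemma sum_vars_C : 1 + \sum_(i < 4) vars_C D A B alpha beta i = base_const D A B alpha beta.
Proof. by rewrite !big_ord_recl big_ord0 /vars_C /= addr0 !addrA. Qed.

Lemma sum_vars_Cplus : 1 + \sum_(i < 6) vars_Cplus D A B alpha beta i = full_const D A B alpha beta.
Proof. by rewrite !big_ord_recl big_ord0 /vars_Cplus /= addr0 !addrA. Qed.

End Constants.

(** The threshold 200 * 200 * m^2 under which the remainder in [neck_balance] stays below 1/2. *)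
Definition large_poly (R : realType) : mpoly.mpoly 4 R :=
  mpoly.mpolyC 4 200 * (mpoly.mpolyC 4 200 * (one_plus_vars * one_plus_vars)).

(** Of degree one in the radius, which enters through the bound on distances in the ball and through
    D <= rho. *)
Definition rate_poly (R : realType) : {poly mpoly.mpoly 6 R} := 'X * bound_poly%:P.

Lemma large_polyE (R : realType) (D : R) (A B : vec3 R -> R) (alpha beta : forall n, box n -> R) :
  const_C (large_poly R) D A B alpha beta =
  200 * (200 * (base_const D A B alpha beta * base_const D A B alpha beta)).
Proof. by rewrite /const_C !mpoly.mevalM !mpoly.mevalC meval_one_plus_vars sum_vars_C. Qed.

Lemma rate_polyE (R : realType) (D : R) (A B : vec3 R -> R) (alpha beta : forall n, box n -> R) (rho : R) :
  let w := factor_const D A B alpha beta in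
  const_CplusR (rate_poly R) D A B alpha beta rho = rho * (100 * (100 * (w * (w * w)))).
Proof.
rewrite /const_CplusR /rate_poly rmorphM /= map_polyX map_polyC hornerM hornerX hornerC /=.
by rewrite meval_bound_poly sum_vars_Cplus.
Qed.

Lemma nonneg_rate_poly (R : realType) : nonneg_coefs_poly (rate_poly R).
Proof.
move=> j m; rewrite /rate_poly coefXM; case: eqP => _; first by rewrite mpoly.mcoeff0.
by rewrite coefC; case: eqP => _; [exact: nonneg_bound_poly|rewrite mpoly.mcoeff0].
Qed.

Lemma nonneg_large_poly (R : realType) : nonneg_coefs (large_poly R).
Proof.
by do !(apply: nonneg_coefsM || exact: nonneg_coefsC || exact: nonneg_one_plus_vars).
Qed.

Section Ell.
Context {R : realType}.
Variables (D : R) (alpha beta : forall n, box n -> R) (n : nat).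
Hypotheses (D0 : 0 < D) (n0 : (0 < n)%N).

Lemma center_inj (i j : box n) : center D i = center D j -> i = j.
Proof.
move=> e; apply/eqP; apply: contraT => ij; have := center_dist D0 n0 ij.
by rewrite e subrr enorm0 leNgt divr_gt0 ?ltr0n.
Qed.

(** A finite value means that the two sets of poles coincide; as distinct boxes have distinct
    centers, this carries over to the indices. The bound for each box is its term in the maximum. *)
Lemma ell_fin : (ell D alpha beta n < +oo)%E -> exists l : R,
  [/\ ell D alpha beta n = l%:E, 0 <= l,
      forall i : box n, alpha i + beta i != 0 -> alpha i * beta i != 0 &
      forall i : box n, alpha i + beta i != 0 ->
        (alpha i + beta i) * `|ln (alpha i * beta i / D ^+ 2)| <= D * l].
Proof.
rewrite /ell; case: asboolP => // dp _.
set l := \big[_/_]_(_ | _) _; exists l; split => //.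
- exact: bigmax_ge_id.
- move=> i Pi; have : double_poles D alpha beta n (center D i) by rewrite dp; exists i.
  by move=> [j /= abj /center_inj <-].
- move=> i Pi.
  have h : D^-1 * (alpha i + beta i) * `|ln (alpha i * beta i / D ^+ 2)| <= l.
    by rewrite /l (bigD1 i)//= le_max lexx.
  by rewrite -ler_pdivrMl// mulrA.
Qed.

End Ell.

Lemma GH_rate (R : realType) (D : R) (A B : vec3 R -> R) (alpha beta : forall n, box n -> R) (rho : R)
    (n : nat) (Sigma : box n -> set (vec3 R)) :
  BLR_sum D A B alpha beta -> Num.sqrt 3 * D < rho -> (0 < n)%N ->
  const_C (large_poly R) D A B alpha beta <= n%:R ->
  (forall i, alpha n i * beta n i != 0 -> neck_surface D alpha beta i (Sigma i)) ->
  (ell D alpha beta n < +oo)%E ->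
  (GH_dist (V_region D alpha beta Sigma rho)
     (conf_dist (factor_n D alpha beta n) (V_region D alpha beta Sigma rho))
     (eball 0 rho) (conf_dist (limit_factor A B) (eball 0 rho))
   < (const_CplusR (rate_poly R) D A B alpha beta rho)%:E * ((n%:R^-1)%:E + ell D alpha beta n))%E.
Proof.
move=> hS hrho n0; rewrite large_polyE => nl hSig /(ell_fin (BLR_D_gt0 hS) n0)[l [-> l0 hd hl]].
apply: le_lt_trans (GH_bound hS n0 nl hrho hSig l0 hd hl) _.
rewrite rate_polyE -EFinD -EFinM lte_fin.
have W1 := factor_const_ge1 hS; move: (factor_const _ _ _ _ _) W1 => w w1.
have D0 := BLR_D_gt0 hS.
have rho0 : 0 < rho.
  by apply: le_lt_trans hrho; rewrite mulr_ge0 ?sqrtr_ge0// ltW.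
have T0 : 0 < n%:R^-1 + l by rewrite ltr_wpDr// invr_gt0 ltr0n.
have -> : rho * (100 * (100 * (w * (w * w)))) * (n%:R^-1 + l) = 100 * (100 * (w * (w * w * (rho * (n%:R^-1 + l))))) by ring.
have : 0 < w * (w * w * (rho * (n%:R^-1 + l))) by rewrite !mulr_gt0//; lra.
by move: (w * (w * w * _)) => q; lra.
Qed.

Lemma no_deep_wells_ell_fin (R : realType) (D : R) (alpha beta : forall n, box n -> R) (n : nat) :
  ~ deep_wells D alpha beta -> (0 < n)%N -> (ell D alpha beta n < +oo)%E.
Proof.
move=> ndw n0; rewrite /ell asboolT ?ltry//.
by apply: contrapT => ne; apply: ndw; left; exists n.
Qed.

Theorem theorem1p15 (R : realType) :
  exists (C : {poly mpoly.mpoly 6 R}) (N : mpoly.mpoly 4 R),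
    [/\ nonneg_coefs_poly C, nonneg_coefs N &
    forall (D : R) (A B : vec3 R -> R) (alpha beta : forall n, box n -> R)
           (rho : R),
      BLR_sum D A B alpha beta ->
      Num.sqrt 3 * D < rho ->
      (forall (n : nat) (Sigma : box n -> set (vec3 R)),
         (0 < n)%N ->
         const_C N D A B alpha beta <= n%:R ->
         (forall i, alpha n i * beta n i != 0 ->
            neck_surface D alpha beta i (Sigma i)) ->
         (ell D alpha beta n < +oo)%E ->
         (GH_dist
            (V_region D alpha beta Sigma rho)
            (conf_dist (factor_n D alpha beta n)
                       (V_region D alpha beta Sigma rho))
            (eball 0 rho)
            (conf_dist (limit_factor A B) (eball 0 rho))
          < (const_CplusR C D A B alpha beta rho)%:E *
            ((n%:R^-1)%:E + ell D alpha beta n))%E)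
      /\
      (forall Sigma : forall n, box n -> set (vec3 R),
         (\forall n \near \oo, forall i, alpha n i * beta n i != 0 ->
            neck_surface D alpha beta i (Sigma n i)) ->
         shallow_wells D alpha beta ->
         GH_dist
           (V_region D alpha beta (Sigma n) rho)
           (conf_dist (factor_n D alpha beta n)
                      (V_region D alpha beta (Sigma n) rho))
           (eball 0 rho)
           (conf_dist (limit_factor A B) (eball 0 rho))
         @[n --> \oo] --> 0%E)].
Proof.
exists (rate_poly R), (large_poly R).
split; [exact: nonneg_rate_poly|exact: nonneg_large_poly|].
move=> D A B alpha beta rho hS hrho; split.
  by move=> n Sigma n0 nl hSig; exact: GH_rate.
move=> Sigma hSig [ndw l0].
set C := const_CplusR (rate_poly R) D A B alpha beta rho.
have hup : (C%:E * ((n%:R^-1)%:E + ell D alpha beta n))%E @[n --> \oo] --> 0%E.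
  rewrite -[X in _ --> X](mule0 C%:E) -[X in (_ * X)%E](add0e 0%E).
  apply: cvgeZl => //; apply: cvgeD => //.
  apply: cvg_EFin; first by near=> n.
  have -> : fine \o (fun n : nat => (n%:R^-1 : R)%:E) = (fun n : nat => n%:R^-1) by [].
  (* [cvg_harmonic] is about 1/(n+1), hence the shift by one. *)
  rewrite -(cvg_shiftS (fun n : nat => n%:R^-1 : R)) /=; exact: cvg_harmonic.
apply: (squeeze_cvge _ (cvg_cst 0%E) hup).
near=> n; apply/andP; split.
  apply: GH_dist_ge0; exists 0; rewrite /eball /= subrr enorm0.
  by apply: le_lt_trans hrho; rewrite mulr_ge0 ?sqrtr_ge0// ltW// (BLR_D_gt0 hS).
have n0 : (0 < n)%N by near: n; exact: nbhs_infty_gt.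
apply/ltW/GH_rate => //; last exact: no_deep_wells_ell_fin.
- by near: n; exact: nbhs_infty_ger.
- by near: n.
Unshelve. all: by end_near.
Qed.
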